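(* Let $\lambda\in\Lambda$. The $\mathfrak u$-module $\mathcal V(\lambda)$ has the same simple $\mathfrak u$-socle and the same simple $\mathfrak u$-head as $\nabla(\lambda)$; that is, the socles of $\mathcal V(\lambda)$ and $\nabla(\lambda)$ are simple and isomorphic as $\mathfrak u$-modules, and the heads of $\mathcal V(\lambda)$ and $\nabla(\lambda)$ are simple and isomorphic as $\mathfrak u$-modules.
   Context: Fix $n\ge 1$ and the Cartan matrix $A=(A_{ij})$ of type $\mathrm A_n$. $\mathbf U$ is the Drinfeld-Jimbo quantum algebra over $\mathbb Q(v)$ associated to $A$, with generators $E_i,F_i,K_i^{\pm1}$, $i\in[1,n]$, and standard relations. With $\mathcal A=\mathbb Z[v,v^{-1}]$, $U$ is Lusztig's $\mathcal A$-subalgebra of $\mathbf U$ generated by the divided powers $E_i^{(r)}=E_i^r/[r]!$, $F_i^{(r)}=F_i^r/[r]!$ and $K_i^{\pm1}$ ($i\in[1,n]$, $r\in\mathbb N$), where $[s]=\frac{v^s-v^{-s}}{v-v^{-1}}$ and $[r]!=\prod_{s=1}^r[s]$. $\ell>2$ is an odd integer, $\phi_\ell$ is the $\ell$-th cyclotomic polynomial, $\mathcal K=\mathbb Q[v]/(\phi_\ell)$, $\zeta$ is the image of $v$ in $\mathcal K$, and $U_{\mathcal K}=U\otimes_{\mathcal A}\mathcal K$; $x\otimes1$ is written $x$. $\mathfrak u$ (resp. $\mathfrak u^\flat$) is the $\mathcal K$-subalgebra of $U_{\mathcal K}$ generated by all $E_i,F_i,K_i$ (resp. all $F_i,K_i$).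 $R$ is the root system with positive system $R^+$ and simple roots $\alpha_1,\dots,\alpha_n$; $\Lambda$ is the weight lattice and $\lambda_i=\langle\lambda,\alpha_i^\vee\rangle$ for $\lambda\in\Lambda$. For $\lambda\in\Lambda$ let $\lambda$ also denote the 1-dimensional $\mathfrak u^\flat$-module on which all $F_i$ act by $0$ and $K_i$ by $\zeta^{\lambda_i}$. The infinitesimal Verma module is $\nabla(\lambda)=\operatorname{Hom}_{\mathfrak u^\flat}(\mathfrak u,\lambda)$ (homomorphisms of left $\mathfrak u^\flat$-modules) with $\mathfrak u$-action $(xf)(y)=f(yx)$. The module $\mathcal V(\lambda)$: index $R^+$ by pairs $(i,j)$, $1\le i\le j\le n$, and write $m_{ij}$ for the $(i,j)$-component of $\mathbf m\in(\mathbb Z/\ell\mathbb Z)^{|R^+|}$. $\mathcal V(\lambda)$ is the $\mathcal K$-vector space with basis $u_{\mathbf m}$, $\mathbf m\in(\mathbb Z/\ell\mathbb Z)^{|R^+|}$, which is a $\mathfrak u$-module by $$E_iu_{\mathbf m}=\sum_{k=i}^n[m_{ik}+m_{i,k-1}-m_{i-1,k-1}-m_{i+1,k}]\,u_{\mathbf m+\epsilon(i,k)+\dots+\epsilon(i,n)},$$ $$F_iu_{\mathbf m}=\sum_{k=1}^i[-\lambda_i+m_{i+1-k,n-k}-m_{i+1-k,n+1-k}+m_{i-k,n+1-k}-m_{i-k,n-k}]\,u_{\mathbf m-\epsilon(i+1-k,n+1-k)-\epsilon(i+2-k,n+2-k)-\dots-\epsilon(i,n)},$$ $$K_iu_{\mathbf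 m}=\zeta^{\lambda_i+2m_{in}-m_{i-1,n}-m_{i+1,n}}u_{\mathbf m},$$ where here $[r]=\frac{\zeta^r-\zeta^{-r}}{\zeta-\zeta^{-1}}$, $\epsilon(i,j)\in(\mathbb Z/\ell\mathbb Z)^{|R^+|}$ has $(s,t)$-component $\delta_{is}\delta_{jt}$, and any meaningless term ($m_{st}$ with $(s,t)$ not satisfying $1\le s\le t\le n$) is read as $0$. *)

(* Defs.v *)
From HB Require Import structures.
From mathcomp Require Import all_boot all_order all_algebra all_field.
From mathcomp Require Import boolp functions.
From mathcomp Require Import monalg.

Set Implicit Arguments.
Unset Strict Implicit.
Unset Printing Implicit Defensive.

Import GRing.Theory.
Local Open Scope ring_scope.
Local Open Scope quotient_scope.

Section SubQuotient.
Variables (R : pzRingType) (M : lmodType R) (N : submodClosed M).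

Record submod : predArgType := Submod { submod_val : M; _ : submod_val \in N }.

HB.instance Definition _ := [isSub for submod_val].
HB.instance Definition _ := [Choice of submod by <:].
HB.instance Definition _ := [SubChoice_isSubLmodule of submod by <:].

(* [submodClosed] does not provide the closure under opposites that
   [Quotient.quot] asks for. *)
Definition submod_zmod : {pred M} := N.

Lemma submod_zmod_closed : zmod_closed submod_zmod.
Proof.
split=> [|x y Nx Ny]; first exact: (rpred0 N).
by rewrite -scaleN1r; apply: (rpredD (S := N)); last exact: (rpredZ (s := N)).
Qed.

HB.instance Definition _ :=
  GRing.isZmodClosed.Build M submod_zmod submod_zmod_closed.

Definition quotmod : Type := Quotient.quot submod_zmod.

HB.instance Definition _ := GRing.Zmodule.on quotmod.

Definition quotmod_pi (x : M) : quotmod := \pi_(Quotient.quot submod_zmod) x.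
Definition quotmod_repr (x : quotmod) : M :=
  repr (x : Quotient.quot submod_zmod).

Lemma quotmod_piE (x y : M) : quotmod_pi x = quotmod_pi y <-> x - y \in N.
Proof.
split=> [/eqP|H]; first by rewrite -Quotient.idealrBE.
by apply/eqP; rewrite -Quotient.idealrBE.
Qed.

Lemma quotmod_piD : {morph quotmod_pi : x y / x + y}.
Proof. exact: raddfD. Qed.

Lemma quotmod_reprK : cancel quotmod_repr quotmod_pi.
Proof. by move=> x; apply: reprK. Qed.

Definition quotmod_scale (a : R) (x : quotmod) : quotmod :=
  quotmod_pi (a *: quotmod_repr x).

Lemma quotmod_scaleE a (x : M) :
  quotmod_scale a (quotmod_pi x) = quotmod_pi (a *: x).
Proof.
apply/quotmod_piE; rewrite -scalerBr rpredZ //.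
by apply/quotmod_piE; rewrite quotmod_reprK.
Qed.

Lemma quotmod_scaleA a b x :
  quotmod_scale a (quotmod_scale b x) = quotmod_scale (a * b) x.
Proof. by rewrite -[x]quotmod_reprK !quotmod_scaleE scalerA. Qed.

Lemma quotmod_scale1 : left_id 1 quotmod_scale.
Proof. by move=> x; rewrite -[x]quotmod_reprK quotmod_scaleE scale1r. Qed.

Lemma quotmod_scaleDr : right_distributive quotmod_scale +%R.
Proof.
move=> a x y; rewrite -[x]quotmod_reprK -[y]quotmod_reprK.
by rewrite -quotmod_piD !quotmod_scaleE scalerDr quotmod_piD.
Qed.

Lemma quotmod_scaleDl x : {morph quotmod_scale^~ x : a b / a + b}.
Proof.
move=> a b; rewrite -[x]quotmod_reprK.
by rewrite !quotmod_scaleE scalerDl quotmod_piD.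
Qed.

HB.instance Definition _ := GRing.Zmodule_isLmodule.Build R quotmod
  quotmod_scaleA quotmod_scale1 quotmod_scaleDr quotmod_scaleDl.

End SubQuotient.

Definition simple_module (R : pzRingType) (M : lmodType R) : Prop :=
  (exists x : M, x != 0) /\
  forall N : submodClosed M,
    (forall x, x \in N -> x = 0) \/ (forall x, x \in N).

Definition isomorphic_modules (R : pzRingType) (M M' : lmodType R) : Prop :=
  exists f : {linear M -> M'}, bijective f.

Definition maximal_submodule (R : pzRingType) (M : lmodType R)
    (N : submodClosed M) : Prop :=
  (exists x, x \notin N) /\
  forall P : submodClosed M, {subset N <= P} ->
    {subset P <= N} \/ (forall x, x \in P).

Section SocleHead.
Variables (R : pzRingType) (M : lmodType R).

Definition in_simple_submodule (x : M) : Prop :=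
  exists2 N : submodClosed M, simple_module (submod N) & x \in N.

Definition socle_pred : {pred M} := fun x =>
  `[< exists2 s : seq M,
        (forall y, y \in s -> in_simple_submodule y) & x = \sum_(y <- s) y >].

Definition radical_pred : {pred M} := fun x =>
  `[< forall N : submodClosed M, maximal_submodule N -> x \in N >].

Lemma socle_closed : subsemimod_closed socle_pred.
Proof.
split; first split.
- by apply/asboolP; exists [::] => //; rewrite big_nil.
- move=> x y /asboolP[s Hs ->] /asboolP[t Ht ->]; apply/asboolP.
  exists (s ++ t); last by rewrite big_cat.
  by move=> z; rewrite mem_cat => /orP[/Hs|/Ht].
- move=> a x /asboolP[s Hs ->]; apply/asboolP.
  exists [seq a *: y | y <- s]; last by rewrite big_map scaler_sumr.
  by move=> z /mapP[y /Hs[N sN Ny] ->]; exists N => //; rewrite rpredZ.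
Qed.

HB.instance Definition _ :=
  GRing.isSubmodClosed.Build R M socle_pred socle_closed.

Lemma radical_closed : subsemimod_closed radical_pred.
Proof.
split; first split.
- by apply/asboolP => N _; rewrite rpred0.
- move=> x y /asboolP Hx /asboolP Hy; apply/asboolP => N mN.
  by rewrite rpredD ?Hx ?Hy.
- by move=> a x /asboolP Hx; apply/asboolP => N mN; rewrite rpredZ ?Hx.
Qed.

HB.instance Definition _ :=
  GRing.isSubmodClosed.Build R M radical_pred radical_closed.

Definition modsocle : lmodType R := submod socle_pred.
Definition modhead : lmodType R := quotmod radical_pred.

End SocleHead.

Section Coinduction.
Variables (S R : pzRingType) (iota : S -> R) (L : lmodType S).

(* Hom_S(R, L), where [S] acts on [R] on the left through [iota]; [R] then
   acts by [(r f)(x) = f (x r)]. *)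
Definition coind_pred : {pred R -> L} := fun f =>
  `[< {morph f : x y / x + y} /\ forall s x, f (iota s * x) = s *: f x >].

Lemma coind_zmod_closed : zmod_closed coind_pred.
Proof.
split.
  apply/asboolP; split=> [x y|s x]; rewrite /GRing.zero /=.
    by rewrite /cst addr0.
  by rewrite /cst scaler0.
move=> f g /asboolP[fD fZ] /asboolP[gD gZ]; apply/asboolP; split=> [x y|s x].
  by rewrite /GRing.add /GRing.opp /= fD gD opprD addrACA.
by rewrite /GRing.add /GRing.opp /= fZ gZ scalerBr.
Qed.

HB.instance Definition _ :=
  GRing.isZmodClosed.Build (R -> L) coind_pred coind_zmod_closed.

Record coind : Type := Coind { coind_val : R -> L; _ : coind_val \in coind_pred }.

HB.instance Definition _ := [isSub for coind_val].
HB.instance Definition _ := [Choice of coind by <:].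
HB.instance Definition _ := [SubChoice_isSubZmodule of coind by <:].

Lemma coind_scale_subproof (r : R) (f : coind) :
  (fun x => coind_val f (x * r)) \in coind_pred.
Proof.
case: f => f /= /asboolP[fD fZ]; apply/asboolP; split=> [x y|s x].
  by rewrite mulrDl fD.
by rewrite -mulrA fZ.
Qed.

Definition coind_scale (r : R) (f : coind) : coind :=
  Coind (coind_scale_subproof r f).

Lemma coind_scaleA a b f :
  coind_scale a (coind_scale b f) = coind_scale (a * b) f.
Proof. by apply/val_inj/funext => x /=; rewrite mulrA. Qed.

Lemma coind_scale1 : left_id 1 coind_scale.
Proof. by move=> f; apply/val_inj/funext => x /=; rewrite mulr1. Qed.

Lemma coind_scaleDr : right_distributive coind_scale +%R.
Proof. by move=> a f g; apply/val_inj/funext. Qed.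

Lemma coind_scaleDl f : {morph coind_scale^~ f : a b / a + b}.
Proof.
move=> a b; apply/val_inj/funext => x /=.
by case: f => f /= /asboolP[fD _]; rewrite mulrDr fD.
Qed.

HB.instance Definition _ := GRing.Zmodule_isLmodule.Build R coind
  coind_scaleA coind_scale1 coind_scaleDr coind_scaleDl.

End Coinduction.

Notation free_alg F X := {malg F[{fmonom X}]}.

Section Presentation.
Variables (F : fieldType) (X : choiceType) (rel : free_alg F X -> Prop).

Inductive ideal_gen : free_alg F X -> Prop :=
| ideal_rel x : rel x -> ideal_gen x
| ideal_0 : ideal_gen 0
| ideal_D x y : ideal_gen x -> ideal_gen y -> ideal_gen (x + y)
| ideal_Z a x : ideal_gen x -> ideal_gen (a *: x)
| ideal_Ml a x : ideal_gen x -> ideal_gen (a * x)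
| ideal_Mr a x : ideal_gen x -> ideal_gen (x * a).

Definition ideal_pred : {pred free_alg F X} := fun x => `[< ideal_gen x >].

Lemma ideal_closed : subsemimod_closed ideal_pred.
Proof.
split; first split.
- exact/asboolP/ideal_0.
- by move=> x y /asboolP Hx /asboolP Hy; apply/asboolP/ideal_D.
- by move=> a x /asboolP Hx; apply/asboolP/ideal_Z.
Qed.

HB.instance Definition _ :=
  GRing.isSubmodClosed.Build F (free_alg F X) ideal_pred ideal_closed.

(* Only a [pzRingType]: for arbitrary relations the quotient may be zero. *)
Definition presented : Type := quotmod ideal_pred.

HB.instance Definition _ := GRing.Lmodule.on presented.

Definition presented_pi (x : free_alg F X) : presented :=
  quotmod_pi ideal_pred x.

Definition presented_repr (x : presented) : free_alg F X := quotmod_repr x.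

Lemma presented_piE x y :
  presented_pi x = presented_pi y <-> ideal_gen (x - y).
Proof.
split=> [/quotmod_piE/asboolP //|H].
by apply/quotmod_piE/asboolP.
Qed.

Lemma presented_reprK : cancel presented_repr presented_pi.
Proof. exact: quotmod_reprK. Qed.

Definition presented_one : presented := presented_pi 1.
Definition presented_mul (x y : presented) : presented :=
  presented_pi (presented_repr x * presented_repr y).

Lemma presented_mulE x y :
  presented_mul (presented_pi x) (presented_pi y) = presented_pi (x * y).
Proof.
apply/presented_piE; set x' := presented_repr _; set y' := presented_repr _.
have -> : x' * y' - x * y = x' * (y' - y) + (x' - x) * y.
  by rewrite mulrBr mulrBl addrA addrNK.
apply: ideal_D; [apply: ideal_Ml|apply: ideal_Mr];
  by apply/presented_piE; rewrite presented_reprK.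
Qed.

Lemma presented_piD x y :
  presented_pi (x + y) = presented_pi x + presented_pi y.
Proof. exact: quotmod_piD. Qed.

Lemma presented_mulA : associative presented_mul.
Proof.
move=> x y z.
rewrite -[x]presented_reprK -[y]presented_reprK -[z]presented_reprK.
by rewrite !presented_mulE mulrA.
Qed.

Lemma presented_mul1l : left_id presented_one presented_mul.
Proof. by move=> x; rewrite -[x]presented_reprK presented_mulE mul1r. Qed.

Lemma presented_mul1r : right_id presented_one presented_mul.
Proof. by move=> x; rewrite -[x]presented_reprK presented_mulE mulr1. Qed.

Lemma presented_mulDl : left_distributive presented_mul +%R.
Proof.
move=> x y z.
rewrite -[x]presented_reprK -[y]presented_reprK -[z]presented_reprK.
by rewrite -presented_piD !presented_mulE mulrDl presented_piD.
Qed.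

Lemma presented_mulDr : right_distributive presented_mul +%R.
Proof.
move=> x y z.
rewrite -[x]presented_reprK -[y]presented_reprK -[z]presented_reprK.
by rewrite -presented_piD !presented_mulE mulrDr presented_piD.
Qed.

HB.instance Definition _ := GRing.Zmodule_isPzRing.Build presented
  presented_mulA presented_mul1l presented_mul1r
  presented_mulDl presented_mulDr.

Definition presented_gen (x : X) : presented := presented_pi << fmu x >>.

Section Subalgebra.
Variables (D : F -> Prop) (G : presented -> Prop).

Inductive subalg_gen : presented -> Prop :=
| subalg_in x : G x -> subalg_gen x
| subalg_1 : subalg_gen 1
| subalg_B x y : subalg_gen x -> subalg_gen y -> subalg_gen (x - y)
| subalg_M x y : subalg_gen x -> subalg_gen y -> subalg_gen (x * y)
| subalg_Z a x : D a -> subalg_gen x -> subalg_gen (a *: x).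

Definition subalg_pred : {pred presented} := fun x => `[< subalg_gen x >].

Lemma subalg_closed : subring_closed subalg_pred.
Proof.
split.
- exact/asboolP/subalg_1.
- by move=> x y /asboolP Hx /asboolP Hy; apply/asboolP/subalg_B.
- by move=> x y /asboolP Hx /asboolP Hy; apply/asboolP/subalg_M.
Qed.

HB.instance Definition _ :=
  GRing.isSubringClosed.Build presented subalg_pred subalg_closed.

Record subalg : Type :=
  Subalg { subalg_val : presented; _ : subalg_val \in subalg_pred }.

HB.instance Definition _ := [isSub for subalg_val].
HB.instance Definition _ := [Choice of subalg by <:].
HB.instance Definition _ := GRing.SubChoice_isSubPzRing.Build presented subalg_pred subalg
  subalg_closed.

Definition subalg_elt (x : presented) (Gx : G x) : subalg :=
  Subalg (introT (asboolP _) (subalg_in Gx)).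

Lemma subalg_scale_subproof (a : F) (Da : D a) (x : subalg) :
  a *: subalg_val x \in subalg_pred.
Proof. by case: x => x /= /asboolP Hx; apply/asboolP/subalg_Z. Qed.

Definition subalg_scale (a : F) (Da : D a) (x : subalg) : subalg :=
  Subalg (subalg_scale_subproof Da x).

End Subalgebra.

End Presentation.

Section SubalgebraInclusion.
Variables (F : fieldType) (X : choiceType) (rel : free_alg F X -> Prop).
Variables (D : F -> Prop) (G G' : presented rel -> Prop).
Hypothesis sGG' : forall x, G x -> G' x.

Lemma subalg_incl_subproof (x : subalg D G) :
  subalg_val x \in subalg_pred D G'.
Proof.
case: x => x /= /asboolP Hx; apply/asboolP.
elim: Hx => {x} [x /sGG'|||| ] *; first exact: subalg_in.
- exact: subalg_1.
- exact: subalg_B.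
- exact: subalg_M.
- exact: subalg_Z.
Qed.

Definition subalg_incl (x : subalg D G) : subalg D G' :=
  Subalg (subalg_incl_subproof x).

End SubalgebraInclusion.

Section QuantumInteger.
Variables (F : fieldType) (q : F).

Definition qint (r : nat) : F := (q ^+ r - q ^- r) / (q - q^-1).
Definition qfact (r : nat) : F := \prod_(1 <= s < r.+1) qint s.
Definition qbinom (m r : nat) : F := qfact m / (qfact r * qfact (m - r)).

End QuantumInteger.

Definition Qv : fieldType := ({fraction {poly rat}} : fieldType).
Definition vQ : Qv := tofrac ('X : {poly rat}).

Definition cartanA (n : nat) (i j : 'I_n) : int :=
  if i == j then 2
  else if (i.+1 == j :> nat) || (j.+1 == i :> nat) then -1 else 0.

(* [SymK' i] is the symbol of the inverse of [K_i]. *)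
Inductive uq_sym (n : nat) :=
  SymE of 'I_n | SymF of 'I_n | SymK of 'I_n | SymK' of 'I_n.

Section UqSymChoice.
Variable n : nat.

Definition uq_sym_code (x : uq_sym n) : nat * 'I_n :=
  match x with
  | SymE i => (0, i) | SymF i => (1, i) | SymK i => (2, i) | SymK' i => (3, i)
  end%N.

Definition uq_sym_decode (c : nat * 'I_n) : uq_sym n :=
  match c.1 with
  | 0 => SymE c.2 | 1 => SymF c.2 | 2 => SymK c.2 | _ => SymK' c.2
  end%N.

Lemma uq_sym_codeK : cancel uq_sym_code uq_sym_decode.
Proof. by case. Qed.

HB.instance Definition _ := Choice.copy (uq_sym n) (can_type uq_sym_codeK).

End UqSymChoice.

Section DrinfeldJimbo.
Variable n : nat.

Let sym (x : uq_sym n) : free_alg Qv (uq_sym n) := << fmu x >>.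
Let e (i : 'I_n) := sym (SymE i).
Let f (i : 'I_n) := sym (SymF i).
Let k (i : 'I_n) := sym (SymK i).
Let k' (i : 'I_n) := sym (SymK' i).

Definition serre (x y : free_alg Qv (uq_sym n)) (a : int) :
    free_alg Qv (uq_sym n) :=
  let m := absz (1 - a) in
  \sum_(s < m.+1)
    ((-1) ^+ s * qbinom vQ m s) *: (x ^+ (m - s) * y * x ^+ s).

Inductive uq_rel : free_alg Qv (uq_sym n) -> Prop :=
| uq_KK' i : uq_rel (k i * k' i - 1)
| uq_K'K i : uq_rel (k' i * k i - 1)
| uq_KK i j : uq_rel (k i * k j - k j * k i)
| uq_KE i j : uq_rel (k i * e j * k' i - vQ ^ cartanA i j *: e j)
| uq_KF i j : uq_rel (k i * f j * k' i - vQ ^ (- cartanA i j) *: f j)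
| uq_EF i j :
    uq_rel (e i * f j - f j * e i
            - ((i == j)%:R / (vQ - vQ^-1)) *: (k i - k' i))
| uq_EE i j : i != j -> uq_rel (serre (e i) (e j) (cartanA i j))
| uq_FF i j : i != j -> uq_rel (serre (f i) (f j) (cartanA i j)).

Definition Uv := presented uq_rel.

Definition Uv_E (i : 'I_n) : Uv := presented_gen uq_rel (SymE i).
Definition Uv_F (i : 'I_n) : Uv := presented_gen uq_rel (SymF i).
Definition Uv_K (i : 'I_n) : Uv := presented_gen uq_rel (SymK i).
Definition Uv_K' (i : 'I_n) : Uv := presented_gen uq_rel (SymK' i).

Definition divpow (x : Uv) (r : nat) : Uv := (qfact vQ r)^-1 *: x ^+ r.

End DrinfeldJimbo.

(* The Laurent polynomial [p(v) / v^k], evaluated at [q]; with [q = vQ] these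
   are the elements of Z[v,v^-1], with [q = zeta] their images in [K]. *)
Definition laurent (F : fieldType) (q : F) (p : {poly int}) (k : nat) : F :=
  (map_poly intr p).[q] / q ^+ k.

Definition is_laurent (c : Qv) : Prop := exists p k, c = laurent vQ p k.

Lemma laurentP p k : is_laurent (laurent vQ p k).
Proof. by exists p, k. Qed.

Section IntegralForm.
Variable n : nat.

Inductive lusztig_gen : Uv n -> Prop :=
| lusztig_E i r : lusztig_gen (divpow (Uv_E i) r)
| lusztig_F i r : lusztig_gen (divpow (Uv_F i) r)
| lusztig_K i : lusztig_gen (Uv_K i)
| lusztig_K' i : lusztig_gen (Uv_K' i).

Definition UA := subalg is_laurent lusztig_gen.

HB.instance Definition _ := GRing.PzRing.on UA.

Definition UA_E (i : 'I_n) (r : nat) : UA :=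
  subalg_elt is_laurent (lusztig_E i r).
Definition UA_F (i : 'I_n) (r : nat) : UA :=
  subalg_elt is_laurent (lusztig_F i r).
Definition UA_K (i : 'I_n) : UA := subalg_elt is_laurent (lusztig_K i).

Definition UA_scale (p : {poly int}) (k : nat) (x : UA) : UA :=
  subalg_scale (laurentP p k) x.

End IntegralForm.

Section Specialization.
Variables (n : nat) (K : fieldType) (zeta : K).

(* The tensor product of [UA n] with [K] over Z[v,v^-1], where [v] acts on [K]
   as [zeta]: [t x c] stands for the pure tensor of [x] and [c].  By the
   relations [tensor_M] and [tensor_1] every word in the pure tensors is a pure
   tensor, so the quotient is additively the usual one, with the usual product
   of pure tensors. *)
Let t (x : UA n) (c : K) : free_alg K (UA n * K)%type := << fmu (x, c) >>.

Inductive tensor_rel : free_alg K (UA n * K)%type -> Prop :=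
| tensor_Dl x y c : tensor_rel (t (x + y) c - t x c - t y c)
| tensor_Dr x c d : tensor_rel (t x (c + d) - t x c - t x d)
| tensor_balanced p k x c :
    tensor_rel (t (UA_scale p k x) c - t x (laurent zeta p k * c))
| tensor_Z d x c : tensor_rel (t x (d * c) - d *: t x c)
| tensor_M x y c d : tensor_rel (t x c * t y d - t (x * y) (c * d))
| tensor_1 : tensor_rel (t 1 1 - 1).

Definition UK := presented tensor_rel.

HB.instance Definition _ := GRing.PzRing.on UK.
HB.instance Definition _ := GRing.Lmodule.on UK.

Definition UK_of (x : UA n) : UK := presented_gen tensor_rel (x, 1).

(* E_i and F_i are their first divided powers. *)
Inductive small_gen : UK -> Prop :=
| small_gen_E i : small_gen (UK_of (UA_E i 1))
| small_gen_F i : small_gen (UK_of (UA_F i 1))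
| small_gen_K i : small_gen (UK_of (UA_K i)).

Inductive flat_gen : UK -> Prop :=
| flat_gen_F i : flat_gen (UK_of (UA_F i 1))
| flat_gen_K i : flat_gen (UK_of (UA_K i)).

Lemma flat_gen_small x : flat_gen x -> small_gen x.
Proof. by case=> i; [exact: small_gen_F|exact: small_gen_K]. Qed.

Definition all_scalars (_ : K) : Prop := True.

Definition small_u := subalg all_scalars small_gen.
Definition flat_u := subalg all_scalars flat_gen.

HB.instance Definition _ := GRing.PzRing.on small_u.
HB.instance Definition _ := GRing.PzRing.on flat_u.

Definition flat_small : flat_u -> small_u := subalg_incl flat_gen_small.

Definition small_E (i : 'I_n) : small_u :=
  subalg_elt all_scalars (small_gen_E i).
Definition small_F (i : 'I_n) : small_u :=
  subalg_elt all_scalars (small_gen_F i).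
Definition small_K (i : 'I_n) : small_u :=
  subalg_elt all_scalars (small_gen_K i).
Definition flat_F (i : 'I_n) : flat_u := subalg_elt all_scalars (flat_gen_F i).
Definition flat_K (i : 'I_n) : flat_u := subalg_elt all_scalars (flat_gen_K i).

(* A module over [small_u] or [flat_u] is a [K]-vector space through these. *)
Definition small_scalar (c : K) : small_u := subalg_scale (I : all_scalars c) 1.
Definition flat_scalar (c : K) : flat_u := subalg_scale (I : all_scalars c) 1.

(* A weight [lambda] is given by its integers [lambda_i], that is, by its
   coordinates in the basis of fundamental weights. *)
Definition weight_module (lambda : 'I_n -> int) (L : lmodType flat_u) : Prop :=
  [/\ exists2 w : L, w != 0 & forall x : L, exists c, x = flat_scalar c *: w,
      forall i (x : L), flat_F i *: x = 0
    & forall i (x : L), flat_K i *: x = flat_scalar (zeta ^ lambda i) *: x].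

Definition nabla (L : lmodType flat_u) : lmodType small_u := coind flat_small L.

Section ModuleV.
Variables (l : nat) (lambda : 'I_n -> int).

(* Both coordinates are 1-based: 0 in ['I_n.+1] is not used. *)
Definition posroot : finType :=
  {p : 'I_n.+1 * 'I_n.+1 | (0 < p.1 <= p.2)%N}.

Definition multiindex : finType := {ffun posroot -> 'Z_l}.

Definition is_posroot (s t : nat) (p : posroot) : bool :=
  ((val p).1 == s :> nat) && ((val p).2 == t :> nat).

(* The component m_{st}, read as 0 unless [1 <= s <= t <= n]. *)
Definition mcomp (m : multiindex) (s t : nat) : 'Z_l :=
  \sum_(p | is_posroot s t p) m p.

Definition eps (s t : nat) : multiindex := [ffun p => (is_posroot s t p)%:R].

(* For [zeta] of order [l], the quantum integer only depends on its argument
   modulo [l], so it can be evaluated at the representative in [0, l). *)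
Definition zqint (r : 'Z_l) : K := qint zeta r.

Definition lambdaZ (i : 'I_n) : 'Z_l := (lambda i)%:~R.

Definition coefE (m : multiindex) (i k : nat) : K :=
  zqint (mcomp m i k + mcomp m i (k - 1)
         - mcomp m (i - 1) (k - 1) - mcomp m (i + 1) k).

Definition shiftE (m : multiindex) (i k : nat) : multiindex :=
  m + \sum_(k <= j < n.+1) eps i j.

Definition coefF (m : multiindex) (lam : 'Z_l) (i k : nat) : K :=
  zqint (- lam + mcomp m (i + 1 - k) (n - k)
         - mcomp m (i + 1 - k) (n + 1 - k)
         + mcomp m (i - k) (n + 1 - k) - mcomp m (i - k) (n - k)).

Definition shiftF (m : multiindex) (i k : nat) : multiindex :=
  m - \sum_(1 <= j < k.+1) eps (i + 1 - j) (n + 1 - j).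

Definition coefK (m : multiindex) (lam : 'Z_l) (i : nat) : K :=
  zeta ^+ nat_of_ord
    (lam + mcomp m i n *+ 2 - mcomp m (i - 1) n - mcomp m (i + 1) n).

(* [i : 'I_n] is the index [i.+1] of the formulas. *)
Definition V_module (V : lmodType small_u) : Prop :=
  exists u : multiindex -> V,
  [/\ forall x : V, exists! c : {ffun multiindex -> K},
        x = \sum_m small_scalar (c m) *: u m,
      forall (i : 'I_n) m, small_E i *: u m =
        \sum_(i.+1 <= k < n.+1)
          small_scalar (coefE m i.+1 k) *: u (shiftE m i.+1 k),
      forall (i : 'I_n) m, small_F i *: u m =
        \sum_(1 <= k < i.+2)
          small_scalar (coefF m (lambdaZ i) i.+1 k) *: u (shiftF m i.+1 k)
    & forall (i : 'I_n) m,
        small_K i *: u m = small_scalar (coefK m (lambdaZ i) i.+1) *: u m].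

End ModuleV.

End Specialization.

Definition cyclotomic_rat (l : nat) : {poly rat} := map_poly intr 'Phi_l.

Lemma cyclotomic_rat_irreducible (l : nat) :
  (0 < l)%N -> monic_irreducible_poly (cyclotomic_rat l).
Proof.
move=> l_gt0; have [z prim_z] := C_prim_root_exists l_gt0.
have mon : cyclotomic_rat l \is monic.
  by rewrite /cyclotomic_rat monic_map ?Cyclotomic_monic.
split=> //; have [p [Dp mon_p] dv_p] := minCpolyP z.
have {}Dp : p = cyclotomic_rat l.
  apply: (map_poly_inj (ratr : {rmorphism rat -> algC})).
  rewrite -Dp (minCpoly_cyclotomic prim_z) -(Cintr_Cyclotomic prim_z).
  rewrite -map_poly_comp; apply: eq_map_poly => a /=.
  by rewrite ratr_int.
rewrite -{}Dp in mon *.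
have root_p : root (map_poly ratr p) z by rewrite dv_p dvdpp.
have p_neq0 : p != 0 := monic_neq0 mon.
split=> [|q q_neq1 q_dv].
  rewrite ltnNge; apply: contraL root_p => size_p.
  have /eqP sp1 : size p == 1 by rewrite eqn_leq size_p size_poly_gt0.
  have /size_poly1P[c c_neq0 ->] : size p == 1 by rewrite sp1.
  by rewrite map_polyC /= rootC fmorph_eq0.
have [r Dr] := dvdpP _ _ q_dv; move: root_p.
rewrite Dr rmorphM rootM => /orP[]; rewrite dv_p => dv.
  case/negP: q_neq1; have r_neq0 : r != 0.
    by apply: contraNneq p_neq0 => r0; rewrite Dr r0 mul0r.
  have q_neq0 : q != 0.
    by apply: contraNneq p_neq0 => q0; rewrite Dr q0 mulr0.
  have := dvdp_leq r_neq0 dv; rewrite Dr size_mul //.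
  have := size_poly_gt0 q; rewrite q_neq0.
  have := size_poly_gt0 r; rewrite r_neq0.
  case: (size r) => // a _; case: (size q) => // b _.
  by rewrite addSn addnS /= ltnS -[X in (_ <= X)%N]addn0 leq_add2l; case: b.
by rewrite /eqp -Dr q_dv.
Qed.

Section CyclotomicField.
Variables (l : nat) (l_gt0 : (0 < l)%N).

Definition cyc_field : fieldType :=
  {poly %/ cyclotomic_rat l with cyclotomic_rat_irreducible l_gt0}.

Definition cyc_zeta : cyc_field := 'qX.

End CyclotomicField.

(* Main.v *)
(** The simple socle and the simple head of a module are pinned down by
   extremal vectors.  In both modules the vectors killed by all E_i form a line
   of weight lambda, so that every nonzero submodule contains it.  The heads
   are handled with a linear form chi that vanishes on all E_i x and has kernel
   as large as possible: the largest submodule on which chi vanishes is the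
   radical.  Two simple modules whose extremal vectors have the same K-weight
   are isomorphic, because in a simple module the extremal vector is not a
   combination of nonempty words in the lowering generators applied to it;
   this uses that these words are nilpotent, not a weight argument, which
   would fail modulo l.

   Nilpotency comes from a PBW spanning set for words in the E_i, the root
   vectors having vanishing l-th power since their divided powers lie in the
   integral form.  For V(lambda) the line of invariants and the form chi are
   read off the explicit formulas, the support of a vector being such that no
   cancellation can occur.  For nabla(lambda), a map f is determined by its
   values on words in the E_i, and pairing those words with V(lambda) through
   the coordinate at u_0 embeds nabla(lambda) into V(lambda) compatibly with
   the E_i and K_i.  The embedding hits a vector on which chi is nonzero as
   soon as some f is nonzero on the top PBW monomial.  Such an f is obtained
   over Q(v), by letting U_v act on functions on Z^(n+1) x Z^(n+1) through the
   (n+1)-fold tensor power of the q-boson representation, and specializing an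
   integral matrix coefficient. *)

(* A presented algebra may collapse, and only the spanning half of PBW is proved for the small
   quantum group, so even [nabla L] being nonzero needs an argument. The missing half is traded for
   V(lambda): its basis and the truncated PBW monomials have the same index set, so the matrix with
   entries the coordinate at u_0 of X_m u_m' is square; it is injective because every nonzero
   E-stable subspace contains u_0, hence invertible. The top monomial is decisive because X_top E_i
   = 0: it only sees the coordinate at the top index. The functional tested on X_top must exist for
   every integral lambda. It comes from E_i = x_{i+1} D_i and F_i = x_i D_{i+1}, with D_i a
   q-difference operator, acting on monomials with integer exponents; allowing negative exponents
   makes room for arbitrary lambda. Specializing v to zeta is only partially defined on Q(v), hence
   is encoded by relations ([specializes], [UK_image]) along which identities are transported. *)
Require Import Defs.
From HB Require Import structures.
From mathcomp Require Import all_boot all_order all_algebra all_field.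
From mathcomp Require Import boolp functions finmap monalg.
From mathcomp Require Import ring zify.

Set Implicit Arguments.
Unset Strict Implicit.
Unset Printing Implicit Defensive.

Import GRing.Theory.
Local Open Scope ring_scope.

(** * Identities in noncommutative algebras *)

Inductive nc_expr (F : Type) : Type :=
| NcVar of nat
| NcScal of F
| NcOne
| NcZero
| NcAdd of nc_expr F & nc_expr F
| NcMul of nc_expr F & nc_expr F
| NcOpp of nc_expr F.

(** Built on [Nat.eqb] and its own recursion, so that [lazy] with an explicit list of constants
    decides equality of words without unfolding the coefficients. *)
Fixpoint nc_word_eqb (u w : seq nat) : bool :=
  match u, w with
  | [::], [::] => true
  | i :: u', j :: w' => if Nat.eqb i j then nc_word_eqb u' w' else false
  | _, _ => false
  end.

Lemma nc_word_eqbP u w : nc_word_eqb u w -> u = w.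
Proof.
elim: u w => [|i u IHu] [|j w] //=.
case E: (Nat.eqb i j) => // /IHu->; congr (_ :: _).
exact/PeanoNat.Nat.eqb_eq.
Qed.

Section NcRing.
Variables (F : fieldType) (R : pzRingType) (sc : {rmorphism F -> R}).
Hypothesis scC : forall c x, sc c * x = x * sc c.

Fixpoint nc_eval (env : seq R) (e : nc_expr F) : R :=
  match e with
  | NcVar i => nth 0 env i
  | NcScal c => sc c
  | NcOne => 1
  | NcZero => 0
  | NcAdd e1 e2 => nc_eval env e1 + nc_eval env e2
  | NcMul e1 e2 => nc_eval env e1 * nc_eval env e2
  | NcOpp e1 => - nc_eval env e1
  end.

Fixpoint nc_insert (w : seq nat) (c : F) (l : seq (seq nat * F)) :=
  match l with
  | [::] => [:: (w, c)]
  | (w', c') :: l' =>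
    if nc_word_eqb w w' then (w', c + c') :: l' else (w', c') :: nc_insert w c l'
  end.

Fixpoint nc_add (l1 l2 : seq (seq nat * F)) :=
  match l1 with
  | [::] => l2
  | (w, c) :: l1' => nc_insert w c (nc_add l1' l2)
  end.

Fixpoint nc_cat (u w : seq nat) : seq nat :=
  if u is i :: u' then i :: nc_cat u' w else w.

Fixpoint nc_mul1 (w : seq nat) (c : F) (l : seq (seq nat * F)) :=
  match l with
  | [::] => [::]
  | (w', c') :: l' => (nc_cat w w', c * c') :: nc_mul1 w c l'
  end.

Fixpoint nc_mul (l1 l2 : seq (seq nat * F)) :=
  match l1 with
  | [::] => [::]
  | (w, c) :: l1' => nc_add (nc_mul1 w c l2) (nc_mul l1' l2)
  end.

Fixpoint nc_opp (l : seq (seq nat * F)) :=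
  match l with
  | [::] => [::]
  | (w, c) :: l' => (w, - c) :: nc_opp l'
  end.

Fixpoint nc_norm (e : nc_expr F) : seq (seq nat * F) :=
  match e with
  | NcVar i => [:: ([:: i], 1)]
  | NcScal c => [:: ([::], c)]
  | NcOne => [:: ([::], 1)]
  | NcZero => [::]
  | NcAdd e1 e2 => nc_add (nc_norm e1) (nc_norm e2)
  | NcMul e1 e2 => nc_mul (nc_norm e1) (nc_norm e2)
  | NcOpp e1 => nc_opp (nc_norm e1)
  end.

Fixpoint nc_word (env : seq R) (w : seq nat) : R :=
  if w is i :: w' then nth 0 env i * nc_word env w' else 1.

Fixpoint nc_nf (env : seq R) (l : seq (seq nat * F)) : R :=
  if l is (w, c) :: l' then sc c * nc_word env w + nc_nf env l' else 0.

Fixpoint nc_all0 (l : seq (seq nat * F)) : Prop :=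
  if l is (w, c) :: l' then c = 0 /\ nc_all0 l' else True.

Lemma nc_wordM env u w :
  nc_word env (nc_cat u w) = nc_word env u * nc_word env w.
Proof. by elim: u => [|i u IHu] /=; rewrite ?mul1r // IHu mulrA. Qed.

Lemma nc_nf_insert env w c l :
  nc_nf env (nc_insert w c l) = sc c * nc_word env w + nc_nf env l.
Proof.
elim: l => [|[w' c'] l IHl] //=.
case: ifP => [/nc_word_eqbP->|_] /=; first by rewrite rmorphD mulrDl addrA.
by rewrite IHl addrCA.
Qed.

Lemma nc_nfD env l1 l2 :
  nc_nf env (nc_add l1 l2) = nc_nf env l1 + nc_nf env l2.
Proof.
elim: l1 => [|[w c] l1 IHl] /=; first by rewrite add0r.
by rewrite nc_nf_insert IHl addrA.
Qed.

Lemma nc_nfM env l1 l2 :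
  nc_nf env (nc_mul l1 l2) = nc_nf env l1 * nc_nf env l2.
Proof.
elim: l1 => [|[w c] l1 IHl] /=; first by rewrite mul0r.
rewrite nc_nfD IHl mulrDl; congr (_ + _); clear IHl.
elim: l2 => [|[w' c'] l2 IHl2] /=; first by rewrite mulr0.
rewrite IHl2 mulrDr nc_wordM rmorphM; congr (_ + _).
by rewrite -!mulrA; congr (_ * _); rewrite !mulrA scC.
Qed.

Lemma nc_nfN env l : nc_nf env (nc_opp l) = - nc_nf env l.
Proof.
elim: l => [|[w c] l IHl] /=; first by rewrite oppr0.
by rewrite IHl rmorphN mulNr opprD.
Qed.

Lemma nc_normP env e : nc_nf env (nc_norm e) = nc_eval env e.
Proof.
elim: e => [i|c|||e1 IH1 e2 IH2|e1 IH1 e2 IH2|e IH] /=.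
- by rewrite rmorph1 mul1r mulr1 addr0.
- by rewrite mulr1 addr0.
- by rewrite rmorph1 mulr1 addr0.
- by [].
- by rewrite nc_nfD IH1 IH2.
- by rewrite nc_nfM IH1 IH2.
- by rewrite nc_nfN IH.
Qed.

(** Words are not claimed to be independent: the vanishing of all coefficients is a sufficient
    condition, and each of them is a commutative goal for [field] or [ring]. *)
Lemma nc_eq env e1 e2 :
  nc_all0 (nc_norm (NcAdd e1 (NcOpp e2))) -> nc_eval env e1 = nc_eval env e2.
Proof.
move=> H; apply/eqP; rewrite -subr_eq0.
rewrite -[_ - _]/(nc_eval env (NcAdd e1 (NcOpp e2))) -nc_normP; apply/eqP.
by elim: (nc_norm _) H => [|[w c] l IHl] //= [-> /IHl->]; rewrite rmorph0 mul0r addr0.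
Qed.

End NcRing.

Arguments NcVar {F}.
Arguments NcOne {F}.
Arguments NcZero {F}.

Ltac nc_mem a l :=
  match l with
  | a :: _ => constr:(true)
  | _ :: ?l' => nc_mem a l'
  | _ => constr:(false)
  end.
Ltac nc_idx a l :=
  match l with
  | a :: _ => constr:(O)
  | _ :: ?l' => let k := nc_idx a l' in constr:(S k)
  end.
Ltac nc_scal sc t :=
  match t with
  | ?f ?c => let u := constr:(erefl : t = GRing.RMorphism.sort sc c) in c
  end.
Ltac nc_atoms sc t l :=
  lazymatch t with
  | @GRing.add _ ?x ?y => let l1 := nc_atoms sc x l in nc_atoms sc y l1
  | @GRing.mul _ ?x ?y => let l1 := nc_atoms sc x l in nc_atoms sc y l1
  | @GRing.opp _ ?x => nc_atoms sc x l
  | @GRing.exp _ ?x O => nc_atoms sc x l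
  | @GRing.exp _ ?x (S _) => nc_atoms sc x l
  | @GRing.one _ => l
  | @GRing.zero _ => l
  | _ =>
    match t with
    | _ => let u := nc_scal sc t in l
    | _ => let b := nc_mem t l in
           lazymatch b with true => l | false => constr:(t :: l) end
    end
  end.
Ltac nc_pow x n :=
  lazymatch n with
  | O => constr:(NcOne)
  | S O => x
  | S ?m => let r := nc_pow x m in constr:(NcMul x r)
  end.
Ltac nc_reify F sc t l :=
  lazymatch t with
  | @GRing.add _ ?x ?y =>
    let a := nc_reify F sc x l in let b := nc_reify F sc y l in
    constr:(@NcAdd F a b)
  | @GRing.mul _ ?x ?y =>
    let a := nc_reify F sc x l in let b := nc_reify F sc y l in
    constr:(@NcMul F a b)
  | @GRing.opp _ ?x => let a := nc_reify F sc x l in constr:(@NcOpp F a)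
  | @GRing.exp _ ?x O => constr:(@NcOne F)
  | @GRing.exp _ ?x (S ?n) =>
    let a := nc_reify F sc x l in nc_pow a (S n)
  | @GRing.one _ => constr:(@NcOne F)
  | @GRing.zero _ => constr:(@NcZero F)
  | _ =>
    match t with
    | _ => let c := nc_scal sc t in constr:(@NcScal F c)
    | _ => let k := nc_idx t l in constr:(@NcVar F k)
    end
  end.

(* Reduces an identity in an algebra over [F], embedded by the central
   morphism [sc], to the vanishing of the coefficient of every word. *)
Ltac nc_coef F sc scC :=
  lazymatch goal with
  | |- @eq ?R ?x ?y =>
      let l0 := constr:(@nil R) in
      let l1 := nc_atoms sc x l0 in
      let l := nc_atoms sc y l1 in
      let e1 := nc_reify F sc x l in
      let e2 := nc_reify F sc y l in
      refine (@nc_eq F _ sc scC l e1 e2 _);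
      lazy [nc_all0 nc_norm nc_add nc_mul nc_mul1 nc_opp nc_insert nc_cat
            nc_word_eqb Nat.eqb];
      repeat split
  end.

(** * Root vectors and PBW monomials *)

Section LinSpan.
Variables (F : fieldType) (R : pzRingType) (sc : {rmorphism F -> R}).
Hypothesis scC : forall c x, sc c * x = x * sc c.

Inductive lin_span (P : R -> Prop) : R -> Prop :=
| span_in x : P x -> lin_span P x
| span_0 : lin_span P 0
| span_D x y : lin_span P x -> lin_span P y -> lin_span P (x + y)
| span_Z c x : lin_span P x -> lin_span P (sc c * x).

Lemma lin_span_sub (P Q : R -> Prop) x :
  (forall y, P y -> lin_span Q y) -> lin_span P x -> lin_span Q x.
Proof.
move=> sPQ; elim=> {x}; [exact: sPQ|exact: span_0| |].
  by move=> x y _ Hx _ Hy; apply: span_D.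
by move=> c x _ Hx; apply: span_Z.
Qed.

Lemma lin_spanM (P Q : R -> Prop) a b x :
  (forall y, P y -> lin_span Q (a * y * b)) -> lin_span P x ->
  lin_span Q (a * x * b).
Proof.
move=> sPQ; elim=> {x} [x /sPQ //||x y _ Hx _ Hy|c x _ Hx].
- by rewrite mulr0 mul0r; apply: span_0.
- by rewrite mulrDr mulrDl; apply: span_D.
- by rewrite mulrA -scC -!mulrA [a * _]mulrA; apply: span_Z.
Qed.

Lemma lin_spanMl (P Q : R -> Prop) a x :
  (forall y, P y -> lin_span Q (a * y)) -> lin_span P x -> lin_span Q (a * x).
Proof.
move=> sPQ; rewrite -[a * x]mulr1; apply: lin_spanM => y Py.
by rewrite mulr1; apply: sPQ.
Qed.

Lemma lin_spanMr (P Q : R -> Prop) b x :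
  (forall y, P y -> lin_span Q (y * b)) -> lin_span P x -> lin_span Q (x * b).
Proof.
move=> sPQ; rewrite -[x * b]mul1r mulrA; apply: lin_spanM => y Py.
by rewrite mul1r; apply: sPQ.
Qed.

Lemma span_N P x : lin_span P x -> lin_span P (- x).
Proof. by move/(span_Z (-1)); rewrite rmorphN1 mulN1r. Qed.

Lemma span_B P x y : lin_span P x -> lin_span P y -> lin_span P (x - y).
Proof. by move=> Hx /span_N; apply: span_D. Qed.

End LinSpan.

Section RootVectors.
Variables (F : fieldType) (R : pzRingType) (sc : {rmorphism F -> R}).
Hypothesis scC : forall c x, sc c * x = x * sc c.
Variables (q : F) (e : nat -> R).
Hypothesis q_neq0 : q != 0.
Hypothesis e_far : forall i j, (i.+1 < j)%N -> e i * e j = e j * e i.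

Definition serre2 (x y : R) : R :=
  x * x * y - sc (q + q^-1) * x * y * x + y * x * x.

Hypothesis e_serre : forall i, serre2 (e i) (e i.+1) = 0.
Hypothesis e_serre' : forall i, serre2 (e i.+1) (e i) = 0.

(** The root vector of alpha_s + ... + alpha_{s+d}, simple roots being numbered from 0. An explicit
    iterated q-commutator takes the place of the braid group action, so that all relations below
    follow from the Serre relations alone. *)
Fixpoint root_vec (s d : nat) : R :=
  if d is d'.+1 then
    e (s + d) * root_vec s d' - sc q^-1 * root_vec s d' * e (s + d)
  else e s.

Lemma root_vecS s d :
  root_vec s d.+1
  = e (s + d.+1) * root_vec s d - sc q^-1 * root_vec s d * e (s + d.+1).
Proof. by []. Qed.

Lemma comm_qcomm a x y : a * x = x * a -> a * y = y * a ->
  a * (x * y - sc q^-1 * y * x) = (x * y - sc q^-1 * y * x) * a.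
Proof.
move=> ax ay; apply/eqP; rewrite -subr_eq0; apply/eqP.
(* The pattern for all identities of this kind: the difference of the two sides is an explicit
   combination of the hypotheses, each written as an expression equal to 0, and [nc_coef] checks the
   combination. *)
transitivity ((a * x - x * a) * y + x * (a * y - y * a)
  - sc q^-1 * (a * y - y * a) * x - sc q^-1 * y * (a * x - x * a)).
  by nc_coef F sc scC; field.
by rewrite ax ay !subrr !mulr0 !mul0r !(subr0, addr0).
Qed.

Lemma e_root_vec_far s d j :
  (s + d.+1 < j)%N -> e j * root_vec s d = root_vec s d * e j.
Proof.
elim: d => [|d IHd] lt_j; first by rewrite /= [RHS]e_far //; lia.
rewrite root_vecS; apply: comm_qcomm; last by apply: IHd; lia.
by rewrite [RHS]e_far //; lia.
Qed.

(** [serre2 g] passes through a factor that commutes with g, so the Serre relation of g with the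
    last letter h of a root vector becomes a relation with the whole root vector. *)
Lemma serre2_qcomm g h y : g * y = y * g ->
  serre2 g (h * y - sc q^-1 * y * h)
  = serre2 g h * y - sc q^-1 * y * serre2 g h.
Proof.
move=> gy.
have -> : serre2 g (h * y - sc q^-1 * y * h) = serre2 g h * y
    - sc q^-1 * y * serre2 g h + sc (q + q^-1) * g * h * (g * y - y * g)
    - h * g * (g * y - y * g) - h * (g * y - y * g) * g
    - sc q^-1 * g * (g * y - y * g) * h - sc q^-1 * (g * y - y * g) * g * h
    + sc (q^-1 * (q + q^-1)) * (g * y - y * g) * h * g.
  by rewrite /serre2; nc_coef F sc scC; field.
by rewrite gy subrr !mulr0 !mul0r !(subr0, addr0).
Qed.

Lemma e_root_vec_serre s d : serre2 (e (s + d.+1)) (root_vec s d) = 0.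
Proof.
elim: d => [|d IHd]; first by rewrite addn1 e_serre'.
rewrite root_vecS serre2_qcomm; last by apply: e_root_vec_far; lia.
by rewrite [in e (s + _)]addnS e_serre' !mulr0 !mul0r subrr.
Qed.

(** The Serre relation factors: with z = b c - q^-1 c b, the expression [serre2 b c] is b z - q z
    b. *)
Lemma e_root_vec_end s d :
  e (s + d.+1) * root_vec s d.+1 = sc q * root_vec s d.+1 * e (s + d.+1).
Proof.
apply/eqP; rewrite -subr_eq0 -(e_root_vec_serre s d) root_vecS /serre2.
by apply/eqP; nc_coef F sc scC; field.
Qed.

Lemma e_root_vec_next s d :
  e (s + d.+1) * root_vec s d
  = sc q^-1 * root_vec s d * e (s + d.+1) + root_vec s d.+1.
Proof. by rewrite root_vecS addrC subrK. Qed.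

Hypothesis q2_neqN1 : 1 + q ^+ 2 != 0.

(* Both ways of writing [a, [b, c]_q]_q as an iterated q-commutator give a
   relation between b Y and Y b; together they force commutation. *)
Lemma comm_inner a b c : a * c = c * a -> serre2 b a = 0 -> serre2 b c = 0 ->
  let z := b * c - sc q^-1 * c * b in
  let y := a * z - sc q^-1 * z * a in
  b * y = y * b.
Proof.
move=> ac ba bc z y.
have Hz : b * z - sc q * z * b = 0.
  by rewrite -bc /z /serre2; nc_coef F sc scC; field.
pose w := a * b - sc q^-1 * b * a.
have Hw : w * b - sc q * b * w = 0.
  by rewrite -ba /w /serre2; nc_coef F sc scC; field.
have Hy : y = w * c - sc q^-1 * c * w.
  apply/eqP; rewrite -subr_eq0; apply/eqP.
  transitivity (sc q^-1 * (c * a - a * c) * b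
    - sc q^-1 * b * (c * a - a * c)); last first.
    by rewrite ac subrr !mulr0 mul0r subrr.
  by rewrite /y /w /z; nc_coef F sc scC; field.
have A : b * y - sc (q ^+ 2) * y * b + sc q * w * z - sc q * z * w = 0.
  transitivity (sc q * a * (b * z - sc q * z * b)
    - sc q^-1 * (b * z - sc q * z * b) * a); last first.
    by rewrite Hz !mulr0 !mul0r subrr.
  by rewrite /y /w; nc_coef F sc scC; field.
have B : w * z - z * w - sc q * b * y + sc q^-1 * y * b = 0.
  transitivity ((w * b - sc q * b * w) * c
    - sc (q^-1 ^+ 2) * c * (w * b - sc q * b * w)); last first.
    by rewrite Hw !mulr0 !mul0r subrr.
  by rewrite Hy /z; nc_coef F sc scC; field.
apply/eqP; rewrite -subr_eq0; apply/eqP.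
transitivity (sc (1 + q ^+ 2)^-1 *
  ((b * y - sc (q ^+ 2) * y * b + sc q * w * z - sc q * z * w)
   - sc q * (w * z - z * w - sc q * b * y + sc q^-1 * y * b))); last first.
  by rewrite A B mulr0 subrr mulr0.
by nc_coef F sc scC; field; rewrite ?q_neq0.
Qed.

Lemma e_root_vec_inner s d j :
  (s < j < s + d)%N -> e j * root_vec s d = root_vec s d * e j.
Proof.
elim: d => [|d IHd] lt_j; first by lia.
have [->|neq_j] := eqVneq j (s + d)%N; last first.
  rewrite root_vecS; apply: comm_qcomm; last by apply: IHd; lia.
  by apply: e_far; lia.
case: d lt_j {IHd} => [|d] lt_j; first by lia.
rewrite root_vecS [root_vec s d.+1]root_vecS; apply: comm_inner.
- by apply: e_root_vec_far; lia.
- by rewrite [in e (s + d.+2)]addnS e_serre.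
- exact: e_root_vec_serre.
Qed.

Lemma root_vec_qcomm0 s d : root_vec s d.+1 * e s = sc q * e s * root_vec s d.+1.
Proof.
elim: d => [|d IHd].
  apply/eqP; rewrite -subr_eq0 -(e_serre s) /= addn1 /serre2.
  by apply/eqP; nc_coef F sc scC; field.
rewrite root_vecS; set y := root_vec s d.+1 in IHd *; set g := e (s + _).
have gs : e s * g = g * e s by apply: e_far; lia.
apply/eqP; rewrite -subr_eq0; apply/eqP.
transitivity (g * (y * e s - sc q * e s * y)
  - sc q^-1 * (y * e s - sc q * e s * y) * g
  + sc q^-1 * y * (e s * g - g * e s) - sc q * (e s * g - g * e s) * y).
  by nc_coef F sc scC; field.
by rewrite IHd gs !subrr !mulr0 !mul0r !(subr0, addr0).
Qed.

(** Induction on the shorter root vector: the letter that extends it lies strictly inside the longer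
    one, hence commutes with it, and the q-commutation passes to the q-commutator. *)
Lemma root_vec_qcomm s d i : (i < d)%N ->
  root_vec s d * root_vec s i = sc q * root_vec s i * root_vec s d.
Proof.
case: d => [//|d]; elim: i => [|i IHi] lt_id; first exact: root_vec_qcomm0.
rewrite [root_vec s i.+1]root_vecS; have {}IHi := IHi (ltnW lt_id).
set y := root_vec s d.+1 in IHi *; set x := root_vec s i in IHi *.
set g := e (s + _).
have gy : g * y = y * g by apply: e_root_vec_inner; lia.
apply/eqP; rewrite -subr_eq0; apply/eqP.
transitivity (g * (y * x - sc q * x * y) - (g * y - y * g) * x
  - sc q^-1 * (y * x - sc q * x * y) * g + x * (g * y - y * g)).
  by nc_coef F sc scC; field.
by rewrite IHi gy !subrr !mulr0 !mul0r !(subr0, addr0).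
Qed.

End RootVectors.

(** * Spanning by PBW monomials with exponents below l *)

Section PBW.
Variables (F : fieldType) (R : pzRingType) (sc : {rmorphism F -> R}).
Hypothesis scC : forall c x, sc c * x = x * sc c.
Variables (q : F) (e : nat -> R) (n l : nat).
Hypothesis q_neq0 : q != 0.
Hypothesis q2_neqN1 : 1 + q ^+ 2 != 0.
Hypothesis e_far : forall i j, (i.+1 < j)%N -> e i * e j = e j * e i.
Hypothesis e_serre : forall i, serre2 sc q (e i) (e i.+1) = 0.
Hypothesis e_serre' : forall i, serre2 sc q (e i.+1) (e i) = 0.
Hypothesis e_out : forall i, (n <= i)%N -> e i = 0.

Local Notation X := (root_vec sc q e).

Hypothesis l_gt0 : (0 < l)%N.
Hypothesis root_vecXl : forall s d, X s d ^+ l = 0.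

Definition gen_word (w : seq nat) : R := \prod_(i <- w) e i.
Definition root_word (s : nat) (ds : seq nat) : R := \prod_(d <- ds) X s d.
Definition root_word_deg (ds : seq nat) : nat := \sum_(d <- ds) d.+1.

Lemma gen_word_cons i w : gen_word (i :: w) = e i * gen_word w.
Proof. exact: big_cons. Qed.

Lemma gen_word_cat w w' : gen_word (w ++ w') = gen_word w * gen_word w'.
Proof. exact: big_cat. Qed.

Lemma root_word_cons s d ds : root_word s (d :: ds) = X s d * root_word s ds.
Proof. exact: big_cons. Qed.

Lemma root_vec_out s d : (n <= s + d)%N -> X s d = 0.
Proof.
case: d => [|d] le_n; first by rewrite /= e_out //; lia.
by rewrite root_vecS e_out // mul0r mulr0 subrr.
Qed.

Definition split_word s k (x : R) :=
  exists ds w, [/\ x = root_word s ds * gen_word w, all (ltn s) w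
    & (root_word_deg ds + size w = k)%N].

(** On its way to the right e_j q-commutes with X_{s,d}, except for j = s+d+1, where it may also be
    absorbed and give X_{s,d+1}. The total length is tracked because it later bounds the length of
    nonzero words. *)
Lemma gen_root_word s j ds : (s < j)%N ->
  lin_span sc (split_word s (root_word_deg ds).+1) (e j * root_word s ds).
Proof.
move=> lt_sj; elim: ds => [|d ds IHds].
  apply: span_in; exists [::], [:: j]; split; rewrite /= ?lt_sj //.
    by rewrite /root_word /gen_word big_nil big_seq1 mulr1 mul1r.
  by rewrite /root_word_deg big_nil.
have deg_cons k : root_word_deg (k :: ds) = (k.+1 + root_word_deg ds)%N.
  exact: big_cons.
have swap c : lin_span sc (split_word s (root_word_deg (d :: ds)).+1)
    (sc c * X s d * (e j * root_word s ds)).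
  rewrite -mulrA; apply: span_Z; apply: lin_spanMl IHds => // y.
  case=> ds' [w [-> w_gt deg]]; apply: span_in.
  exists (d :: ds'), w; split=> //; first by rewrite root_word_cons mulrA.
  by rewrite deg_cons -addnS -deg addnA; congr (_ + _)%N; apply: big_cons.
have swap1 : e j * X s d = X s d * e j -> lin_span sc
    (split_word s (root_word_deg (d :: ds)).+1) (e j * root_word s (d :: ds)).
  move=> ej; have := swap 1.
  by rewrite rmorph1 mul1r root_word_cons mulrA mulrA ej.
have [lt_j|ge_j] := ltnP j (s + d); first by apply: swap1; apply: e_root_vec_inner; rewrite ?lt_sj.
have [Dj|neq_j] := eqVneq j (s + d)%N.
  case: d ge_j Dj deg_cons swap {swap1} => [|d] ge_j Dj deg_cons swap; first by lia.
  by rewrite root_word_cons mulrA Dj e_root_vec_end // -mulrA -Dj; apply: swap.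
have [Dj|neq_j'] := eqVneq j (s + d.+1)%N; last first.
  by apply: swap1; apply: e_root_vec_far => //; lia.
rewrite root_word_cons mulrA Dj e_root_vec_next mulrDl -mulrA -Dj.
apply: span_D; first exact: swap.
apply: span_in; exists (d.+1 :: ds), [::]; split=> //.
  by rewrite /gen_word big_nil mulr1 root_word_cons.
by rewrite !deg_cons addn0.
Qed.

Lemma gen_word_split s w : all (leq s) w ->
  lin_span sc (split_word s (size w)) (gen_word w).
Proof.
elim: w => [_|i w IHw /= /andP[le_si /IHw{}IHw]].
  apply: span_in; exists [::], [::]; split=> //.
    by rewrite /gen_word /root_word !big_nil mulr1.
  by rewrite /root_word_deg big_nil.
rewrite gen_word_cons; apply: lin_spanMl IHw => // _ [ds [w' [-> gt_w' <-]]].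
have [Di|neq_si] := eqVneq s i.
  apply: span_in; exists (0%N :: ds), w'; split=> //.
    by rewrite root_word_cons /= Di mulrA.
  by rewrite /root_word_deg big_cons.
rewrite mulrA; apply: lin_spanMr (gen_root_word ds _) => //; last by lia.
move=> _ [ds' [w'' [-> gt_w'' deg]]]; apply: span_in.
exists ds', (w'' ++ w'); split; first by rewrite gen_word_cat mulrA.
  by rewrite all_cat gt_w''.
by rewrite size_cat addnA deg.
Qed.

Definition pbw_row (s N : nat) (c : nat -> nat) : R :=
  \prod_(0 <= d < N) X s d ^+ c d.

Lemma pbw_row_cons s N c i : (i < N)%N -> exists k,
  X s i * pbw_row s N c
  = sc (q ^+ k) * pbw_row s N (fun d => c d + (d == i))%N.
Proof.
move=> lt_iN.
have qpow d k : (d < i)%N ->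
    X s i * X s d ^+ k = sc (q ^+ k) * X s d ^+ k * X s i.
  move=> lt_di; elim: k => [|k IHk]; first by rewrite !expr0 rmorph1 !mul1r mulr1.
  rewrite exprSr mulrA IHk -[_ * X s i * X s d]mulrA root_vec_qcomm // exprSr.
  by move: (X s d) (X s i) (q ^+ k) => y z a; nc_coef F sc scC; ring.
have low N' : (N' <= i)%N -> exists k, X s i * pbw_row s N' c
   = sc (q ^+ k) * pbw_row s N' c * X s i.
  elim: N' => [|N' IHN] le_N'.
    by exists 0%N; rewrite /pbw_row big_geq // rmorph1 mulr1 !mul1r.
  have [k Hk] := IHN (ltnW le_N'); exists (k + c N')%N.
  rewrite /pbw_row big_nat_recr //= mulrA Hk -!mulrA qpow //.
  rewrite exprD rmorphM -!mulrA; congr (_ * _).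
  by rewrite !mulrA -scC.
have [k Hk] := low i (leqnn i); exists k.
rewrite /pbw_row (big_cat_nat (leq0n i) (ltnW lt_iN)) /= mulrA Hk.
rewrite [in RHS](big_cat_nat (leq0n i) (ltnW lt_iN)) /= -!mulrA; congr (_ * (_ * _)).
  apply: eq_big_nat => d /andP[_ lt_d].
  by rewrite (ltn_eqF lt_d) addn0.
rewrite big_ltn // [in RHS]big_ltn // eqxx addn1 exprS mulrA; congr (_ * _).
apply: eq_big_nat => d /andP[lt_d _].
by rewrite (gtn_eqF lt_d) addn0.
Qed.

Definition pbw (s : nat) (m : nat -> nat -> nat) : R :=
  \prod_(s <= i < n) pbw_row i (n - i) (m i).
Definition pbw_deg (s : nat) (m : nat -> nat -> nat) : nat :=
  \sum_(s <= i < n) \sum_(0 <= d < n - i) m i d * d.+1.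

(** The root vectors with a common start s q-commute, so a word in them sorts into powers at the
    cost of a power of q; an exponent reaching l gives 0. *)
Lemma root_word_row s ds : root_word s ds = 0 \/ exists k c,
  [/\ root_word s ds = sc (q ^+ k) * pbw_row s (n - s) c,
      forall d, (c d < l)%N
    & root_word_deg ds = (\sum_(0 <= d < n - s) c d * d.+1)%N].
Proof.
elim: ds => [|d ds [IHds|[k [c [Dw c_lt deg]]]]].
- right; exists 0%N, (fun=> 0%N); split=> //.
    by rewrite /root_word big_nil /pbw_row big1 ?rmorph1 ?mul1r.
  by rewrite /root_word_deg big_nil big1.
- by left; rewrite root_word_cons IHds mulr0.
rewrite root_word_cons.
have [le_n|lt_d] := leqP (n - s) d.
  by left; rewrite root_vec_out ?mul0r //; lia.
have [k' Hk'] := pbw_row_cons s c lt_d.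
have Ew : X s d * root_word s ds
   = sc (q ^+ (k + k')) * pbw_row s (n - s) (fun i => c i + (i == d))%N.
  by rewrite Dw mulrA -scC -mulrA Hk' exprD rmorphM mulrA.
have [cd|cd] := eqVneq (c d).+1 l.
  left; rewrite Ew /pbw_row (big_cat_nat (leq0n d) (ltnW lt_d)) /=.
  by rewrite [X in _ * (_ * X)]big_ltn // eqxx addn1 cd root_vecXl mul0r !mulr0.
right; exists (k + k')%N, (fun i => c i + (i == d))%N; split=> //.
  move=> i; case: eqP => [->|_]; last by rewrite addn0.
  by rewrite addn1 ltn_neqAle cd c_lt.
rewrite /root_word_deg big_cons -/(root_word_deg ds) deg.
under [RHS]eq_bigr do rewrite mulnDl.
rewrite big_split addnC; congr (_ + _)%N.
rewrite (bigD1_seq d) ?iota_uniq ?mem_index_iota //= eqxx mul1n big1 ?addn0 //.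
by move=> i /negPf->.
Qed.

Definition pbw_homog s k (x : R) :=
  exists m, [/\ x = pbw s m, forall i d, (m i d < l)%N & pbw_deg s m = k].

(** All letters s are absorbed into root vectors X_{s,d} on the left, and the remaining letters
    exceed s: induction on n - s. *)
Theorem gen_word_pbw s w : (s <= n)%N -> all (leq s) w ->
  lin_span sc (pbw_homog s (size w)) (gen_word w).
Proof.
move=> le_sn; move Dk: (n - s)%N => k; elim: k s le_sn Dk w => [|k IHk] s le_sn Dk w.
  have -> : s = n by lia.
  case: w => [_|i w /= /andP[/e_out ei _]]; last first.
    by rewrite gen_word_cons ei mul0r; apply: span_0.
  apply: span_in; exists (fun _ _ => 0%N); split=> //.
    by rewrite /gen_word /pbw big_nil big_geq.
  by rewrite /pbw_deg big_geq.
move/gen_word_split; apply: lin_span_sub => _ [ds [w' [-> gt_w' <-]]].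
have [->|[k' [c [-> c_lt ->]]]] := root_word_row s ds.
  by rewrite mul0r; apply: span_0.
rewrite -mulrA; apply: span_Z.
have := IHk s.+1 (ltac:(lia)) (ltac:(lia)) w' gt_w'.
apply: lin_spanMl => // _ [m [-> m_lt deg]]; apply: span_in.
pose m' i d := if i == s then c d else m i d.
exists m'; split.
- rewrite /pbw [RHS]big_ltn; last by lia.
  rewrite {1}/m' eqxx; congr (_ * _).
  apply: eq_big_nat => i /andP[lt_si _].
  by apply: eq_big_nat => d _; rewrite /m' gtn_eqF.
- by move=> i d; rewrite /m'; case: eqP.
rewrite /pbw_deg big_ltn; last by lia.
congr (_ + _)%N; first by apply: eq_bigr => d _; rewrite /m' eqxx.
rewrite -deg; apply: eq_big_nat => i /andP[lt_si _].
by apply: eq_bigr => d _; rewrite /m' gtn_eqF.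
Qed.

End PBW.

Section RelatedPBW.
Variables (F F' : fieldType) (R R' : pzRingType).
Variables (sc : {rmorphism F -> R}) (sc' : {rmorphism F' -> R'}).
Variables (q : F) (q' : F') (e : nat -> R) (e' : nat -> R').
Variable T : R -> R' -> Prop.
Hypothesis T1 : T 1 1.
Hypothesis TB : forall x x' y y', T x x' -> T y y' -> T (x - y) (x' - y').
Hypothesis TM : forall x x' y y', T x x' -> T y y' -> T (x * y) (x' * y').
Hypothesis Tq : T (sc q^-1) (sc' q'^-1).
Hypothesis Te : forall j, T (e j) (e' j).

(** [T] is the graph of a possibly partial ring morphism: later the specialization from Q(v), the
    inclusion of a subalgebra, or the action on functions. *)
Lemma root_vec_related i d : T (root_vec sc q e i d) (root_vec sc' q' e' i d).
Proof.
elim: d => [|d IHd]; first exact: Te.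
by rewrite !root_vecS; apply: TB; do ?apply: TM.
Qed.

Lemma pbw_related n s m : T (pbw sc q e n s m) (pbw sc' q' e' n s m).
Proof.
have TX x x' k : T x x' -> T (x ^+ k) (x' ^+ k).
  by move=> Tx; elim: k => // k IHk; rewrite !exprS; apply: TM.
apply: (big_ind2 T) => // i _; apply: (big_ind2 T) => // d _; apply: TX.
exact: root_vec_related.
Qed.

End RelatedPBW.

(** * Quantum integers and divided powers of q-commutators *)

Section QuantumIntegers.
Variables (F : fieldType) (q : F).
Hypothesis q_neq0 : q != 0.

Lemma qint0 : qint q 0 = 0.
Proof. by rewrite /qint expr0 invr1 subrr mul0r. Qed.

Lemma qintD a b : qint q (a + b) = q ^+ a * qint q b + q ^- b * qint q a.
Proof.
rewrite /qint !mulrA -mulrDl exprD invfM; congr (_ / _).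
by field; rewrite !expf_neq0.
Qed.

Lemma qfact0 : qfact q 0 = 1.
Proof. by rewrite /qfact big_geq. Qed.

Lemma qfactS r : qfact q r.+1 = qfact q r * qint q r.+1.
Proof. by rewrite /qfact big_nat_recr. Qed.

Hypothesis qint_neq0 : forall r, (0 < r)%N -> qint q r != 0.

Lemma qfact_neq0 r : qfact q r != 0.
Proof.
elim: r => [|r IHr]; first by rewrite qfact0 oner_neq0.
by rewrite qfactS mulf_neq0 ?qint_neq0.
Qed.

Lemma qint_sub_neq0 : q - q^-1 != 0.
Proof.
have := qint_neq0 (ltn0Sn 0); rewrite /qint mulf_eq0 negb_or invr_eq0.
by case/andP.
Qed.

Lemma qint1 : qint q 1 = 1.
Proof. by rewrite /qint expr1 divff ?qint_sub_neq0. Qed.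

Lemma qfact1 : qfact q 1 = 1.
Proof. by rewrite qfactS qfact0 qint1 mul1r. Qed.

Lemma qint2 : qint q 2 = q + q^-1.
Proof. by rewrite (qintD 1 1) qint1 !mulr1 expr1. Qed.

End QuantumIntegers.

Section DividedPowers.
Variables (F : fieldType) (R : pzRingType) (sc : {rmorphism F -> R}).
Hypothesis scC : forall c x, sc c * x = x * sc c.
Variable q : F.
Hypothesis q_neq0 : q != 0.
Hypothesis qint_neq0 : forall r, (0 < r)%N -> qint q r != 0.

Definition div_pow (x : R) (r : nat) : R := sc (qfact q r)^-1 * x ^+ r.

Lemma div_pow0 x : div_pow x 0 = 1.
Proof. by rewrite /div_pow qfact0 invr1 rmorph1 mul1r expr0. Qed.

Lemma div_powSr x r : div_pow x r * x = sc (qint q r.+1) * div_pow x r.+1.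
Proof.
rewrite /div_pow qfactS invfM mulrA -rmorphM mulrCA mulfV ?qint_neq0 // mulr1.
by rewrite exprSr mulrA.
Qed.

Lemma div_pow_comm c x y r : x * y = sc c * y * x ->
  div_pow x r * y = sc (c ^+ r) * y * div_pow x r.
Proof.
move=> xy; have H : x ^+ r * y = sc (c ^+ r) * y * x ^+ r.
  elim: r => [|r IHr]; first by rewrite !expr0 rmorph1 !mul1r mulr1.
  rewrite exprSr -mulrA xy [c ^+ r.+1]exprSr.
  have -> : x ^+ r * (sc c * y * x) = sc c * (x ^+ r * y) * x.
    by nc_coef F sc scC; ring.
  by rewrite IHr; nc_coef F sc scC; ring.
by rewrite /div_pow -mulrA H; nc_coef F sc scC; ring.
Qed.

Section Heisenberg.
Variables a y z : R.
Hypothesis az : a * z = sc q * z * a.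
Hypothesis zy : z * y = sc q * y * z.
Hypothesis ay : a * y = sc q^-1 * y * a + z.

Lemma div_powSl m : div_pow a m.+1 * y
  = sc (q ^- m.+1) * y * div_pow a m.+1 + z * div_pow a m.
Proof.
have H : a ^+ m.+1 * y
   = sc (q ^- m.+1) * y * a ^+ m.+1 + sc (qint q m.+1) * z * a ^+ m.
  elim: m => [|m IHm].
    by rewrite !expr1 ay expr0 mulr1 qint1 // rmorph1 mul1r.
  have -> : qint q m.+2 = q * qint q m.+1 + q ^- m.+1.
    by rewrite (qintD q_neq0 1) qint1 // mulr1 expr1.
  rewrite [a ^+ m.+2]exprS -mulrA IHm [a ^+ m.+1]exprS.
  set c := q ^- _; have -> : q ^- m.+2 = c * q^-1 by rewrite exprSr invfM mulrC.
  move: (qint q m.+1) c (a ^+ m) => d c b {IHm}.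
  apply/eqP; rewrite -subr_eq0; apply/eqP.
  transitivity (sc c * (a * y - sc q^-1 * y * a - z) * a * b
     + sc d * (a * z - sc q * z * a) * b).
    by nc_coef F sc scC; field.
  by rewrite ay az [_ + z]addrC addrK !subrr !mulr0 !mul0r addr0.
rewrite /div_pow -mulrA H qfactS.
move: (qint _ _) (qint_neq0 (ltn0Sn m)) (qfact q m) (qfact_neq0 qint_neq0 m).
move: (q ^- _) (a ^+ m.+1) (a ^+ m) => c A B d d_neq0 f f_neq0.
by nc_coef F sc scC; field; rewrite ?d_neq0 ?f_neq0.
Qed.

(** A q-analogue of normal ordering in the Heisenberg algebra: t counts the pairs (a, y) that merge
    into a z. The coefficients match by [p+1] = q^t [p+1-t] + q^-(p+1-t) [t]. *)
Lemma div_powM m p : (p <= m)%N -> div_pow a m * div_pow y p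
  = \sum_(0 <= t < p.+1) sc (q ^- ((m - t) * (p - t)))
      * (div_pow y (p - t) * div_pow z t * div_pow a (m - t)).
Proof.
elim: p => [_|p IHp lt_pm].
  by rewrite big_nat1 muln0 expr0 invr1 rmorph1 !div_pow0 subn0 mulr1 !mul1r.
have qp_neq0 := qint_neq0 (ltn0Sn p).
(* Multiplying by [p+1] turns y^(p+1) into y^(p) y, to which the induction hypothesis applies. *)
suff H : sc (qint q p.+1) * (div_pow a m * div_pow y p.+1)
   = sc (qint q p.+1) * \sum_(0 <= t < p.+2) sc (q ^- ((m - t) * (p.+1 - t)))
      * (div_pow y (p.+1 - t) * div_pow z t * div_pow a (m - t)).
  have := congr1 ( *%R (sc (qint q p.+1)^-1)) H.
  by rewrite !mulrA -!rmorphM mulVf // rmorph1 !mul1r.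
rewrite mulrA scC -mulrA -div_powSr mulrA IHp; last exact: ltnW.
pose T t := div_pow y (p.+1 - t) * div_pow z t * div_pow a (m - t).
have step t : (t <= p)%N -> sc (q ^- ((m - t) * (p - t)))
      * (div_pow y (p - t) * div_pow z t * div_pow a (m - t)) * y
   = sc (q ^- ((m - t) * (p - t)) * (q ^+ t * q ^- (m - t)) * qint q (p.+1 - t))
       * T t + sc (q ^- ((m - t) * (p - t)) * qint q t.+1) * T t.+1.
  move=> le_tp; have Dm : (m - t = (m - t.+1).+1)%N by lia.
  have Dp : (p.+1 - t = (p - t).+1)%N by lia.
  rewrite /T subSS Dp Dm.
  have zty := div_pow_comm t zy; have ym := div_powSr y (p - t).
  have zm := div_powSr z t; have ya := div_powSl (m - t.+1).
  rewrite -Dm in ya *; move: (q ^- (_ * _)) (q ^- (m - t)) ya => c1 c2 ya.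
  move: (q ^+ t) zty (div_pow y (p - t)) ym zm => c3 zty Y ym zm.
  move: (div_pow y (p - t).+1) ym => Y' ym.
  move: (div_pow z t.+1) (div_pow z t) zty zm => Z' Z zty zm.
  move: (div_pow a (m - t)) (div_pow a (m - t.+1)) ya => A A' ya.
  move: (qint q t.+1) (qint q (p - t).+1) ym zm => c4 c5 ym zm.
  apply/eqP; rewrite -subr_eq0; apply/eqP.
  transitivity (sc c1 * Y * Z * (A * y - (sc c2 * y * A + z * A'))
    + sc (c1 * c2) * Y * (Z * y - sc c3 * y * Z) * A
    + sc c1 * Y * (Z * z - sc c4 * Z') * A'
    + sc (c1 * c2 * c3) * (Y * y - sc c5 * Y') * Z * A).
    by nc_coef F sc scC; field.
  by rewrite ya zty zm ym !subrr !mulr0 !mul0r !addr0.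
rewrite mulr_suml; under eq_big_nat => t /andP[_ lt_t] do rewrite step //.
rewrite big_split /=.
have -> : \sum_(0 <= i < p.+1)
    sc (q ^- ((m - i) * (p - i)) * qint q i.+1) * T i.+1
  = \sum_(0 <= i < p.+2) sc (q ^- ((m - i).+1 * (p.+1 - i)) * qint q i) * T i.
  rewrite [RHS]big_nat_recl // qint0 mulr0 rmorph0 mul0r add0r.
  apply: eq_big_nat => i /andP[_ lt_i]; rewrite subSS.
  by have -> : ((m - i.+1).+1 = m - i)%N by lia.
have -> : \sum_(0 <= i < p.+1) sc (q ^- ((m - i) * (p - i))
      * (q ^+ i * q ^- (m - i)) * qint q (p.+1 - i)) * T i
  = \sum_(0 <= i < p.+2) sc (q ^- ((m - i) * (p - i))
      * (q ^+ i * q ^- (m - i)) * qint q (p.+1 - i)) * T i.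
  rewrite [RHS]big_nat_recr //= subnn qint0 mulr0 rmorph0 mul0r addr0.
  by [].
rewrite -big_split mulr_sumr; apply: eq_big_nat => t /andP[_ lt_t] /=.
rewrite mulrA -rmorphM -mulrDl -rmorphD; congr (sc _ * _).
have -> : qint q p.+1 = q ^+ t * qint q (p.+1 - t) + q ^- (p.+1 - t) * qint q t.
  by rewrite -qintD // subnKC.
have [Dt|neq_t] := eqVneq t p.+1.
  by rewrite Dt subnn qint0 !muln0 !mulr0 !add0r expr0 invr1 !mul1r mulr1.
have -> : (p.+1 - t = (p - t).+1)%N by lia.
rewrite mulSn mulnS !exprD !invfM; move: (qint _ _) (qint _ _) => c d.
by field; rewrite !expf_neq0.
Qed.

(** For m = p = r the term t = r of [div_powM] is z^(r) itself, and the other terms only involve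
    smaller divided powers of z. So the divided powers of root vectors inherit membership in a
    subring from those of the generators. *)
Lemma div_pow_qcomm_closed (I : R -> Prop) :
    (forall x y, I x -> I y -> I (x - y)) ->
    (forall x y, I x -> I y -> I (x * y)) ->
    I 1 -> (forall k, I (sc (q ^- k))) ->
    (forall r, I (div_pow a r)) -> (forall r, I (div_pow y r)) ->
  forall r, I (div_pow z r).
Proof.
move=> IB IM I1 Iq Ia Iy r; elim/ltn_ind: r => r IHr.
have I0 : I 0 by rewrite -(subrr 1); apply: (IB).
have ID u v : I u -> I v -> I (u + v).
  by move=> Iu Iv; rewrite -[v]opprK; apply: (IB) => //; rewrite -sub0r; apply: (IB).
have -> : div_pow z r = div_pow a r * div_pow y r
    - \sum_(0 <= t < r) sc (q ^- ((r - t) * (r - t)))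
      * (div_pow y (r - t) * div_pow z t * div_pow a (r - t)).
  rewrite div_powM // big_nat_recr //= subnn expr0 invr1 rmorph1 !div_pow0.
  by rewrite !mul1r mulr1 addrC addrK.
apply: (IB); first exact: (IM).
rewrite big_nat_cond.
elim/big_ind: _ => // t /andP[/andP[_ lt_tr] _].
by apply: (IM) => //; apply: (IM) => //; apply: (IM) => //; apply: IHr.
Qed.

End Heisenberg.

End DividedPowers.

(** * Presented algebras and specialization *)

Lemma malg_scaleAr (F : fieldType) (X : choiceType) c (x y : free_alg F X) :
  c *: (x * y) = x * (c *: y).
Proof.
rewrite malgME (malgMEw (fsubset_refl _) (msuppZ_le c y)) scaler_sumr.
apply: eq_bigr => k _; rewrite scaler_sumr; apply: eq_bigr => k' _.
apply/malgP => w.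
have -> : (c *: y)@_k' = c * y@_k' by apply: mcoeffZ.
have E a b : << a *g b >>@_w = a *+ (b == w) :> F by apply: mcoeffU.
rewrite {}E.
rewrite [LHS]mcoeffZ.
rewrite mcoeffU.
by rewrite mulrCA mulrnAr.
Qed.

Section PresentedAlgebra.
Variables (F : fieldType) (X : choiceType) (rel : free_alg F X -> Prop).

Local Notation P := (presented rel).
Local Notation pi := (presented_pi rel).

Lemma presented_piM : {morph pi : x y / x * y}.
Proof. by move=> x y; apply/esym/presented_mulE. Qed.

Lemma presented_pi1 : pi 1 = 1.
Proof. by []. Qed.

Lemma presented_piZ c : {morph pi : x / c *: x}.
Proof. by move=> x; apply/esym/(quotmod_scaleE (ideal_pred rel)). Qed.

Lemma presented_piB : {morph pi : x y / x - y}.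
Proof. by move=> x y; rewrite -scaleN1r presented_piD presented_piZ scaleN1r. Qed.

Lemma presented_piP (x : P) : exists z, x = pi z.
Proof. by exists (presented_repr x); rewrite presented_reprK. Qed.

Lemma presented_rel z : rel z -> pi z = 0.
Proof.
move=> rz; rewrite -(scale0r (pi 0)) -presented_piZ scale0r.
by apply/presented_piE; rewrite subr0; apply: ideal_rel.
Qed.

Lemma presented_rel_eq x y : rel (x - y) -> pi x = pi y.
Proof.
by move/presented_rel; rewrite presented_piB => /eqP; rewrite subr_eq0 => /eqP.
Qed.

(* Rewriting with the morphism lemmas makes unification unfold the product of
   [malg], hence the explicit terms. *)
Lemma presented_relM x y z w : rel (x * y - z * w) -> pi x * pi y = pi z * pi w.
Proof.
move/presented_rel_eq => H.
have A := etrans (esym (presented_piM x y)) H.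
exact (etrans A (presented_piM z w)).
Qed.

Lemma presented_rel_inv x y : rel (x * y - 1) -> pi x * pi y = 1.
Proof. by move/presented_rel_eq => H; exact: etrans (esym (presented_piM x y)) H. Qed.

Lemma presented_piM3 x y z : pi (x * y * z) = pi x * pi y * pi z.
Proof.
exact: etrans (presented_piM (x * y) z) (congr1 ( *%R^~ _) (presented_piM x y)).
Qed.

Lemma presented_rel_conj k x k' c :
  rel (k * x * k' - c *: x) -> pi k * pi x * pi k' = c *: pi x.
Proof.
move/presented_rel_eq => H.
have A := etrans (esym (presented_piM3 k x k')) H.
exact (etrans A (presented_piZ c x)).
Qed.

Lemma presented_rel_bracket x y z w c :
  rel (x * y - y * x - c *: (z - w)) ->
  pi x * pi y - pi y * pi x = c *: (pi z - pi w).
Proof.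
move/presented_rel_eq => H.
have E1 := etrans (presented_piB (x * y) (y * x))
  (congr2 (fun a b => a - b) (presented_piM x y) (presented_piM y x)).
have E2 := etrans (presented_piZ c (z - w))
  (congr1 ( *:%R c) (presented_piB z w)).
have E3 := etrans (esym E1) H.
exact (etrans E3 E2).
Qed.

Lemma presented_scaleAl c (x y : P) : c *: (x * y) = (c *: x) * y.
Proof.
have [[x' ->] [y' ->]] := (presented_piP x, presented_piP y).
by rewrite -!(presented_piM, presented_piZ) scalerAl.
Qed.

Lemma presented_scaleAr c (x y : P) : c *: (x * y) = x * (c *: y).
Proof.
have [[x' ->] [y' ->]] := (presented_piP x, presented_piP y).
by rewrite -!(presented_piM, presented_piZ) malg_scaleAr.
Qed.

Definition presented_scalar (c : F) : P := c *: (1 : P).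

Fact presented_scalar_is_additive : additive presented_scalar.
Proof. by move=> a b; rewrite /presented_scalar scalerBl. Qed.

Fact presented_scalar_is_monoid_morphism : monoid_morphism presented_scalar.
Proof.
split=> [|a b]; first by rewrite /presented_scalar scale1r.
by rewrite /presented_scalar -presented_scaleAl mul1r scalerA.
Qed.

HB.instance Definition _ := GRing.isZmodMorphism.Build F P presented_scalar
  presented_scalar_is_additive.
HB.instance Definition _ := GRing.isMonoidMorphism.Build F P presented_scalar
  presented_scalar_is_monoid_morphism.

Lemma presented_scalarE c x : presented_scalar c * x = c *: x.
Proof. by rewrite -presented_scaleAl mul1r. Qed.

Lemma presented_scalarC c x : presented_scalar c * x = x * presented_scalar c.
Proof. by rewrite -presented_scaleAl -presented_scaleAr mul1r mulr1. Qed.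

Lemma presented_rel_serre x y c :
  rel (x * x * y - c *: (x * y * x) + y * x * x) ->
  pi x * pi x * pi y - presented_scalar c * pi x * pi y * pi x
    + pi y * pi x * pi x = 0.
Proof.
move/presented_rel => H.
have E0 := etrans (presented_piZ c (x * y * x))
  (congr1 ( *:%R c) (presented_piM3 x y x)).
have E1 := etrans (presented_piB (x * x * y) (c *: (x * y * x)))
  (congr2 (fun a b => a - b) (presented_piM3 x x y) E0).
have E2 := etrans (presented_piD rel (x * x * y - c *: (x * y * x)) (y * x * x))
  (congr2 +%R E1 (presented_piM3 y x x)).
have E3 := etrans (esym E2) H.
move: (pi x) (pi y) E3 => a b; rewrite -presented_scalarE !mulrA.
by [].
Qed.

End PresentedAlgebra.

Section FreeExtension.
Variables (F : fieldType) (X : choiceType) (S : pzRingType).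
Variables (sc : {rmorphism F -> S}) (phi : X -> S).
Hypothesis scC : forall c x, sc c * x = x * sc c.

Definition malg_word (k : {fmonom X}) : S := \prod_(x <- k) phi x.
Definition malg_ext (z : free_alg F X) : S :=
  \sum_(k <- msupp z) sc z@_k * malg_word k.

Lemma malg_extEw (d : {fset {fmonom X}}) z : (msupp z `<=` d)%fset ->
  malg_ext z = \sum_(k <- d) sc z@_k * malg_word k.
Proof.
move=> le_d; rewrite [LHS](big_fset_incl _ le_d) => //= x _ /mcoeff_outdom ->.
by rewrite rmorph0 mul0r.
Qed.

Lemma malg_extU c k : malg_ext << c *g k >> = sc c * malg_word k.
Proof. by rewrite (malg_extEw msuppU_le) big_seq_fset1 mcoeffUU. Qed.

Lemma malg_extD : {morph malg_ext : x y / x + y}.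
Proof.
move=> x y; pose d := (msupp x `|` msupp y)%fset.
rewrite (malg_extEw (msuppD_le _ _)) (@malg_extEw d x) ?fsubsetUl //.
rewrite (@malg_extEw d y) ?fsubsetUr // -big_split /=.
by apply: eq_bigr => k _; rewrite mcoeffD rmorphD mulrDl.
Qed.

Lemma malg_extZ c : {morph malg_ext : x / c *: x >-> sc c * x}.
Proof.
move=> x; rewrite (malg_extEw (msuppZ_le _ _)) mulr_sumr.
by apply: eq_bigr => k _; rewrite mcoeffZ rmorphM mulrA.
Qed.

Lemma malg_ext0 : malg_ext 0 = 0.
Proof. by rewrite /malg_ext msupp0 big_seq_fset0. Qed.

Lemma malg_extB : {morph malg_ext : x y / x - y}.
Proof. by move=> x y; rewrite -scaleN1r malg_extD malg_extZ rmorphN1 mulN1r. Qed.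

Lemma malg_ext_sum I r (G : I -> free_alg F X) :
  malg_ext (\sum_(i <- r) G i) = \sum_(i <- r) malg_ext (G i).
Proof. exact: (big_morph _ malg_extD malg_ext0). Qed.

Lemma malg_wordM k k' :
  malg_word (mmul k k') = malg_word k * malg_word k'.
Proof. by rewrite /malg_word fmM big_cat. Qed.

Lemma malg_extM : {morph malg_ext : x y / x * y}.
Proof.
move=> x y; rewrite malgME malg_ext_sum mulr_suml; apply: eq_bigr => k _.
rewrite malg_ext_sum mulr_sumr; apply: eq_bigr => k' _.
rewrite malg_extU malg_wordM rmorphM -!mulrA; congr (_ * _).
by rewrite !mulrA scC.
Qed.

Lemma malg_ext1 : malg_ext 1 = 1.
Proof.
have -> : (1 : free_alg F X) = << (mone : {fmonom X}) >> by [].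
rewrite malg_extU rmorph1 mul1r /malg_word.
by rewrite fm1 big_nil.
Qed.

Lemma malg_ext_gen x : malg_ext << fmu x >> = phi x.
Proof. by rewrite malg_extU rmorph1 mul1r /malg_word fmuE big_seq1. Qed.

Variable rel : free_alg F X -> Prop.
Hypothesis ext_rel : forall z, rel z -> malg_ext z = 0.

Definition presented_ext (x : presented rel) : S :=
  malg_ext (presented_repr x).

Lemma presented_extE z : presented_ext (presented_pi rel z) = malg_ext z.
Proof.
have H : ideal_gen rel (presented_repr (presented_pi rel z) - z).
  by apply/presented_piE; rewrite presented_reprK.
apply/eqP; rewrite -subr_eq0 -malg_extB; apply/eqP.
elim: H => [x /ext_rel //||x y _ Hx _ Hy|a x _ Hx|a x _ Hx|a x _ Hx].
- exact: malg_ext0.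
- by rewrite malg_extD Hx Hy addr0.
- by rewrite malg_extZ Hx mulr0.
- by rewrite malg_extM Hx mulr0.
- by rewrite malg_extM Hx mul0r.
Qed.

Lemma presented_ext_gen x : presented_ext (presented_gen rel x) = phi x.
Proof. by rewrite presented_extE malg_ext_gen. Qed.

Lemma presented_ext1 : presented_ext 1 = 1.
Proof. by rewrite -presented_pi1 presented_extE malg_ext1. Qed.

Lemma presented_extM : {morph presented_ext : x y / x * y}.
Proof.
move=> x y; have [[x' ->] [y' ->]] := (presented_piP x, presented_piP y).
by rewrite -presented_piM !presented_extE malg_extM.
Qed.

Lemma presented_extB : {morph presented_ext : x y / x - y}.
Proof.
move=> x y; have [[x' ->] [y' ->]] := (presented_piP x, presented_piP y).
by rewrite -presented_piB !presented_extE malg_extB.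
Qed.

Lemma presented_extZ c : {morph presented_ext : x / c *: x >-> sc c * x}.
Proof.
move=> x; have [x' ->] := presented_piP x.
by rewrite -presented_piZ !presented_extE malg_extZ.
Qed.

Lemma presented_extX x n : presented_ext (x ^+ n) = presented_ext x ^+ n.
Proof.
elim: n => [|n IHn]; first by rewrite !expr0 presented_ext1.
by rewrite !exprS presented_extM IHn.
Qed.

End FreeExtension.

(** * The specialization of Laurent polynomials at zeta *)

Lemma vQ_neq0 : vQ != 0.
Proof. by rewrite /vQ tofrac_eq0 polyX_eq0. Qed.

Lemma vQX_neq1 r : (0 < r)%N -> vQ ^+ r != 1.
Proof.
case: r => // r _; rewrite /vQ -tofracXn -tofrac1 tofrac_eq.
by apply/eqP => /(congr1 (size : {poly rat} -> nat)); rewrite size_polyXn size_poly1.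
Qed.

Lemma qint_vQ_neq0 r : (0 < r)%N -> qint vQ r != 0.
Proof.
have H k : (0 < k)%N -> vQ ^+ k - vQ ^- k != 0.
  move=> k_gt0; have vk_neq0 : vQ ^+ k != 0 by rewrite expf_neq0 ?vQ_neq0.
  rewrite subr_eq0; apply/eqP => /(congr1 ( *%R (vQ ^+ k))).
  rewrite mulfV // -expr2 -exprM; apply/eqP/vQX_neq1.
  by rewrite muln_gt0 k_gt0.
by move=> r_gt0; rewrite mulf_neq0 ?H // invr_eq0 (H 1%N).
Qed.

Lemma horner_vQ (p : {poly int}) :
  (map_poly intr p).[vQ] = tofrac (map_poly intr p : {poly rat}).
Proof.
elim/poly_ind: p => [|p c IHp]; first by rewrite !rmorph0 horner0.
rewrite !rmorphD !rmorphM /= !map_polyX !map_polyC /= !hornerE IHp.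
by congr (_ + _); rewrite !rmorph_int.
Qed.

Section Specialization.
Variables (K : fieldType) (zeta : K).
Hypothesis zeta_neq0 : zeta != 0.

(** The graph of the ring morphism from Z[v,v^-1] to K that sends v to zeta; a relation, since its
    domain is only a subring of Q(v). *)
Definition specializes (c : Qv) (d : K) :=
  exists p k, c = laurent vQ p k /\ d = laurent zeta p k.

(** As v is transcendental, p / v^k = p' / v^k' amounts to an identity of polynomials over Z, which
    can be evaluated at zeta. *)
Lemma specializes_fun c d d' : specializes c d -> specializes c d' -> d = d'.
Proof.
case=> p [k [-> ->]] [p' [k' [E ->]]].
have vX j : vQ ^+ j != 0 by rewrite expf_neq0 ?vQ_neq0.
have zX j : zeta ^+ j != 0 by rewrite expf_neq0.
have {}E : p * 'X^k' = p' * 'X^k.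
  apply: (@map_inj_poly _ _ (intr : int -> rat)) => [x y|//|]; first exact: intr_inj.
  apply/eqP; rewrite !rmorphM /= !map_polyXn -tofrac_eq !tofracM !tofracXn.
  rewrite -!horner_vQ -/vQ; apply/eqP.
  have := congr1 ( *%R^~ (vQ ^+ k * vQ ^+ k')) E; rewrite /laurent.
  by rewrite mulrA divfK // [vQ ^+ k * _]mulrC mulrA divfK.
rewrite /laurent; apply: (mulIf (zX k)); apply: (mulIf (zX k')).
rewrite divfK // mulrAC divfK //.
have := congr1 (fun r => (map_poly intr r : {poly K}).[zeta]) E.
by rewrite !rmorphM /= !map_polyXn !hornerE.
Qed.

Lemma specializesB c d c' d' :
  specializes c d -> specializes c' d' -> specializes (c - c') (d - d').
Proof.
case=> p [k [-> ->]] [p' [k' [-> ->]]].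
exists (p * 'X^k' - p' * 'X^k), (k + k')%N.
have H (F : fieldType) (x : F) : x != 0 -> laurent x p k - laurent x p' k'
    = laurent x (p * 'X^k' - p' * 'X^k) (k + k').
  move=> x_neq0; rewrite /laurent rmorphB !rmorphM /= !map_polyXn !hornerE exprD.
  by field; rewrite !expf_neq0.
by rewrite !H ?vQ_neq0.
Qed.

Lemma specializesM c d c' d' :
  specializes c d -> specializes c' d' -> specializes (c * c') (d * d').
Proof.
case=> p [k [-> ->]] [p' [k' [-> ->]]]; exists (p * p'), (k + k')%N.
have H (F : fieldType) (x : F) : x != 0 -> laurent x p k * laurent x p' k'
    = laurent x (p * p') (k + k').
  move=> x_neq0; rewrite /laurent rmorphM hornerM exprD.
  by field; rewrite !expf_neq0.
by rewrite !H ?vQ_neq0.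
Qed.

Lemma specializes1 : specializes 1 1.
Proof. by exists 1, 0%N; rewrite /laurent !rmorph1 !hornerC !expr0 !divr1. Qed.

Lemma specializesX : specializes vQ zeta.
Proof. by exists 'X, 0%N; rewrite /laurent !map_polyX !hornerX !expr0 !divr1. Qed.

Lemma specializesV : specializes vQ^-1 zeta^-1.
Proof. by exists 1, 1%N; rewrite /laurent !rmorph1 !hornerC !expr1 !div1r. Qed.

Lemma specializes0 : specializes 0 0.
Proof.
have := specializesB specializes1 specializes1.
by rewrite !subrr.
Qed.

Lemma specializesD c d c' d' :
  specializes c d -> specializes c' d' -> specializes (c + c') (d + d').
Proof.
move=> cd /(specializesB specializes0); rewrite !sub0r => /(specializesB cd).
by rewrite !opprK.
Qed.

Lemma specializesXn c d k : specializes c d -> specializes (c ^+ k) (d ^+ k).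
Proof.
move=> cd; elim: k => [|k IHk]; first exact: specializes1.
by rewrite !exprS; apply: specializesM.
Qed.

Lemma specializesXz a : specializes (vQ ^ a) (zeta ^ a).
Proof.
case: a => k; first exact/specializesXn/specializesX.
by rewrite /exprz -!exprVn; apply/specializesXn/specializesV.
Qed.

Hypothesis zeta_sub_neq0 : zeta - zeta^-1 != 0.

(** [r] is defined as a fraction; the addition formula, starting from [1] = 1, shows that it is a
    Laurent polynomial. *)
Lemma specializes_qint r : specializes (qint vQ r) (qint zeta r).
Proof.
elim: r => [|r IHr]; first by rewrite !qint0; apply: specializes0.
rewrite -addn1 !qintD ?vQ_neq0 //.
have q1 (F : fieldType) (x : F) : x - x^-1 != 0 -> qint x 1 = 1.
  by move=> x_neq0; rewrite /qint expr1 divff.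
rewrite !q1 ?(qint_sub_neq0 qint_vQ_neq0) //.
apply: specializesD; apply: specializesM => //; first exact: (specializesXz r%:Z).
  exact: specializes1.
exact: specializesV.
Qed.

Lemma specializes_qfact r : specializes (qfact vQ r) (qfact zeta r).
Proof.
elim: r => [|r IHr]; first by rewrite !qfact0; apply: specializes1.
by rewrite !qfactS; apply: specializesM => //; apply: specializes_qint.
Qed.

End Specialization.

(** * The relations of the quantum group, over Q(v) and specialized *)

Section SerreExpansion.
Variables (F : fieldType) (q : F) (X : choiceType).
Hypothesis q_neq0 : q != 0.
Hypothesis qint_neq0 : forall r, (0 < r)%N -> qint q r != 0.
Implicit Types x y : free_alg F X.

Lemma qbinom_n0 m : qbinom q m 0 = 1.
Proof. by rewrite /qbinom qfact0 mul1r subn0 divff // qfact_neq0. Qed.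

Lemma qbinom_nn m : qbinom q m m = 1.
Proof. by rewrite /qbinom subnn qfact0 mulr1 divff // qfact_neq0. Qed.

Lemma qbinom21 : qbinom q 2 1 = qint q 2.
Proof. by rewrite /qbinom qfact1 // mulr1 divr1 qfactS qfact1 ?mul1r. Qed.

Lemma serre_sum3 x y :
  \sum_(s < 3) ((-1) ^+ s * qbinom q 2 s) *: (x ^+ (2 - s) * y * x ^+ s)
  = x * x * y - (q + q^-1) *: (x * y * x) + y * x * x.
Proof.
pose G s := ((-1) ^+ s * qbinom q 2 s) *: (x ^+ (2 - s) * y * x ^+ s).
rewrite -[LHS]/(\sum_(s < 3) G s) !big_ord_recr big_ord0 /= add0r.
have -> : G 0%N = x * x * y.
  by rewrite /G qbinom_n0 mulr1 scale1r; apply: mulr1.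
have -> : G 1%N = - ((q + q^-1) *: (x * y * x)).
  by rewrite /G qbinom21 qint2 // expr1 mulN1r scaleNr.
have -> // : G 2%N = y * x * x.
rewrite /G qbinom_nn mulr1 sqrrN expr1n scale1r -[(2 - 2)%N]/0%N (expr0 x).
by rewrite mul1r (expr2 x) mulrA.
Qed.

Lemma serre_sum2 x y :
  \sum_(s < 2) ((-1) ^+ s * qbinom q 1 s) *: (x ^+ (1 - s) * y * x ^+ s)
  = x * y - y * x.
Proof.
pose G s := ((-1) ^+ s * qbinom q 1 s) *: (x ^+ (1 - s) * y * x ^+ s).
rewrite -[LHS]/(\sum_(s < 2) G s) !big_ord_recr big_ord0 /= add0r.
have -> : G 0%N = x * y.
  by rewrite /G qbinom_n0 mulr1 scale1r; apply: mulr1.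
have -> // : G 1%N = - (y * x).
rewrite /G qbinom_nn mulr1 (expr1 (-1)).
by rewrite scaleN1r -[(1 - 1)%N]/0%N (expr0 x) (expr1 x) mul1r.
Qed.

End SerreExpansion.

Lemma serre_neg1 n (x y : free_alg Qv (uq_sym n)) :
  serre x y (-1)
  = x * x * y - (vQ + vQ^-1) *: (x * y * x) + y * x * x.
Proof. exact: (serre_sum3 vQ_neq0 qint_vQ_neq0). Qed.

Lemma serre_0 n (x y : free_alg Qv (uq_sym n)) : serre x y 0 = x * y - y * x.
Proof. exact: (serre_sum2 qint_vQ_neq0). Qed.

Definition adjacent (n : nat) (i j : 'I_n) : bool :=
  (i.+1 == j :> nat) || (j.+1 == i :> nat).

(** One list of relations serves for the algebra over Q(v), its specialization, the small quantum
    group and the operators on functions. Conjugations by K_i are rewritten as q-commutations and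
    the Serre sums are expanded, ready for noncommutative normalization. *)
Record uq_rep (n : nat) (F : fieldType) (R : pzRingType)
    (sc : F -> R) (q : F) (E F' K K' : 'I_n -> R) : Prop := UqRep {
  uq_KVr i : K i * K' i = 1;
  uq_KVl i : K' i * K i = 1;
  uq_KC i j : K i * K j = K j * K i;
  uq_KEq i j : K i * E j = sc (q ^ cartanA i j) * E j * K i;
  uq_KFq i j : K i * F' j = sc (q ^ (- cartanA i j)) * F' j * K i;
  uq_EFq i j : E i * F' j - F' j * E i
    = sc ((i == j)%:R / (q - q^-1)) * (K i - K' i);
  uq_E_far i j : i != j -> ~~ adjacent i j -> E i * E j = E j * E i;
  uq_F_far i j : i != j -> ~~ adjacent i j -> F' i * F' j = F' j * F' i;
  uq_E_adj i j : adjacent i j ->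
    E i * E i * E j - sc (q + q^-1) * E i * E j * E i + E j * E i * E i = 0;
  uq_F_adj i j : adjacent i j ->
    F' i * F' i * F' j - sc (q + q^-1) * F' i * F' j * F' i
      + F' j * F' i * F' i = 0
}.

Lemma adjacent_neq n (i j : 'I_n) : adjacent i j -> i != j.
Proof. by rewrite /adjacent => A; apply/eqP => /(congr1 val) /=; lia. Qed.

Lemma cartanA_adj n (i j : 'I_n) : i != j ->
  cartanA i j = if adjacent i j then -1 else 0.
Proof. by rewrite /cartanA => /negPf->. Qed.

Section QuantumGroup.
Variable n : nat.
Local Notation rel := (@uq_rel n).
Local Notation pi := (presented_pi rel).
Local Notation scv := (presented_scalar rel).

Lemma pi_serre_adj x y : rel (serre x y (-1)) ->
  pi x * pi x * pi y - scv (vQ + vQ^-1) * pi x * pi y * pi x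
    + pi y * pi x * pi x = 0.
Proof.
by rewrite serre_neg1; exact: presented_rel_serre.
Qed.

Lemma pi_serre_far x y : rel (serre x y 0) -> pi x * pi y = pi y * pi x.
Proof. by rewrite serre_0 => /presented_relM. Qed.

Lemma Uv_KVl i : Uv_K' i * Uv_K i = 1 :> Uv n.
Proof. exact: (presented_rel_inv (uq_K'K i)). Qed.

Lemma Uv_conj i (x : Uv n) c : Uv_K i * x * Uv_K' i = c *: x ->
  Uv_K i * x = scv c * x * Uv_K i.
Proof.
have KVl := Uv_KVl i; move: (Uv_K i) (Uv_K' i) KVl => k k' kV H.
by rewrite presented_scalarE -H -mulrA kV mulr1.
Qed.

Lemma Uv_rep : uq_rep scv vQ (@Uv_E n) (@Uv_F n) (@Uv_K n) (@Uv_K' n).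
Proof.
split.
- by move=> i; exact: (presented_rel_inv (uq_KK' i)).
- exact: Uv_KVl.
- by move=> i j; exact: (presented_relM (uq_KK i j)).
- by move=> i j; apply: Uv_conj; exact: (presented_rel_conj (uq_KE i j)).
- by move=> i j; apply: Uv_conj; exact: (presented_rel_conj (uq_KF i j)).
- move=> i j; rewrite presented_scalarE.
  exact: (presented_rel_bracket (uq_EF i j)).
- move=> i j nij aij; have H := uq_EE nij.
  have E : cartanA i j = 0 by rewrite cartanA_adj // (negPf aij).
  by rewrite {}E in H; exact (pi_serre_far H).
- move=> i j nij aij; have H := uq_FF nij.
  have E : cartanA i j = 0 by rewrite cartanA_adj // (negPf aij).
  by rewrite {}E in H; exact (pi_serre_far H).
- move=> i j aij; have H := uq_EE (adjacent_neq aij).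
  have E : cartanA i j = -1 by rewrite cartanA_adj ?adjacent_neq // aij.
  by rewrite {}E in H; exact (pi_serre_adj H).
- move=> i j aij; have H := uq_FF (adjacent_neq aij).
  have E : cartanA i j = -1 by rewrite cartanA_adj ?adjacent_neq // aij.
  by rewrite {}E in H; exact (pi_serre_adj H).
Qed.

Section Tensor.
Variables (K : fieldType) (zeta : K).
Local Notation trel := (@tensor_rel n K zeta).
Local Notation tpi := (presented_pi trel).
Local Notation scz := (presented_scalar trel).
Local Notation UKof := (@UK_of n K zeta).

Definition pure_tensor (x : UA n) (c : K) : UK n zeta :=
  presented_gen trel (x, c).

Lemma pure_tensorE x c : pure_tensor x c = c *: UKof x.
Proof.
have := presented_rel (tensor_Z zeta c x 1).
rewrite presented_piB presented_piZ mulr1.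
by move/eqP; rewrite subr_eq0 => /eqP.
Qed.

Lemma UK_ofD : {morph UKof : x y / x + y}.
Proof.
move=> x y; have := presented_rel (tensor_Dl zeta x y 1).
rewrite !presented_piB; move/eqP; rewrite -addrA -opprD subr_eq0 => /eqP.
by [].
Qed.

Lemma UK_ofM : {morph UKof : x y / x * y}.
Proof.
move=> x y; have := presented_rel (tensor_M zeta x y 1 1).
rewrite !presented_piB presented_piM mulr1.
by move/eqP; rewrite subr_eq0 => /eqP.
Qed.

Lemma UK_of1 : UKof 1 = 1.
Proof.
have := presented_rel (tensor_1 n zeta); rewrite presented_piB.
by move/eqP; rewrite subr_eq0 => /eqP.
Qed.

Lemma UK_of_scale p k x : UKof (UA_scale p k x) = laurent zeta p k *: UKof x.
Proof.
have := presented_rel (tensor_balanced zeta p k x 1).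
rewrite !presented_piB mulr1; move/eqP; rewrite subr_eq0 => /eqP.
by rewrite -pure_tensorE.
Qed.

Lemma UK_of0 : UKof 0 = 0.
Proof. by apply: (addrI (UKof 0)); rewrite -UK_ofD !addr0. Qed.

Lemma UK_ofB : {morph UKof : x y / x - y}.
Proof.
by move=> x y; apply: (addIr (UKof y)); rewrite -UK_ofD !subrK.
Qed.

(** The graph of a partial map, defined on Lusztig's form. It is functional because that form is a
    subset of [Uv n], so an identity over Q(v) between elements that have images also holds between
    the images. *)
Definition UK_image (x : Uv n) (y : UK n zeta) :=
  exists x' : UA n, subalg_val x' = x /\ UKof x' = y.

Lemma UK_image_fun x y y' : UK_image x y -> UK_image x y' -> y = y'.
Proof.
by case=> u [<- <-] [u' [/val_inj-> <-]].
Qed.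

Lemma UK_image1 : UK_image 1 1.
Proof. by exists 1; rewrite UK_of1. Qed.

Lemma UK_imageM x y x' y' :
  UK_image x y -> UK_image x' y' -> UK_image (x * x') (y * y').
Proof. by case=> u [<- <-] [u' [<- <-]]; exists (u * u'); rewrite UK_ofM. Qed.

Lemma UK_imageB x y x' y' :
  UK_image x y -> UK_image x' y' -> UK_image (x - x') (y - y').
Proof. by case=> u [<- <-] [u' [<- <-]]; exists (u - u'); rewrite UK_ofB. Qed.

Lemma UK_image0 : UK_image 0 0.
Proof. by exists 0; rewrite UK_of0. Qed.

Lemma UK_imageD x y x' y' :
  UK_image x y -> UK_image x' y' -> UK_image (x + x') (y + y').
Proof. by case=> u [<- <-] [u' [<- <-]]; exists (u + u'); rewrite UK_ofD. Qed.

Lemma UK_imageX x y k : UK_image x y -> UK_image (x ^+ k) (y ^+ k).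
Proof.
move=> xy; elim: k => [|k IHk]; first exact: UK_image1.
by rewrite !exprS; apply: UK_imageM.
Qed.

Lemma UK_imageZ c d x y : specializes zeta c d ->
  UK_image x y -> UK_image (scv c * x) (scz d * y).
Proof.
case=> p [k [-> ->]] [u [<- <-]]; exists (UA_scale p k u).
by rewrite UK_of_scale /= !presented_scalarE.
Qed.

Lemma UK_image_scalar c d : specializes zeta c d -> UK_image (scv c) (scz d).
Proof. by move/UK_imageZ/(_ UK_image1); rewrite !mulr1. Qed.

Definition UK_E i := UKof (UA_E i 1).
Definition UK_F i := UKof (UA_F i 1).
Definition UK_K i := UKof (UA_K i).
Definition UK_K' i := UKof (subalg_elt is_laurent (lusztig_K' i)).

Lemma divpow1 (x : Uv n) : divpow x 1 = x.
Proof. by rewrite /divpow qfact1 ?invr1 ?scale1r ?expr1 //; apply: qint_vQ_neq0. Qed.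

Lemma UK_image_E i : UK_image (Uv_E i) (UK_E i).
Proof. by exists (UA_E i 1); rewrite /= divpow1. Qed.
Lemma UK_image_F i : UK_image (Uv_F i) (UK_F i).
Proof. by exists (UA_F i 1); rewrite /= divpow1. Qed.
Lemma UK_image_K i : UK_image (Uv_K i) (UK_K i).
Proof. by exists (UA_K i). Qed.
Lemma UK_image_K' i : UK_image (Uv_K' i) (UK_K' i).
Proof. by exists (subalg_elt is_laurent (lusztig_K' i)). Qed.

Hypothesis zeta_neq0 : zeta != 0.
Hypothesis zeta_sub_neq0 : zeta - zeta^-1 != 0.

Lemma UK_rep : uq_rep scz zeta UK_E UK_F UK_K UK_K'.
Proof.
have [KVr KVl KC KEq KFq EFq EF FF EA FA] := Uv_rep.
have tr x x' y y' : UK_image x x' -> UK_image y y' -> x = y -> x' = y'.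
  by move=> Hx Hy Exy; apply: UK_image_fun Hx _; rewrite Exy.
have sXz a := UK_image_scalar (specializesXz zeta_neq0 a).
have iE := UK_image_E; have iF := UK_image_F.
have iK := UK_image_K; have iK' := UK_image_K'.
have iq2 := UK_image_scalar (specializesD zeta_neq0 (specializesX zeta) (specializesV zeta)).
have iM3 x y z x' y' z' (a : UK_image x x') (b : UK_image y y')
    (c : UK_image z z') := UK_imageM (UK_imageM a b) c.
have iM4 x y z t x' y' z' t' (a : UK_image x x') (b : UK_image y y')
    (c : UK_image z z') (d : UK_image t t') := UK_imageM (iM3 _ _ _ _ _ _ a b c) d.
split=> [i|i|i j|i j|i j|i j|i j nij aij|i j nij aij|i j aij|i j aij].
- exact (tr _ _ _ _ (UK_imageM (iK i) (iK' i)) UK_image1 (KVr i)).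
- exact (tr _ _ _ _ (UK_imageM (iK' i) (iK i)) UK_image1 (KVl i)).
- exact (tr _ _ _ _ (UK_imageM (iK i) (iK j)) (UK_imageM (iK j) (iK i)) (KC i j)).
- exact (tr _ _ _ _ (UK_imageM (iK i) (iE j))
    (iM3 _ _ _ _ _ _ (sXz _) (iE j) (iK i)) (KEq i j)).
- exact (tr _ _ _ _ (UK_imageM (iK i) (iF j))
    (iM3 _ _ _ _ _ _ (sXz _) (iF j) (iK i)) (KFq i j)).
- have [<-{j}|nij] := eqVneq i j; last first.
    have H := EFq i j; rewrite (negPf nij) mul0r rmorph0 mul0r in H.
    rewrite mul0r rmorph0 mul0r.
    exact (tr _ _ _ _ (UK_imageB (UK_imageM (iE i) (iF j))
      (UK_imageM (iF j) (iE i))) UK_image0 H).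
  (* The coefficient 1/(v - v^-1) is not a Laurent polynomial: the relation is multiplied by v -
     v^-1, transported, and divided by zeta - zeta^-1. *)
  have sub : specializes zeta (vQ - vQ^-1) (zeta - zeta^-1).
    exact (specializesB zeta_neq0 (specializesX zeta) (specializesV zeta)).
  have H : scv (vQ - vQ^-1) * (Uv_E i * Uv_F i - Uv_F i * Uv_E i)
    = Uv_K i - Uv_K' i.
    rewrite EFq eqxx mulrA -rmorphM mul1r divff ?rmorph1 ?mul1r //.
    exact: (qint_sub_neq0 qint_vQ_neq0).
  have {}H := tr _ _ _ _ (UK_imageZ sub (UK_imageB (UK_imageM (iE i) (iF i))
      (UK_imageM (iF i) (iE i)))) (UK_imageB (iK i) (iK' i)) H.
  by rewrite -H mulrA -rmorphM /= mul1r mulVf // rmorph1 mul1r.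
- exact (tr _ _ _ _ (UK_imageM (iE i) (iE j)) (UK_imageM (iE j) (iE i)) (EF i j nij aij)).
- exact (tr _ _ _ _ (UK_imageM (iF i) (iF j)) (UK_imageM (iF j) (iF i)) (FF i j nij aij)).
- exact (tr _ _ _ _ (UK_imageD (UK_imageB (iM3 _ _ _ _ _ _ (iE i) (iE i) (iE j))
    (iM4 _ _ _ _ _ _ _ _ iq2 (iE i) (iE j) (iE i)))
    (iM3 _ _ _ _ _ _ (iE j) (iE i) (iE i))) UK_image0 (EA i j aij)).
- exact (tr _ _ _ _ (UK_imageD (UK_imageB (iM3 _ _ _ _ _ _ (iF i) (iF i) (iF j))
    (iM4 _ _ _ _ _ _ _ _ iq2 (iF i) (iF j) (iF i)))
    (iM3 _ _ _ _ _ _ (iF j) (iF i) (iF i))) UK_image0 (FA i j aij)).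
Qed.

End Tensor.

End QuantumGroup.

(* Extending the generators by 0 beyond the rank keeps all the relations, and
   avoids arithmetic on ordinals. *)
Definition nat_gen (n : nat) (R : pzRingType) (x : 'I_n -> R) (j : nat) : R :=
  if insub j is Some i then x i else 0.

Section NatGen.
Variables (n : nat) (F : fieldType) (R : pzRingType) (sc : {rmorphism F -> R}).
Variables (q : F) (x : 'I_n -> R).

Lemma nat_genE (i : 'I_n) : nat_gen x i = x i.
Proof. by rewrite /nat_gen valK. Qed.

Lemma nat_gen_out i : (n <= i)%N -> nat_gen x i = 0.
Proof. by move=> le_ni; rewrite /nat_gen insubF // ltnNge le_ni. Qed.

Hypothesis x_far : forall i j, i != j -> ~~ adjacent i j -> x i * x j = x j * x i.
Hypothesis x_adj : forall i j, adjacent i j ->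
    x i * x i * x j - sc (q + q^-1) * x i * x j * x i + x j * x i * x i = 0.

Lemma nat_gen_far i j : (i.+1 < j)%N ->
  nat_gen x i * nat_gen x j = nat_gen x j * nat_gen x i.
Proof.
move=> lt_ij; have [lt_jn|le_nj] := ltnP j n; last first.
  by rewrite (nat_gen_out le_nj) mulr0 mul0r.
have lt_in : (i < n)%N by lia.
rewrite -[i]/(nat_of_ord (Ordinal lt_in)) -[j]/(nat_of_ord (Ordinal lt_jn)).
rewrite !nat_genE; apply: x_far; rewrite /adjacent -?val_eqE /=; lia.
Qed.

Lemma nat_gen_serre i : serre2 sc q (nat_gen x i) (nat_gen x i.+1) = 0.
Proof.
have [lt_jn|le_nj] := ltnP i.+1 n; last first.
  by rewrite (nat_gen_out le_nj) /serre2 !mulr0 !mul0r subrr addr0.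
have lt_in : (i < n)%N by lia.
have -> : nat_gen x i = x (Ordinal lt_in) by rewrite -nat_genE.
have -> : nat_gen x i.+1 = x (Ordinal lt_jn) by rewrite -nat_genE.
by apply: x_adj; rewrite /adjacent /= eqxx.
Qed.

Lemma nat_gen_serre' i : serre2 sc q (nat_gen x i.+1) (nat_gen x i) = 0.
Proof.
have [lt_jn|le_nj] := ltnP i.+1 n; last first.
  by rewrite (nat_gen_out le_nj) /serre2 !mulr0 !mul0r subrr addr0 // mulr0.
have lt_in : (i < n)%N by lia.
have -> : nat_gen x i = x (Ordinal lt_in) by rewrite -nat_genE.
have -> : nat_gen x i.+1 = x (Ordinal lt_jn) by rewrite -nat_genE.
by apply: x_adj; rewrite /adjacent /= eqxx orbT.
Qed.

End NatGen.

Lemma qint2_neq0 (F : fieldType) (q : F) : q != 0 -> q - q^-1 != 0 ->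
  qint q 2 != 0 -> 1 + q ^+ 2 != 0.
Proof.
move=> q_neq0 q_sub; rewrite (qintD q_neq0 1) /qint !expr1 divff // !mulr1.
apply: contra_neq => H; apply: (mulfI q_neq0); rewrite mulr0 mulrDr divff //.
by rewrite -expr2 addrC.
Qed.

(** * Vanishing of the l-th powers of root vectors *)

Section RootVectorPower.
Variables (n : nat) (K : fieldType) (zeta : K) (l : nat).
Hypothesis zeta_neq0 : zeta != 0.
Hypothesis zeta_sub_neq0 : zeta - zeta^-1 != 0.
Hypothesis qfact_l : qfact zeta l = 0.

Local Notation scv := (presented_scalar (@uq_rel n)).
Local Notation scz := (presented_scalar (@tensor_rel n K zeta)).

Variables (xv : 'I_n -> Uv n) (xz : 'I_n -> UK n zeta).
Hypothesis x_far : forall i j, i != j -> ~~ adjacent i j ->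
  xv i * xv j = xv j * xv i.
Hypothesis x_adj : forall i j, adjacent i j -> xv i * xv i * xv j
  - scv (vQ + vQ^-1) * xv i * xv j * xv i + xv j * xv i * xv i = 0.
Hypothesis x_image : forall i, UK_image (xv i) (xz i).
Hypothesis x_divpow : forall i r, exists y : UK n zeta,
  UK_image (divpow (xv i) r) y.

Lemma root_vec_image s d :
  UK_image (root_vec scv vQ (nat_gen xv) s d)
           (root_vec scz zeta (nat_gen xz) s d).
Proof.
apply: (root_vec_related (T := @UK_image n K zeta)).
- exact: UK_imageB.
- exact: UK_imageM.
- by apply: UK_image_scalar; apply: specializesV.
by move=> j; rewrite /nat_gen; case: insub => [i|]; [exact: x_image|exact: UK_image0].
Qed.

Lemma root_vec_div_pow s d r : exists y : UK n zeta,
  UK_image (div_pow scv vQ (root_vec scv vQ (nat_gen xv) s d) r) y.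
Proof.
have gen j k : exists y : UK n zeta,
    UK_image (div_pow scv vQ (nat_gen xv j) k) y.
  rewrite /nat_gen /div_pow; case: insub => [i|].
    have [y Hy] := x_divpow i k; exists y.
    by move: Hy; rewrite /divpow presented_scalarE.
  case: k => [|k]; last by exists 0; rewrite expr0n mulr0; apply: UK_image0.
  by exists 1; rewrite qfact0 invr1 rmorph1 mul1r; apply: UK_image1.
have scC := @presented_scalarC _ _ (@uq_rel n).
have far := nat_gen_far x_far; have adj := nat_gen_serre x_adj.
have adj' := nat_gen_serre' x_adj.
have v2 := qint2_neq0 vQ_neq0 (qint_sub_neq0 qint_vQ_neq0)
  (qint_vQ_neq0 (ltn0Sn 1)).
elim: d r => [|d IHd] r; first exact: gen.
have az := e_root_vec_end scC vQ_neq0 far adj' s d.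
have zy := root_vec_qcomm scC vQ_neq0 far adj adj' v2 s (ltnSn d).
have ay := e_root_vec_next scv vQ (nat_gen xv) s d.
pose I (x : Uv n) := exists y : UK n zeta, UK_image x y.
apply: (div_pow_qcomm_closed scC vQ_neq0 qint_vQ_neq0 az zy ay (I := I)).
- by move=> x y [x' Hx] [y' Hy]; exists (x' - y'); apply: UK_imageB.
- by move=> x y [x' Hx] [y' Hy]; exists (x' * y'); apply: UK_imageM.
- by exists 1; apply: UK_image1.
- move=> k; exists (scz (zeta ^- k)); apply: UK_image_scalar.
  by rewrite -!exprVn; apply/specializesXn/specializesV.
- exact: gen.
- exact: IHd.
Qed.

(** Over Q(v) the power X^l equals [l]! X^(l); the divided power has an image and [l]! specializes
    to 0. *)
Lemma root_vecXl0 s d : root_vec scz zeta (nat_gen xz) s d ^+ l = 0.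
Proof.
have [y Hy] := root_vec_div_pow s d l.
have Hl := UK_imageZ (specializes_qfact zeta_neq0 zeta_sub_neq0 l) Hy.
have Hx := UK_imageX l (root_vec_image s d).
rewrite qfact_l rmorph0 mul0r /div_pow mulrA -rmorphM in Hl.
rewrite mulfV ?qfact_neq0 ?rmorph1 ?mul1r // in Hl; last exact: qint_vQ_neq0.
exact: UK_image_fun Hx Hl.
Qed.

End RootVectorPower.

(** * The small quantum group: induction principle and relations *)

Section SmallQuantumGroup.
Variables (n : nat) (K : fieldType) (zeta : K).

Local Notation scz := (presented_scalar (@tensor_rel n K zeta)).
Local Notation R := (small_u n zeta).
Local Notation val := (fun x : R => subalg_val x).

Lemma small_val_inj : injective val.
Proof. exact: val_inj. Qed.

Fact small_scalar_is_additive : additive (small_scalar n zeta).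
Proof.
move=> a b; apply: small_val_inj.
exact: (rmorphB (@presented_scalar _ _ (@tensor_rel n K zeta)) a b).
Qed.

Fact small_scalar_is_monoid_morphism : monoid_morphism (small_scalar n zeta).
Proof.
split=> [|a b]; apply: small_val_inj.
  exact: (rmorph1 (@presented_scalar _ _ (@tensor_rel n K zeta))).
exact: (rmorphM (@presented_scalar _ _ (@tensor_rel n K zeta)) a b).
Qed.

HB.instance Definition _ := GRing.isZmodMorphism.Build K R
  (small_scalar n zeta) small_scalar_is_additive.
HB.instance Definition _ := GRing.isMonoidMorphism.Build K R
  (small_scalar n zeta) small_scalar_is_monoid_morphism.

Local Notation sc := (small_scalar n zeta).

Lemma small_scalarC c (x : R) : sc c * x = x * sc c.
Proof. by apply: small_val_inj; apply: presented_scalarC. Qed.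

Lemma small_u_ind (P : R -> Prop) :
  (forall c, P (sc c)) -> (forall x y, P x -> P y -> P (x - y)) ->
  (forall x y, P x -> P y -> P (x * y)) ->
  (forall i, P (small_E zeta i)) -> (forall i, P (small_F zeta i)) ->
  (forall i, P (small_K zeta i)) -> forall x, P x.
Proof.
move=> Psc PB PM PE PF PK.
have P1 : P 1 by rewrite -(rmorph1 (small_scalar n zeta)); apply: Psc.
suff H y : subalg_gen (@all_scalars K) (@small_gen n K zeta) y ->
    forall x : R, val x = y -> P x.
  by move=> x; case: (x) => y Hy; apply: (H y) => //; apply/asboolP.
elim=> {y} [y [] i x Dx||y z Hy IHy Hz IHz x Dx|y z Hy IHy Hz IHz x Dx
           |c y _ Hy IHy x Dx].
- by rewrite (small_val_inj (Dx : val x = val (small_E zeta i))).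
- by rewrite (small_val_inj (Dx : val x = val (small_F zeta i))).
- by rewrite (small_val_inj (Dx : val x = val (small_K zeta i))).
- by move=> x Dx; rewrite (small_val_inj (Dx : val x = val 1)).
- pose y' : R := Subalg (introT (asboolP _) Hy).
  pose z' : R := Subalg (introT (asboolP _) Hz).
  rewrite (small_val_inj (Dx : val x = val (y' - z'))).
  by apply: PB; [apply: IHy|apply: IHz].
- pose y' : R := Subalg (introT (asboolP _) Hy).
  pose z' : R := Subalg (introT (asboolP _) Hz).
  rewrite (small_val_inj (Dx : val x = val (y' * z'))).
  by apply: PM; [apply: IHy|apply: IHz].
- pose y' : R := Subalg (introT (asboolP _) Hy).
  have -> : x = sc c * y'.
    by apply: small_val_inj; rewrite Dx -presented_scalarE.
  by apply: PM => //; apply: IHy.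
Qed.

Hypothesis zeta_neq0 : zeta != 0.
Hypothesis zeta_sub_neq0 : zeta - zeta^-1 != 0.

(* K_i^-1 is not a generator of u, but it is recovered from the commutator
   of E_i and F_i. *)
Definition small_K' (i : 'I_n) : R :=
  small_K zeta i - sc (zeta - zeta^-1)
    * (small_E zeta i * small_F zeta i - small_F zeta i * small_E zeta i).

Lemma small_K'_val i : val (small_K' i) = UK_K' zeta i.
Proof.
have := uq_EFq (UK_rep n zeta_neq0 zeta_sub_neq0) i i; rewrite eqxx mul1r => H.
have -> : val (small_K' i) = UK_K zeta i - scz (zeta - zeta^-1)
    * (UK_E zeta i * UK_F zeta i - UK_F zeta i * UK_E zeta i) by [].
move: (UK_K zeta i) (UK_K' zeta i) (_ - _) H => k k' x ->.
by rewrite mulrA -rmorphM mulfV // rmorph1 mul1r opprB addrC subrK.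
Qed.

Lemma small_rep : uq_rep sc zeta (@small_E n K zeta) (@small_F n K zeta)
  (@small_K n K zeta) small_K'.
Proof.
have [KVr KVl KC KEq KFq EFq EF FF EA FA] := UK_rep n zeta_neq0 zeta_sub_neq0.
split=> [i|i|i j|i j|i j|i j|i j nij aij|i j nij aij|i j aij|i j aij];
  apply: small_val_inj.
- by have := KVr i; rewrite -small_K'_val.
- by have := KVl i; rewrite -small_K'_val.
- exact (KC i j).
- exact (KEq i j).
- exact (KFq i j).
- by have := EFq i j; rewrite -small_K'_val.
- exact (EF i j nij aij).
- exact (FF i j nij aij).
- exact (EA i j aij).
- exact (FA i j aij).
Qed.

Lemma root_vec_val (x : 'I_n -> R) s d :
  val (root_vec sc zeta (nat_gen x) s d)
  = root_vec scz zeta (nat_gen (fun i => val (x i))) s d.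
Proof.
apply: (root_vec_related (T := fun x y => val x = y)).
- by move=> y _ z _ <- <-.
- by move=> y _ z _ <- <-.
- by [].
by move=> j; rewrite /nat_gen; case: insub.
Qed.

Variable l : nat.
Hypothesis qfact_l : qfact zeta l = 0.

Lemma small_valX (x : R) k : val (x ^+ k) = val x ^+ k.
Proof. by elim: k => [|k IHk] //; rewrite !exprS -IHk. Qed.

Lemma small_E_root_vecXl s d :
  root_vec sc zeta (nat_gen (@small_E n K zeta)) s d ^+ l = 0.
Proof.
apply: small_val_inj; rewrite small_valX root_vec_val.
have [_ _ _ _ _ _ far _ adj _] := Uv_rep n.
apply: (root_vecXl0 zeta_neq0 zeta_sub_neq0 qfact_l far adj) => [i|i r].
  exact: UK_image_E.
by exists (UK_of zeta (UA_E i r)); exists (UA_E i r).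
Qed.

Lemma small_F_root_vecXl s d :
  root_vec sc zeta (nat_gen (@small_F n K zeta)) s d ^+ l = 0.
Proof.
apply: small_val_inj; rewrite small_valX root_vec_val.
have [_ _ _ _ _ _ _ far _ adj] := Uv_rep n.
apply: (root_vecXl0 zeta_neq0 zeta_sub_neq0 qfact_l far adj) => [i|i r].
  exact: UK_image_F.
by exists (UK_of zeta (UA_F i r)); exists (UA_F i r).
Qed.

End SmallQuantumGroup.

(** * The module V(lambda) over the raising operators *)

Section Multiindices.
Variables (n l : nat).
Local Notation mi := (multiindex n l).
Implicit Types m : mi.

Definition is_root_index (s t : nat) : bool := (0 < s <= t)%N && (t <= n)%N.

Lemma root_indexP s t : is_root_index s t ->
  exists p : posroot n, [/\ val (val p).1 = s, val (val p).2 = t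
    & forall p', is_posroot s t p' = (p' == p)].
Proof.
move=> /andP[/andP[s_gt0 le_st] le_tn].
pose a : 'I_n.+1 := inord s; pose b : 'I_n.+1 := inord t.
have Da : a = s :> nat by rewrite inordK // ltnS (leq_trans le_st).
have Db : b = t :> nat by rewrite inordK // ltnS.
have ab : (0 < (a, b).1 <= (a, b).2)%N by rewrite /= Da Db s_gt0.
exists (exist _ (a, b) ab); split=> // p'.
by rewrite /is_posroot -val_eqE -Da -Db /=.
Qed.

Lemma mcomp_out m s t : ~~ is_root_index s t -> mcomp m s t = 0.
Proof.
move=> Nst; rewrite /mcomp big_pred0 // => p; apply: contraNF Nst.
case/andP=> /eqP<- /eqP<-; rewrite /is_root_index (valP p) /=.
by rewrite -ltnS ltn_ord.
Qed.

Lemma mcomp_val m (p : posroot n) : mcomp m (val p).1 (val p).2 = m p.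
Proof.
by rewrite /mcomp (big_pred1 p).
Qed.

Lemma mcompD m m' s t : mcomp (m + m') s t = mcomp m s t + mcomp m' s t.
Proof. by rewrite -big_split; apply: eq_bigr => p _; rewrite ffunE. Qed.

Lemma mcompB m m' s t : mcomp (m - m') s t = mcomp m s t - mcomp m' s t.
Proof. by rewrite /mcomp -sumrB; apply: eq_bigr => p _; rewrite !ffunE. Qed.

Lemma mcomp0 s t : mcomp (0 : mi) s t = 0.
Proof. by rewrite /mcomp big1 // => p _; rewrite ffunE. Qed.

Lemma mcomp_inj m m' :
  (forall s t, is_root_index s t -> mcomp m s t = mcomp m' s t) -> m = m'.
Proof.
move=> H; apply/ffunP => p; rewrite -!mcomp_val; apply: H.
by rewrite /is_root_index (valP p) /= -ltnS ltn_ord.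
Qed.

Lemma mcomp_eps s t s' t' : is_root_index s' t' ->
  mcomp (eps n l s t) s' t' = ((s == s') && (t == t'))%:R.
Proof.
case/root_indexP => p [<- <- _]; rewrite mcomp_val ffunE /is_posroot.
by rewrite eq_sym [X in _ && X]eq_sym.
Qed.

Definition row_tail (i k : nat) : mi := \sum_(k <= j < n.+1) eps n l i j.

Lemma shiftEE m i k : shiftE m i k = m + row_tail i k.
Proof. by []. Qed.

Lemma mcomp_row_tail i k s t : is_root_index s t ->
  mcomp (row_tail i k) s t = ((i == s) && (k <= t)%N)%:R.
Proof.
move=> st; rewrite /row_tail.
transitivity (\sum_(k <= j < n.+1) mcomp (eps n l i j) s t).
  elim/big_ind2: _ => [|x y z w <- <-|//]; first by rewrite mcomp0.
  by rewrite mcompD.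
under eq_bigr do rewrite mcomp_eps //.
case: eqP => [_|_] /=; last by rewrite big1.
have le_tn : (t < n.+1)%N by case/andP: st.
have [le_kt|lt_tk] := leqP k t; last first.
  rewrite big_nat big1 // => j /andP[le_kj _].
  by rewrite gtn_eqF // (leq_trans lt_tk).
rewrite (bigD1_seq t) ?iota_uniq ?mem_index_iota ?le_kt //= eqxx big1 ?addr0 //.
by move=> j /negPf->.
Qed.

Definition argE m (i k : nat) : 'Z_l :=
  mcomp m i k + mcomp m i (k - 1) - mcomp m (i - 1) (k - 1) - mcomp m (i + 1) k.

(* On the indices [m] with m_{i+1,k+1} = m_{ik} for all k, the target of a
   term of E_i u_m determines the term, so that no cancellation can occur. *)
Lemma support_eq0 (S : mi -> Prop) :
    (forall i m k, (0 < i)%N -> (i <= k <= n)%N -> S m ->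
      (forall m' k', (i <= k' <= n)%N -> S m' ->
         shiftE m' i k' = shiftE m i k -> k' = k) -> argE m i k = 0) ->
  forall m, S m -> m = 0.
Proof.
(* Descending induction on i: if [C i.+1] holds on S, the targets are separated, the hypothesis
   makes [argE] vanish, and with [C i.+1] this is [C i]. All the conditions together move an entry
   down its diagonal to row 0, where it is 0 by convention. *)
move=> HS; pose C i m := forall k, (i <= k <= n)%N ->
  mcomp m i k = mcomp m (i - 1) (k - 1).
have step i : (0 < i <= n)%N -> (forall m, S m -> C i.+1 m) ->
    forall m, S m -> C i m.
  move=> /andP[i_gt0 le_in] Ci m Sm k Hk.
  have sep m1 m2 k1 k2 : S m1 -> S m2 -> (i <= k1)%N -> (k1 < k2 <= n)%N ->
      shiftE m1 i k1 = shiftE m2 i k2 -> False.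
    move=> S1 S2 le_ik1 /andP[lt_k le_k2n] E.
    have idx1 : is_root_index i k1 by rewrite /is_root_index; lia.
    have idx2 : is_root_index i.+1 k1.+1 by rewrite /is_root_index; lia.
    have H1 : (i.+1 <= k1.+1 <= n)%N by lia.
    (* By [C i.+1] this difference is 0 at m1 and m2; the tail starting at k1 raises it to 1, the
       one starting at k2 > k1 leaves it at 0. *)
    have := congr1 (fun m => mcomp m i k1 - mcomp m i.+1 k1.+1) E.
    rewrite !shiftEE !mcompD !mcomp_row_tail // !eqxx leqnn.
    rewrite (ltn_eqF (ltnSn i)) /= !addr0.
    have -> : (k2 <= k1)%N = false by lia.
    rewrite (Ci _ S1 _ H1) (Ci _ S2 _ H1) !subn1 /= addrAC !subrr add0r addr0.
    by rewrite subrr => /eqP; rewrite oner_eq0.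
  have Hz : argE m i k = 0.
    apply: HS => // m' k' Hk' Sm' E.
    have [lt_k|lt_k|//] := ltngtP k' k.
      by case: (sep m' m k' k) => //; lia.
    by case: (sep m m' k k') => //; lia.
  have E : mcomp m (i + 1) k = mcomp m i (k - 1).
    have [->|neq_k] := eqVneq k i.
      by rewrite !mcomp_out //; rewrite /is_root_index; lia.
    rewrite addn1 (Ci m Sm) ?subn1 //; lia.
  by move: Hz; rewrite /argE E addrAC addrK => /eqP; rewrite subr_eq0 => /eqP.
have all_C i : (0 < i)%N -> forall m, S m -> C i m.
  move=> i_gt0; have [le_in|lt_ni] := leqP i n; last by move=> m Sm k; lia.
  move Dd: (n - i)%N => d; elim: d i i_gt0 le_in Dd => [|d IHd] i i_gt0 le_in Dd.
    by apply: step; [lia|move=> m Sm k; lia].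
  by apply: step; [lia|apply: IHd; lia].
move=> m Sm; apply: mcomp_inj => s t.
elim: s t => [|s IHs] t st; first by rewrite /is_root_index in st; lia.
have -> : mcomp m s.+1 t = mcomp m s (t - 1).
  by rewrite (all_C s.+1 _ _ Sm) ?subn1 //.
rewrite mcomp0; have [st'|Nst] := boolP (is_root_index s (t - 1)).
  by rewrite IHs // mcomp0.
by rewrite mcomp_out.
Qed.

(** The entry s(t+1-s) is the coefficient of alpha_s in 2 rho for type A_t. It solves [argE] = 1 at
    all (i, k), so that m -> top - m exchanges the invariants of the E_i with their coinvariants. *)
Definition top_index : mi :=
  [ffun p : posroot n => ((val p).1 * ((val p).2 - (val p).1).+1)%:R].

Lemma mcomp_top s t : mcomp top_index s t
  = if is_root_index s t then (s * (t - s).+1)%:R else 0.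
Proof.
case: ifPn => [|st]; last by rewrite mcomp_out.
by case/root_indexP => p [<- <- _]; rewrite mcomp_val ffunE.
Qed.

Lemma argE_top i k : (0 < i)%N -> (i <= k <= n)%N -> argE top_index i k = 1.
Proof.
move=> i_gt0 Hk; rewrite /argE !mcomp_top.
have nat_arg a b c d : (a + b = c + d + 1)%N -> a%:R + b%:R - c%:R - d%:R = 1 :> 'Z_l.
  move=> E; rewrite -natrD E !natrD; ring.
have tonat (b : bool) x : (if b then x%:R else 0) = (if b then x else 0%N)%:R :> 'Z_l.
  by case: b.
rewrite !tonat; apply: nat_arg; rewrite /is_root_index.
case: i i_gt0 Hk => // i _ Hk; have [d Dd] : exists d, k = (i.+1 + d)%N.
  by exists (k - i.+1)%N; lia.
rewrite {}Dd in Hk *; case: i Hk => [|i] Hk; case: d Hk => [|d] Hk.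
all: rewrite ?subn1 ?addn1 /=.
all: repeat (case: ifP => //; try lia); nia.
Qed.

End Multiindices.

(** * Invariants and coinvariants of the E_i in V(lambda) *)

Section ModuleVStructure.
Variables (n l : nat) (K : fieldType) (zeta : K) (lambda : 'I_n -> int).
Hypothesis zqint_eq0 : forall r : 'Z_l, zqint zeta r = 0 -> r = 0.

Local Notation R := (small_u n zeta).
Local Notation sc := (small_scalar n zeta).
Local Notation mi := (multiindex n l).

Variables (V : lmodType R) (u : mi -> V).
Hypothesis u_basis : forall x : V,
  exists! c : {ffun mi -> K}, x = \sum_m sc (c m) *: u m.
Hypothesis u_E : forall (i : 'I_n) m, small_E zeta i *: u m =
  \sum_(i.+1 <= k < n.+1) sc (Defs.coefE zeta m i.+1 k) *: u (shiftE m i.+1 k).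

Definition V_coord (x : V) : {ffun mi -> K} := sval (cid (u_basis x)).

Lemma V_coordK x : x = \sum_m sc (V_coord x m) *: u m.
Proof. by rewrite /V_coord; case: cid => c []. Qed.

Lemma V_coord_uniq (x : V) (c : {ffun mi -> K}) :
  x = \sum_m sc (c m) *: u m -> V_coord x = c.
Proof. by rewrite /V_coord; case: cid => c' [_ uniq_c'] /= /uniq_c'. Qed.

Lemma V_coordD x y m : V_coord (x + y) m = V_coord x m + V_coord y m.
Proof.
rewrite (@V_coord_uniq (x + y) [ffun m => V_coord x m + V_coord y m]) ?ffunE //.
rewrite {1}(V_coordK x) {1}(V_coordK y) -big_split; apply: eq_bigr => k _ /=.
by rewrite ffunE rmorphD scalerDl.
Qed.

Lemma V_coordZ c x m : V_coord (sc c *: x) m = c * V_coord x m.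
Proof.
rewrite (@V_coord_uniq _ [ffun m => c * V_coord x m]) ?ffunE //.
rewrite {1}(V_coordK x) scaler_sumr; apply: eq_bigr => k _ /=.
by rewrite ffunE rmorphM scalerA.
Qed.

Lemma V_coord0 m : V_coord 0 m = 0.
Proof. by apply: (addrI (V_coord 0 m)); rewrite -V_coordD !addr0. Qed.

Lemma V_coord_sum I (r : seq I) (P : pred I) (f : I -> V) m :
  V_coord (\sum_(i <- r | P i) f i) m = \sum_(i <- r | P i) V_coord (f i) m.
Proof. exact: (big_morph (fun x => V_coord x m) (fun x y => V_coordD x y m) (V_coord0 m)). Qed.

Lemma V_coord_u m m' : V_coord (u m) m' = (m' == m)%:R.
Proof.
rewrite (@V_coord_uniq _ [ffun m' => (m' == m)%:R]) ?ffunE //.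
rewrite (bigD1 m) //= ffunE eqxx rmorph1 scale1r big1 ?addr0 // => k /negPf nk.
by rewrite ffunE nk rmorph0 scale0r.
Qed.

Lemma V_coord_inj x y : (forall m, V_coord x m = V_coord y m) -> x = y.
Proof.
move=> H; rewrite (V_coordK x) (V_coordK y).
by apply: eq_bigr => m _; rewrite H.
Qed.

Lemma V_coordE (i : 'I_n) x m : V_coord (small_E zeta i *: x) m =
  \sum_m' \sum_(i.+1 <= k < n.+1)
    V_coord x m' * Defs.coefE zeta m' i.+1 k * (shiftE m' i.+1 k == m)%:R.
Proof.
rewrite {1}(V_coordK x) scaler_sumr V_coord_sum; apply: eq_bigr => m' _.
rewrite scalerA -small_scalarC -scalerA V_coordZ u_E V_coord_sum mulr_sumr.
by apply: eq_bigr => k _; rewrite V_coordZ V_coord_u eq_sym mulrA.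
Qed.

Lemma zqint0 : zqint zeta (0 : 'Z_l) = 0.
Proof. exact: qint0. Qed.

Lemma coefE_arg (m : mi) i k : Defs.coefE zeta m i k = zqint zeta (argE m i k).
Proof. by []. Qed.

Lemma shiftE_inj (m m' : mi) i k : shiftE m i k = shiftE m' i k -> m = m'.
Proof. by rewrite !shiftEE => /addIr. Qed.

(** [support_eq0] applied to the support of x: at a target hit by a single term, the coordinate of
    E_i x is a nonzero coordinate of x times [argE], and [r] = 0 forces r = 0 in Z/l. *)
Lemma V_E_invariant x : (forall i, small_E zeta i *: x = 0) ->
  x = sc (V_coord x 0) *: u 0.
Proof.
move=> Ex0; apply: V_coord_inj => m; rewrite V_coordZ V_coord_u.
have [->|m_neq0] := eqVneq m 0; first by rewrite mulr1.
rewrite mulr0; apply/eqP/negPn/negP => xm_neq0; case/negP: m_neq0; apply/eqP.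
apply: (@support_eq0 n l (fun m => V_coord x m != 0)) xm_neq0 => {m} i m k.
move=> i_gt0 Hk xm sep; have lt_in : (i.-1 < n)%N by lia.
have := congr1 (fun y => V_coord y (shiftE m i k)) (Ex0 (Ordinal lt_in)).
rewrite V_coordE V_coord0 /= prednK // (bigD1 m) //= (bigD1_seq k) ?iota_uniq //=;
  last by rewrite mem_index_iota ltnS.
rewrite eqxx mulr1 big1_seq ?addr0; last first.
  move=> k' /andP[nk']; rewrite mem_index_iota => Hk'; case: eqP => E; last by rewrite mulr0.
  by case/eqP: nk'; apply: (sep m).
rewrite big1 ?addr0; last first.
  move=> m' nm'; rewrite big1_seq // => k' /andP[_]; rewrite mem_index_iota => Hk'.
  case: eqP => [E|_]; last by rewrite mulr0.
  have [->|xm'] := eqVneq (V_coord x m') 0; first by rewrite !mul0r.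
  have Dk : k' = k by apply: sep E.
  by rewrite Dk in E; rewrite (shiftE_inj E) eqxx in nm'.
move=> /eqP; rewrite mulf_eq0 (negPf xm) /= => /eqP.
by rewrite coefE_arg => /zqint_eq0.
Qed.

Local Notation top := (top_index n l).

Lemma argEB (m m' : mi) i k : argE (m - m') i k = argE m i k - argE m' i k.
Proof. by rewrite /argE !mcompB; ring. Qed.

Lemma argE_tail i k : (0 < i)%N -> (i <= k <= n)%N ->
  argE (row_tail n l i k) i k = 1.
Proof.
move=> i_gt0 Hk; rewrite /argE.
have H s t : mcomp (row_tail n l i k) s t
    = (is_root_index n s t && ((i == s) && (k <= t)%N))%:R.
  have [st|Nst] := boolP (is_root_index n s t); last by rewrite mcomp_out.
  by rewrite mcomp_row_tail.
rewrite !H /is_root_index.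
have -> : (k <= k - 1)%N = false by lia.
have -> : (i == i + 1)%N = false by lia.
rewrite !andbF !subr0 addr0 eqxx leqnn !andbT.
by have -> : (0 < i <= k)%N && (k <= n)%N by lia.
Qed.

(** A term that reaches the top index starts at top minus a row tail, where [argE] is 1 - 1 = 0. *)
Lemma V_coord_top (i : 'I_n) x : V_coord (small_E zeta i *: x) top = 0.
Proof.
rewrite V_coordE big1 // => m _; rewrite big1_seq // => k /andP[_].
rewrite mem_index_iota ltnS => Hk; case: eqP => [E|_]; last by rewrite mulr0.
have -> : m = top - row_tail n l i.+1 k by rewrite -E shiftEE addrK.
by rewrite coefE_arg argEB argE_top // argE_tail // subrr zqint0 mulr0 mul0r.
Qed.

(** [support_eq0] again, now for the set of m with u_{top - m} outside Q. *)
Lemma V_E_coinvariant (Q : V -> Prop) : Q 0 ->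
    (forall x y, Q x -> Q y -> Q (x + y)) ->
    (forall c x, Q x -> Q (sc c *: x)) ->
    (forall i x, Q (small_E zeta i *: x)) ->
  forall m, m != top -> Q (u m).
Proof.
move=> Q0 QD QZ QE m nm; apply: contrapT => NQm; case/eqP: nm.
suff : top - m = 0 by move/eqP; rewrite subr_eq0 => /eqP->.
apply: (@support_eq0 n l (fun m => ~ Q (u (top - m)))); last first.
  by rewrite opprB addrC subrK.
move=> {m NQm} i m k i_gt0 Hk NQm sep; have lt_in : (i.-1 < n)%N by lia.
(* The source whose k-th target is top - m. The other targets of E_i u_t lie in Q by separation, so
   modulo Q one term remains, with argument - [argE m i k]. *)
pose t := top - m - row_tail n l i k.
have Et k' : shiftE t i k' = top - (m + row_tail n l i k - row_tail n l i k').
  by rewrite shiftEE /t !opprD opprK !addrA.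
have := QE (Ordinal lt_in) (u t); rewrite u_E /= prednK //.
rewrite (bigD1_seq k) ?iota_uniq //=; last by rewrite mem_index_iota ltnS.
set y := \sum_(_ <- _ | _) _; have Qy : Q y.
  rewrite /y big_seq_cond; apply: big_rec => // k' x /andP[+ nk'] Qx.
  rewrite mem_index_iota ltnS => Hk'; apply: (QD) => //; apply: QZ.
  rewrite Et; apply: contrapT => NQk'; case/eqP: nk'.
  by apply: sep NQk' _ => //; rewrite !shiftEE subrK.
move=> H; have {H} : Q (sc (Defs.coefE zeta t i k) *: u (shiftE t i k)).
  rewrite -[_ *: _](addrK y); apply: (QD) => //.
  by have := QZ (-1) y Qy; rewrite rmorphN1 scaleN1r.
rewrite Et addrK => H; have c0 : Defs.coefE zeta t i k = 0.
  apply: contra_not_eq NQm => c_neq0; have := QZ (Defs.coefE zeta t i k)^-1 _ H.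
  by rewrite scalerA -rmorphM mulVf // rmorph1 scale1r.
move: c0; rewrite coefE_arg => /zqint_eq0; rewrite /t !argEB argE_top // argE_tail //.
by rewrite addrAC subrr add0r => /eqP; rewrite oppr_eq0 => /eqP.
Qed.

End ModuleVStructure.

(** * q-boson representations of the quantum group *)

(* Linear endomorphisms acting on the right: the product is composition in
   the diagrammatic order. *)
Section RightEndomorphisms.
Variables (F : fieldType) (M : lmodType F).

Record rendo : Type := Rendo { rendo_fun :> M -> M; rendo_linear : linear rendo_fun }.

HB.instance Definition _ := gen_eqMixin rendo.
HB.instance Definition _ := gen_choiceMixin rendo.

Lemma rendo_eq (f g : rendo) : (forall x, f x = g x) -> f = g.
Proof.
case: f g => f Hf [g Hg] /= /funext fg; case: g / fg Hg => Hg.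
by rewrite (Prop_irrelevance Hf Hg).
Qed.

Lemma rendoD (f : rendo) x y : f (x + y) = f x + f y.
Proof. by rewrite -[x]scale1r rendo_linear !scale1r. Qed.

Lemma rendo0 (f : rendo) : f 0 = 0.
Proof. by apply: (addrI (f 0)); rewrite -rendoD !addr0. Qed.

Lemma rendoZ (f : rendo) c x : f (c *: x) = c *: f x.
Proof. by rewrite -[c *: x]addr0 rendo_linear rendo0 !addr0. Qed.

Fact rendo_zero_linear : linear (fun _ : M => 0 : M).
Proof. by move=> c x y; rewrite scaler0 addr0. Qed.
Definition rendo_zero := Rendo rendo_zero_linear.

Fact rendo_opp_linear (f : rendo) : linear (fun x => - f x).
Proof. by move=> c x y; rewrite rendo_linear opprD scalerN. Qed.
Definition rendo_opp f := Rendo (rendo_opp_linear f).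

Fact rendo_add_linear (f g : rendo) : linear (fun x => f x + g x).
Proof. by move=> c x y; rewrite !rendo_linear scalerDr addrACA. Qed.
Definition rendo_add f g := Rendo (rendo_add_linear f g).

Fact rendo_one_linear : linear (fun x : M => x).
Proof. by []. Qed.
Definition rendo_one := Rendo rendo_one_linear.

Fact rendo_mul_linear (f g : rendo) : linear (fun x => g (f x)).
Proof. by move=> c x y; rewrite !rendo_linear. Qed.
Definition rendo_mul f g := Rendo (rendo_mul_linear f g).

Fact rendo_addA : associative rendo_add.
Proof. by move=> f g h; apply: rendo_eq => x /=; rewrite addrA. Qed.
Fact rendo_addC : commutative rendo_add.
Proof. by move=> f g; apply: rendo_eq => x /=; rewrite addrC. Qed.
Fact rendo_add0 : left_id rendo_zero rendo_add.
Proof. by move=> f; apply: rendo_eq => x /=; rewrite add0r. Qed.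
Fact rendo_addN : left_inverse rendo_zero rendo_opp rendo_add.
Proof. by move=> f; apply: rendo_eq => x /=; rewrite addNr. Qed.

HB.instance Definition _ := GRing.isZmodule.Build rendo
  rendo_addA rendo_addC rendo_add0 rendo_addN.

Fact rendo_mulA : associative rendo_mul.
Proof. by move=> f g h; apply: rendo_eq. Qed.
Fact rendo_mul1 : left_id rendo_one rendo_mul.
Proof. by move=> f; apply: rendo_eq. Qed.
Fact rendo_mulr1 : right_id rendo_one rendo_mul.
Proof. by move=> f; apply: rendo_eq. Qed.
Fact rendo_mulDl : left_distributive rendo_mul rendo_add.
Proof. by move=> f g h; apply: rendo_eq => x /=; rewrite rendoD. Qed.
Fact rendo_mulDr : right_distributive rendo_mul rendo_add.
Proof. by move=> f g h; apply: rendo_eq. Qed.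

HB.instance Definition _ := GRing.Zmodule_isPzRing.Build rendo
  rendo_mulA rendo_mul1 rendo_mulr1 rendo_mulDl rendo_mulDr.

Lemma rendoDE (f g : rendo) x : (f + g) x = f x + g x. Proof. by []. Qed.
Lemma rendoME (f g : rendo) x : (f * g) x = g (f x). Proof. by []. Qed.
Lemma rendo1E x : (1 : rendo) x = x. Proof. by []. Qed.

Fact rendo_scalar_linear c : linear (fun x : M => c *: x).
Proof. by move=> d x y; rewrite scalerDr !scalerA mulrC. Qed.
Definition rendo_scalar c : rendo := Rendo (rendo_scalar_linear c).

Fact rendo_scalar_is_additive : additive rendo_scalar.
Proof. by move=> c d; apply: rendo_eq => x /=; rewrite scalerBl. Qed.
Fact rendo_scalar_is_monoid_morphism : monoid_morphism rendo_scalar.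
Proof.
split=> [|c d]; apply: rendo_eq => x /=; first by rewrite scale1r.
by rewrite scalerA mulrC.
Qed.

HB.instance Definition _ := GRing.isZmodMorphism.Build F rendo rendo_scalar
  rendo_scalar_is_additive.
HB.instance Definition _ := GRing.isMonoidMorphism.Build F rendo rendo_scalar
  rendo_scalar_is_monoid_morphism.

Lemma rendo_scalarC c (f : rendo) : rendo_scalar c * f = f * rendo_scalar c.
Proof. by apply: rendo_eq => x /=; rewrite rendoZ. Qed.

End RightEndomorphisms.

(** * Sums of q-commuting elements and the coproduct *)

Section Coproduct.
Variables (F : fieldType) (R : pzRingType) (sc : {rmorphism F -> R}).
Hypothesis scC : forall c x, sc c * x = x * sc c.
Variable q : F.
Hypothesis q_neq0 : q != 0.
Hypothesis qint_neq0 : forall r, (0 < r)%N -> qint q r != 0.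

Local Notation ser := (serre2 sc q).

(** Meant for the two summands of the coproduct of E_i or F_i: the q-commutations cancel all mixed
    terms of the expansion. *)
Lemma serre2_sum x1 x2 y1 y2 : ser x1 y1 = 0 -> ser x2 y2 = 0 ->
  x2 * x1 = sc (q ^+ 2) * x1 * x2 -> x2 * y1 = sc q^-1 * y1 * x2 ->
  y2 * x1 = sc q^-1 * x1 * y2 -> ser (x1 + x2) (y1 + y2) = 0.
Proof.
move=> S1 S2 HA HB HC.
pose A := x2 * x1 - sc (q ^+ 2) * x1 * x2.
pose B := x2 * y1 - sc q^-1 * y1 * x2.
pose C := y2 * x1 - sc q^-1 * x1 * y2.
pose b := q + q^-1.
transitivity (ser x1 y1 + ser x2 y2
  + (- sc b * x1 * C + C * x1 + sc q^-1 * x1 * C)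
  + (x2 * B + sc q^-1 * B * x2 - sc b * B * x2)
  + (x1 * B + A * y1 + sc (q ^+ 2) * x1 * B - sc b * B * x1
     + sc (1 - b * q^-1) * y1 * A)
  + (A * y2 + C * x2 - sc b * x2 * C - sc (b * q^-1) * A * y2 + y2 * A
     + sc (q ^+ 2) * C * x2)); last first.
  have [-> -> ->] : [/\ A = 0, B = 0 & C = 0] by rewrite /A HA /B HB /C HC !subrr.
  by rewrite S1 S2 !mulr0 !mul0r !(addr0, subr0, mulr0).
by rewrite /serre2 /A /B /C /b; nc_coef F sc scC; field.
Qed.

(** The q-binomial theorem in divided powers; it passes integrality from the factors of a tensor
    product to the whole. *)
Lemma div_pow_sum x1 x2 r : x2 * x1 = sc (q ^+ 2) * x1 * x2 ->
  div_pow sc q (x1 + x2) r = \sum_(0 <= t < r.+1)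
    sc (q ^+ (t * (r - t))) * (div_pow sc q x1 (r - t) * div_pow sc q x2 t).
Proof.
move=> x21; elim: r => [|r IHr].
  by rewrite big_nat1 !div_pow0 muln0 expr0 rmorph1 !mulr1.
have qr_neq0 := qint_neq0 (ltn0Sn r).
suff H : sc (qint q r.+1) * div_pow sc q (x1 + x2) r.+1
   = sc (qint q r.+1) * \sum_(0 <= t < r.+2)
    sc (q ^+ (t * (r.+1 - t))) * (div_pow sc q x1 (r.+1 - t) * div_pow sc q x2 t).
  have := congr1 ( *%R (sc (qint q r.+1)^-1)) H.
  by rewrite !mulrA -!rmorphM mulVf // rmorph1 !mul1r.
rewrite -div_powSr // IHr.
pose T t := div_pow sc q x1 (r.+1 - t) * div_pow sc q x2 t.
have step t : (t <= r)%N -> sc (q ^+ (t * (r - t)))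
      * (div_pow sc q x1 (r - t) * div_pow sc q x2 t) * (x1 + x2)
   = sc (q ^+ (t * (r - t)) * (q ^+ 2) ^+ t * qint q (r.+1 - t)) * T t
     + sc (q ^+ (t * (r - t)) * qint q t.+1) * T t.+1.
  move=> le_tr; rewrite /T subSS (subSn le_tr).
  have H1 := div_powSr sc qint_neq0 x1 (r - t).
  have H2 := div_powSr sc qint_neq0 x2 t.
  have H3 := div_pow_comm scC q t x21.
  move: (div_pow sc q x1 (r - t).+1) (div_pow sc q x1 (r - t)) H1 => X' X H1.
  move: (div_pow sc q x2 t.+1) (div_pow sc q x2 t) H2 H3 => Y' Y H2 H3.
  move: (qint q (r - t).+1) (qint q t.+1) ((q ^+ 2) ^+ t) H1 H2 H3 => c1 c2 c3.
  move: (q ^+ _) => c0 H1 H2 H3.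
  apply/eqP; rewrite -subr_eq0; apply/eqP.
  transitivity (sc c0 * X * (Y * x1 - sc c3 * x1 * Y)
    + sc (c0 * c3) * (X * x1 - sc c1 * X') * Y + sc c0 * X * (Y * x2 - sc c2 * Y')).
    by nc_coef F sc scC; field.
  by rewrite H1 H2 H3 !subrr !mulr0 !mul0r !addr0.
rewrite mulr_suml; under eq_big_nat => t /andP[_ lt_t] do rewrite step //.
rewrite big_split /=.
have -> : \sum_(0 <= i < r.+1)
    sc (q ^+ (i * (r - i)) * qint q i.+1) * T i.+1
  = \sum_(0 <= i < r.+2) sc (q ^+ (i.-1 * (r.+1 - i)) * qint q i) * T i.
  by rewrite [RHS]big_nat_recl // qint0 mulr0 rmorph0 mul0r add0r.
have -> : \sum_(0 <= i < r.+1)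
    sc (q ^+ (i * (r - i)) * (q ^+ 2) ^+ i * qint q (r.+1 - i)) * T i
  = \sum_(0 <= i < r.+2)
    sc (q ^+ (i * (r - i)) * (q ^+ 2) ^+ i * qint q (r.+1 - i)) * T i.
  by rewrite [RHS]big_nat_recr //= subnn qint0 mulr0 rmorph0 mul0r addr0.
rewrite -big_split mulr_sumr; apply: eq_big_nat => t /andP[_ lt_t] /=.
rewrite mulrA -rmorphM -mulrDl -rmorphD; congr (sc _ * _).
have -> : qint q r.+1 = q ^+ t * qint q (r.+1 - t) + q ^- (r.+1 - t) * qint q t.
  by rewrite -qintD // subnKC.
case: t lt_t => [|t] lt_t.
  by rewrite qint0 !mulr0 !addr0 !mul0n ?expr0 ?mul1r ?mulr1.
have [d Dd] : exists d, r = (t + d)%N by exists (r - t)%N; lia.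
rewrite {}Dd subSS addKn -exprM /=.
case: d => [|d].
  by rewrite addn0 subnS subnn !muln0 qint0 !mulr0 !add0r !expr0 invr1 !mul1r mulr1.
have -> : (t + d.+1 - t.+1 = d)%N by lia.
move: (qint _ _) (qint _ _) => c1 c2.
have -> : q ^+ (t * d.+1) = q ^+ (t.+1 * d.+1) / q ^+ d.+1.
  by rewrite mulSn addnC exprD mulfK // expf_neq0.
have -> : (t.+1 * d.+1 = t.+1 * d + t.+1)%N by lia.
rewrite exprD mulnC mul2n -addnn exprD.
by field; rewrite !expf_neq0.
Qed.

End Coproduct.

Lemma cartanA_sym n (i j : 'I_n) : cartanA i j = cartanA j i.
Proof. by rewrite /cartanA eq_sym orbC. Qed.

Lemma cartanA_ii n (i : 'I_n) : cartanA i i = 2.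
Proof. by rewrite /cartanA eqxx. Qed.

Lemma adjacent_sym n (i j : 'I_n) : adjacent i j = adjacent j i.
Proof. by rewrite /adjacent orbC. Qed.

Section UqRepTheory.
Variables (n : nat) (F : fieldType) (R : pzRingType) (sc : {rmorphism F -> R}).
Hypothesis scC : forall c x, sc c * x = x * sc c.
Variable q : F.
Hypothesis q_neq0 : q != 0.

Lemma uq_rep_trivial : uq_rep (n := n) sc q (fun=> 0) (fun=> 0) (fun=> 1) (fun=> 1).
Proof.
by split=> *; rewrite ?mulr0 ?mul0r ?mulr1 ?mul1r ?subrr ?mulr0 ?addr0.
Qed.

Variables (E F' K K' : 'I_n -> R).
Hypothesis rep : uq_rep sc q E F' K K'.

Lemma uq_conjV i c x : c != 0 ->
  K i * x = sc c * x * K i -> K' i * x = sc c^-1 * x * K' i.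
Proof.
move=> c_neq0 H; have V1 := uq_KVl rep i; have V2 := uq_KVr rep i.
apply/eqP; rewrite -subr_eq0; apply/eqP.
transitivity (- sc c^-1 * K' i * (K i * x - sc c * x * K i) * K' i
   + K' i * x * (1 - K i * K' i) - sc c^-1 * (1 - K' i * K i) * x * K' i).
  by nc_coef F sc scC; field.
by rewrite H V1 V2 !subrr !(mulr0, mul0r) subr0 addr0.
Qed.

Lemma uq_K'E i j : K' i * E j = sc (q ^ cartanA i j)^-1 * E j * K' i.
Proof. by apply: uq_conjV; rewrite ?expfz_neq0 // (uq_KEq rep). Qed.

Lemma uq_K'F i j : K' i * F' j = sc (q ^ cartanA i j) * F' j * K' i.
Proof.
rewrite -[q ^ _]invrK invr_expz; apply: uq_conjV; rewrite ?expfz_neq0 //.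
exact: (uq_KFq rep).
Qed.

Lemma uq_K'K i j : K' i * K j = K j * K' i.
Proof.
have := @uq_conjV i 1 (K j) (oner_neq0 _).
by rewrite invr1 rmorph1 !mul1r; apply; apply: (uq_KC rep).
Qed.

Lemma uq_K'K' i j : K' i * K' j = K' j * K' i.
Proof.
have := @uq_conjV i 1 (K' j) (oner_neq0 _).
by rewrite invr1 rmorph1 !mul1r; apply; rewrite uq_K'K.
Qed.

End UqRepTheory.

Section CoproductRep.
Variables (n : nat) (F : fieldType) (R : pzRingType) (sc : {rmorphism F -> R}).
Hypothesis scC : forall c x, sc c * x = x * sc c.
Variable q : F.
Hypothesis q_neq0 : q != 0.
Variables (e f k k' E F' K K' : 'I_n -> R).
Hypothesis rep1 : uq_rep sc q e f k k'.
Hypothesis rep2 : uq_rep sc q E F' K K'.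

Definition uq_in (e f k k' : 'I_n -> R) (x : R) :=
  exists i, [\/ x = e i, x = f i, x = k i | x = k' i].

Hypothesis cross : forall x y, uq_in e f k k' x -> uq_in E F' K K' y ->
  x * y = y * x.

Let cE x i : uq_in e f k k' x -> x * E i - E i * x = 0.
Proof. by move=> Hx; rewrite cross ?subrr //; exists i; constructor 1. Qed.
Let cF x i : uq_in e f k k' x -> x * F' i - F' i * x = 0.
Proof. by move=> Hx; rewrite cross ?subrr //; exists i; constructor 2. Qed.
Let cK x i : uq_in e f k k' x -> x * K i - K i * x = 0.
Proof. by move=> Hx; rewrite cross ?subrr //; exists i; constructor 3. Qed.
Let cK' x i : uq_in e f k k' x -> x * K' i - K' i * x = 0.
Proof. by move=> Hx; rewrite cross ?subrr //; exists i; constructor 4. Qed.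
Let ie i : uq_in e f k k' (e i). Proof. by exists i; constructor 1. Qed.
Let if_ i : uq_in e f k k' (f i). Proof. by exists i; constructor 2. Qed.
Let ik i : uq_in e f k k' (k i). Proof. by exists i; constructor 3. Qed.
Let ik' i : uq_in e f k k' (k' i). Proof. by exists i; constructor 4. Qed.

Let mulACA (a x b y : R) : x * b = b * x -> (a * x) * (b * y) = (a * b) * (x * y).
Proof. by move=> xb; rewrite !mulrA -(mulrA a) xb mulrA. Qed.

Let eq0 (x y : R) : x - y = 0 -> x = y.
Proof. by move/eqP; rewrite subr_eq0 => /eqP. Qed.

Let subE (x y : R) : x = y -> x - y = 0.
Proof. by move->; rewrite subrr. Qed.

(** The coproduct E -> E x 1 + K x E, F -> 1 x F + F x K^-1. Two commuting actions in one ring stand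
    for the tensor factors, so no tensor product of modules has to be formed. *)
Lemma uq_rep_coproduct : uq_rep sc q (fun i => e i + k i * E i)
  (fun i => F' i + f i * K' i) (fun i => k i * K i) (fun i => k' i * K' i).
Proof.
have cEe i j := cE j (ie i); have cEf i j := cE j (if_ i).
have cEk i j := cE j (ik i); have cEk' i j := cE j (ik' i).
have cFe i j := cF j (ie i); have cFf i j := cF j (if_ i).
have cFk i j := cF j (ik i); have cFk' i j := cF j (ik' i).
have cKe i j := cK j (ie i); have cKf i j := cK j (if_ i).
have cKk i j := cK j (ik i); have cKk' i j := cK j (ik' i).
have cK'e i j := cK' j (ie i); have cK'f i j := cK' j (if_ i).
have cK'k i j := cK' j (ik i); have cK'k' i j := cK' j (ik' i).
have kf i j : k i * f j - sc (q ^ cartanA i j)^-1 * f j * k i = 0.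
  by apply: subE; rewrite invr_expz; apply: (uq_KFq rep1).
have K'E i j : K' i * E j - sc (q ^ cartanA i j)^-1 * E j * K' i = 0.
  by apply: subE; apply: (uq_K'E scC q_neq0 rep2).
have K'F i j := uq_K'F scC q_neq0 rep2 i j.
split.
- move=> i; rewrite mulACA ?(uq_KVr rep1) ?(uq_KVr rep2) ?mulr1 //.
  by apply/esym/eq0.
- move=> i; rewrite mulACA ?(uq_KVl rep1) ?(uq_KVl rep2) ?mulr1 //.
  by apply/esym/eq0.
- move=> i j; rewrite [LHS]mulACA; last exact/esym/eq0.
  rewrite [RHS]mulACA; last exact/esym/eq0.
  by rewrite (uq_KC rep1 i j) (uq_KC rep2 i j).
- move=> i j; have ke := subE (uq_KEq rep1 i j).
  have KE := subE (uq_KEq rep2 i j); have kk := subE (uq_KC rep1 i j).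
  move: (q ^ _) (expfz_neq0 (cartanA i j) q_neq0) ke KE => c c_neq0 ke KE.
  apply: eq0.
  transitivity (- k i * (e j * K i - K i * e j) + (k i * e j - sc c * e j * k i) * K i
    - k i * (k j * K i - K i * k j) * E j + (k i * k j - k j * k i) * K i * E j
    + k j * k i * (K i * E j - sc c * E j * K i)
    + sc c * k j * (k i * E j - E j * k i) * K i).
    by nc_coef F sc scC; field.
  by rewrite ke KE kk cKe cKk cEk !(mulr0, mul0r, addr0, subr0).
- move=> i j; have kk := subE (uq_KC rep1 i j); have KF := subE (uq_KFq rep2 i j).
  have KK' : K i * K' j - K' j * K i = 0.
    by apply: subE; rewrite (uq_K'K scC rep2).
  rewrite -invr_expz in KF *.
  move: (q ^ _) (expfz_neq0 (cartanA i j) q_neq0) KF (kf i j) => c c_neq0 KF kf'.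
  apply: eq0.
  transitivity (k i * (K i * F' j - sc c^-1 * F' j * K i)
    + sc c^-1 * (k i * F' j - F' j * k i) * K i
    - k i * (f j * K i - K i * f j) * K' j
    + (k i * f j - sc c^-1 * f j * k i) * K i * K' j
    + sc c^-1 * f j * k i * (K i * K' j - K' j * K i)
    + sc c^-1 * f j * (k i * K' j - K' j * k i) * K i).
    by nc_coef F sc scC; field.
  by rewrite kf' KF KK' cFk cKf cK'k !(mulr0, mul0r, addr0, subr0).
- move=> i j; have ef := subE (uq_EFq rep1 i j); have EF := subE (uq_EFq rep2 i j).
  have K'Eji := K'E j i; have kfij := kf i j; rewrite cartanA_sym in K'Eji.
  move: (q ^ _) (expfz_neq0 (cartanA i j) q_neq0) K'Eji kfij => c c_neq0 K'Eji kfij.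
  have [Dij|nij] := eqVneq i j; last first.
    rewrite (negPf nij) mul0r rmorph0 in ef EF *.
    rewrite mul0r subr0 in ef; rewrite mul0r subr0 in EF; rewrite mul0r.
    transitivity ((e i * F' j - F' j * e i) + (e i * f j - f j * e i) * K' j
      + f j * (e i * K' j - K' j * e i) + k i * (E i * F' j - F' j * E i)
      + (k i * F' j - F' j * k i) * E i - k i * (f j * E i - E i * f j) * K' j
      + (k i * f j - sc c^-1 * f j * k i) * E i * K' j
      - sc (c * c^-1) * f j * k i * (K' j * E i - sc c^-1 * E i * K' j)
      + f j * (k i * K' j - K' j * k i) * E i).
      by nc_coef F sc scC; field.
    by rewrite ef EF cFe cK'e cFk cEf K'Eji kfij cK'k !(mulr0, mul0r, addr0, subr0).
  subst j; rewrite eqxx mul1r in ef EF *.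
  apply: eq0; set d := (q - q^-1)^-1 in ef EF *.
  transitivity ((e i * F' i - F' i * e i)
    + (e i * f i - f i * e i - sc d * (k i - k' i)) * K' i
    + f i * (e i * K' i - K' i * e i)
    + k i * (E i * F' i - F' i * E i - sc d * (K i - K' i))
    + (k i * F' i - F' i * k i) * E i - k i * (f i * E i - E i * f i) * K' i
    + (k i * f i - sc c^-1 * f i * k i) * E i * K' i
    - sc (c * c^-1) * f i * k i * (K' i * E i - sc c^-1 * E i * K' i)
    + f i * (k i * K' i - K' i * k i) * E i).
    by clearbody d; nc_coef F sc scC; field.
  by rewrite ef EF cFe cK'e cFk cEf K'Eji kfij cK'k !(mulr0, mul0r, addr0, subr0).
- move=> i j nij aij; have ee := subE (uq_E_far rep1 nij aij).
  have EE := subE (uq_E_far rep2 nij aij); have kk := subE (uq_KC rep1 i j).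
  have ke : k i * e j - e j * k i = 0.
    apply: subE; rewrite (uq_KEq rep1) cartanA_adj // (negPf aij) expr0z.
    by rewrite rmorph1 mul1r.
  have ke' : k j * e i - e i * k j = 0.
    apply: subE; rewrite (uq_KEq rep1) cartanA_sym cartanA_adj // (negPf aij).
    by rewrite expr0z rmorph1 mul1r.
  apply: eq0.
  transitivity ((e i * e j - e j * e i) - (k j * e i - e i * k j) * E j
    + k j * (e i * E j - E j * e i) - k i * (e j * E i - E i * e j)
    + (k i * e j - e j * k i) * E i - k i * (k j * E i - E i * k j) * E j
    + (k i * k j - k j * k i) * E i * E j + k j * k i * (E i * E j - E j * E i)
    + k j * (k i * E j - E j * k i) * E i).
    by nc_coef F sc scC; field.
  by rewrite ee EE kk ke ke' !cEe !cEk !(mulr0, mul0r, addr0, subr0).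
- move=> i j nij aij; have ff := subE (uq_F_far rep1 nij aij).
  have FF := subE (uq_F_far rep2 nij aij).
  have K'K' := subE (uq_K'K' scC rep2 i j).
  have KF : K' i * F' j - F' j * K' i = 0.
    apply: subE; rewrite K'F cartanA_adj // (negPf aij) expr0z.
    by rewrite rmorph1 mul1r.
  have KF' : K' j * F' i - F' i * K' j = 0.
    apply: subE; rewrite K'F cartanA_sym cartanA_adj // (negPf aij).
    by rewrite expr0z rmorph1 mul1r.
  apply: eq0.
  transitivity ((F' i * F' j - F' j * F' i) - f j * (K' j * F' i - F' i * K' j)
    - (f j * F' i - F' i * f j) * K' j + f i * (K' i * F' j - F' j * K' i)
    + (f i * F' j - F' j * f i) * K' i - f i * (f j * K' i - K' i * f j) * K' j
    + (f i * f j - f j * f i) * K' i * K' j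
    + f j * f i * (K' i * K' j - K' j * K' i)
    + f j * (f i * K' j - K' j * f i) * K' i).
    by nc_coef F sc scC; field.
  by rewrite ff FF K'K' KF KF' !cFf !cK'f !(mulr0, mul0r, addr0, subr0).
- move=> i j aij; have nij := adjacent_neq aij.
  have nji : j != i by rewrite eq_sym.
  have aji : adjacent j i by rewrite adjacent_sym.
  have ES := uq_E_adj rep2 aij.
  (* For the summands k_i E_i the torus factors gather on the left, leaving k_i k_i k_j times the
     Serre relation of the second action. *)
  apply: (serre2_sum scC q_neq0 (uq_E_adj rep1 aij)).
  + have com a b : E a * k b = k b * E a by apply/esym/eq0.
    rewrite /serre2.
    have p3 a b c : k a * E a * (k b * E b) * (k c * E c)
        = k a * k b * k c * (E a * E b * E c).
      have comc : E a * E b * k c = k c * (E a * E b).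
        by rewrite -mulrA com mulrA com mulrA.
      by rewrite (mulACA _ _ (com a b)) (mulACA _ _ comc).
    have p3' a b c : sc (q + q^-1) * (k a * E a) * (k b * E b) * (k c * E c)
        = sc (q + q^-1) * (k a * k b * k c * (E a * E b * E c)).
      by rewrite -p3 !mulrA.
    have k2 : k i * k j * k i = k i * k i * k j by rewrite -mulrA (uq_KC rep1 j) mulrA.
    have k1 : k j * k i * k i = k i * k i * k j by rewrite (uq_KC rep1 j).
    rewrite !p3 p3' k1 k2.
    transitivity (k i * k i * k j * (E i * E i * E j
        - sc (q + q^-1) * E i * E j * E i + E j * E i * E i)).
      by move: (k i * k i * k j) => x; nc_coef F sc scC; field.
    by rewrite ES mulr0.
  + have := uq_KEq rep1 i i; rewrite cartanA_ii => ke.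
    by rewrite -mulrA -(eq0 (cEe i i)) mulrA ke !mulrA.
  + have := uq_KEq rep1 i j; rewrite cartanA_adj // aij => ke.
    by rewrite -mulrA -(eq0 (cEe j i)) mulrA ke !mulrA.
  have := uq_KEq rep1 j i; rewrite cartanA_adj // aji => ke.
  by rewrite -mulrA -(eq0 (cEe i j)) mulrA ke !mulrA.
- move=> i j aij; have nij := adjacent_neq aij.
  have nji : j != i by rewrite eq_sym.
  have aji : adjacent j i by rewrite adjacent_sym.
  have fS := uq_F_adj rep1 aij.
  apply: (serre2_sum scC q_neq0 (uq_F_adj rep2 aij)).
  + have com a b : K' a * f b = f b * K' a by apply/esym/eq0.
    rewrite /serre2.
    have p3 a b c : f a * K' a * (f b * K' b) * (f c * K' c)
        = f a * f b * f c * (K' a * K' b * K' c).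
      have comc : K' a * K' b * f c = f c * (K' a * K' b).
        by rewrite -mulrA com mulrA com mulrA.
      by rewrite (mulACA _ _ (com a b)) (mulACA _ _ comc).
    have p3' a b c : sc (q + q^-1) * (f a * K' a) * (f b * K' b) * (f c * K' c)
        = sc (q + q^-1) * (f a * f b * f c * (K' a * K' b * K' c)).
      by rewrite -p3 !mulrA.
    have KC' := uq_K'K' scC rep2.
    have k2 : K' i * K' j * K' i = K' i * K' i * K' j by rewrite -mulrA (KC' j) mulrA.
    have k1 : K' j * K' i * K' i = K' i * K' i * K' j by rewrite (KC' j).
    rewrite !p3 p3' k1 k2.
    transitivity ((f i * f i * f j - sc (q + q^-1) * f i * f j * f i
        + f j * f i * f i) * (K' i * K' i * K' j)).
      by move: (K' i * K' i * K' j) => x; nc_coef F sc scC; field.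
    by rewrite fS mul0r.
  + have := K'F i i; rewrite cartanA_ii => KF.
    rewrite -mulrA KF !mulrA -scC -!mulrA; congr (_ * _).
    by rewrite !mulrA (eq0 (cFf i i)).
  + have := K'F i j; rewrite cartanA_adj // aij => KF.
    rewrite -mulrA KF !mulrA -scC -!mulrA; congr (_ * _).
    by rewrite !mulrA (eq0 (cFf i j)).
  have := K'F j i; rewrite cartanA_adj // aji => KF.
  rewrite -mulrA KF !mulrA -scC -!mulrA; congr (_ * _).
  by rewrite !mulrA (eq0 (cFf j i)).
Qed.

End CoproductRep.

(* [a p j] is the exponent of the j-th variable in the p-th tensor factor. *)
Definition exponents : Type := nat -> nat -> int.

Definition set_row (a : exponents) (p : nat) (r : nat -> int) : exponents :=
  fun p' => if p' == p then r else a p'.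

Lemma set_row_id a p : set_row a p (a p) = a.
Proof. by apply/funext => p'; rewrite /set_row; case: eqP => [->|]. Qed.

Lemma set_row_eq a p r : set_row a p r p = r.
Proof. by rewrite /set_row eqxx. Qed.

Lemma set_row_neq a p p' r : p' != p -> set_row a p r p' = a p'.
Proof. by rewrite /set_row => /negPf->. Qed.

Lemma set_row_set a p r r' : set_row (set_row a p r) p r' = set_row a p r'.
Proof. by apply/funext => p'; rewrite /set_row; case: eqP. Qed.

Lemma set_rowC a p p' r r' : p != p' ->
  set_row (set_row a p r) p' r' = set_row (set_row a p' r') p r.
Proof.
move=> npp'; apply/funext => p''; rewrite /set_row.
by case: eqP => // ->; rewrite eq_sym (negPf npp').
Qed.

Definition move_unit (i j : nat) (r : nat -> int) : nat -> int :=
  fun k => r k + ((k == j)%:Z - (k == i)%:Z).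

Lemma move_unitC i j i' j' r :
  move_unit i j (move_unit i' j' r) = move_unit i' j' (move_unit i j r).
Proof. by apply/funext => k; rewrite /move_unit addrAC. Qed.

Lemma move_unitK i j r : move_unit i j (move_unit j i r) = r.
Proof. by apply/funext => k; rewrite /move_unit; lia. Qed.

Ltac nat_eq_bools := repeat
  match goal with |- context [@eq_op _ ?a ?b] =>
    first [ have -> : (a == b :> nat) = false by lia
          | have -> : (a == b :> nat) = true by lia ] end.

(** * q-difference operators on the monomials of one tensor factor *)

Section RowOperators.
Variables (F : fieldType) (q : F).
Hypothesis q_neq0 : q != 0.
Hypothesis q_sub_neq0 : q - q^-1 != 0.

Local Notation M := (exponents -> F^o).
Local Notation S := (rendo M).
Local Notation sc := (@rendo_scalar F M).

Definition qintz (z : int) : F := (q ^ z - q ^ (- z)) / (q - q^-1).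

Lemma qintz_nat (k : nat) : qintz k = qint q k.
Proof. by rewrite /qintz /qint -invr_expz. Qed.

(** The transpose of an operator sending each monomial to a multiple of a monomial. Functions of the
    exponents are linear forms on monomials, and the right action on forms corresponds to a left
    action on monomials. *)
Definition row_fun p (c : (nat -> int) -> F) (s : (nat -> int) -> nat -> int)
  (f : M) : M := fun a => c (a p) * f (set_row a p (s (a p))).

Fact row_fun_linear p c s : linear (row_fun p c s).
Proof.
move=> d f g; apply/funext => a.
rewrite /row_fun -[(d *: f + g) _]/(d * f _ + g _).
by rewrite -[(d *: _ + _) a]/(d * _ + _) mulrDr mulrCA.
Qed.

Definition row_op p c s : S := Rendo (row_fun_linear p c s).

Lemma row_opE p c s (f : M) a :
  row_op p c s f a = c (a p) * f (set_row a p (s (a p))).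
Proof. by []. Qed.

Lemma row_op_ext p c c' s s' : (forall r, c r = c' r) -> (forall r, s r = s' r) ->
  row_op p c s = row_op p c' s'.
Proof. by move=> /funext-> /funext->. Qed.

Lemma row_opM p c s c' s' : row_op p c s * row_op p c' s'
  = row_op p (fun r => c' r * c (s' r)) (fun r => s (s' r)).
Proof.
apply: rendo_eq => f; apply/funext => a.
by rewrite rendoME !row_opE set_row_eq set_row_set mulrA.
Qed.

Lemma row_opD p c c' s :
  row_op p c s + row_op p c' s = row_op p (fun r => c r + c' r) s.
Proof.
apply: rendo_eq => f; apply/funext => a.
by rewrite rendoDE row_opE mulrDl.
Qed.

Lemma row_opN p c s : - row_op p c s = row_op p (fun r => - c r) s.
Proof. by apply: rendo_eq => f; apply/funext => a; rewrite row_opE mulNr. Qed.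

Lemma row_opZ p d c s : sc d * row_op p c s = row_op p (fun r => d * c r) s.
Proof.
by rewrite rendo_scalarC; apply: rendo_eq => f; apply/funext => a;
  rewrite row_opE -mulrA.
Qed.

Lemma row_op_zero p c s : (forall r, c r = 0) -> row_op p c s = 0.
Proof.
by move=> c0; apply: rendo_eq => f; apply/funext => a; rewrite row_opE c0 mul0r.
Qed.

Lemma row_op_one p : row_op p (fun=> 1) id = 1.
Proof.
by apply: rendo_eq => f; apply/funext => a; rewrite row_opE mul1r set_row_id.
Qed.

Lemma row_opC p p' c s c' s' : p != p' ->
  row_op p c s * row_op p' c' s' = row_op p' c' s' * row_op p c s.
Proof.
move=> npp'; apply: rendo_eq => f; apply/funext => a.
rewrite !rendoME !row_opE set_row_neq // set_row_neq 1?eq_sym //.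
by rewrite set_rowC 1?eq_sym // mulrCA.
Qed.

(** On monomials E_i is x_{i+1} D_i and F_i is x_i D_{i+1}, where D_i multiplies by [r_i] and lowers
    the exponent r_i, possibly negative, by 1. *)
Definition row_e p i : S := row_op p (fun r => qintz (r i)) (move_unit i i.+1).
Definition row_f p i : S :=
  row_op p (fun r => qintz (r i.+1)) (move_unit i.+1 i).
Definition row_k p i : S := row_op p (fun r => q ^ (r i.+1 - r i)) id.
Definition row_k' p i : S := row_op p (fun r => q ^ (r i - r i.+1)) id.

Lemma row_op_shift p c s s' : (forall r, s r = s' r) ->
  row_op p c s = row_op p c s'.
Proof. by move=> /funext->. Qed.

Lemma qX_neq0 z : q ^ z != 0. Proof. by rewrite expfz_neq0. Qed.

Lemma qintzE z : qintz z = (q ^ z - (q ^ z)^-1) / (q - q^-1).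
Proof. by rewrite /qintz invr_expz. Qed.

Lemma qX_add (z : int) (b c : bool) :
  q ^ (z + (b%:Z - c%:Z)) = q ^ z * q ^+ b / q ^+ c.
Proof. by rewrite !expfzDr // -invr_expz mulrA. Qed.

Lemma qX_sub z z' : q ^ (z - z') = q ^ z / q ^ z'.
Proof. by rewrite expfzDr // -invr_expz. Qed.

Lemma qintz_move (z : int) (b c : bool) : qintz (z + (b%:Z - c%:Z))
  = (q ^ z * q ^+ b / q ^+ c - (q ^ z * q ^+ b / q ^+ c)^-1) / (q - q^-1).
Proof. by rewrite qintzE qX_add. Qed.

Lemma qq1_neq0 : q * q - 1 != 0.
Proof.
apply: contra_neq q_sub_neq0 => H; apply: (mulfI q_neq0).
by rewrite mulrBr mulfV // mulr0.
Qed.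

Ltac row_field :=
  rewrite ?/move_unit; nat_eq_bools; rewrite ?qintz_move ?qintzE ?qX_sub ?qX_add
    /= ?expr0 ?expr1;
  repeat match goal with |- context [exprz q ?z] =>
    let H := fresh "H" in
    have H := qX_neq0 z; move: (exprz q z) H => ? ? end;
  field; repeat (apply/andP; split);
  first [assumption | exact: qq1_neq0 | exact: oner_neq0].

(** Both [row_e] and [row_f] have this form, with i' = i+1 and i = i'+1, which lets one computation
    prove both kinds of Serre relations. *)
Definition row_m p i i' : S := row_op p (fun r => qintz (r i)) (move_unit i i').

Lemma row_m_adj p i i' j j' :
    (i' = i.+1 /\ j' = j.+1) \/ (i = i'.+1 /\ j = j'.+1) ->
    (i.+1 = j) \/ (j.+1 = i) ->
  row_m p i i' * row_m p i i' * row_m p j j'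
  - sc (q + q^-1) * row_m p i i' * row_m p j j' * row_m p i i'
  + row_m p j j' * row_m p i i' * row_m p i i' = 0.
Proof.
move=> Hi Hij; rewrite -!mulrA !row_opM row_opZ row_opN.
rewrite [X in _ + X + _](row_op_shift _ _ (s' := fun r =>
    move_unit i i' (move_unit i i' (move_unit j j' r)))); last first.
  by move=> r; rewrite [move_unit j _ _]move_unitC.
rewrite [X in _ + X](row_op_shift _ _ (s' := fun r =>
    move_unit i i' (move_unit i i' (move_unit j j' r)))); last first.
  by move=> r; rewrite move_unitC [move_unit j _ _]move_unitC.
rewrite !row_opD; apply: row_op_zero => r.
case: Hi => [[Di Dj]|[Di Dj]]; subst.
  by case: Hij => Dj; subst; row_field.
by case: Hij => Hij; case: Hij => Dj; subst; row_field.
Qed.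

Lemma row_m_far p i i' j j' : i != j' -> i' != j ->
  row_m p i i' * row_m p j j' = row_m p j j' * row_m p i i'.
Proof.
move=> nij' ni'j; rewrite !row_opM.
rewrite (row_op_shift _ _ (s' := fun r => move_unit j j' (move_unit i i' r))).
  apply: row_op_ext => r //; rewrite /move_unit.
  have [Dij|nij] := eqVneq i j; first by subst i; nat_eq_bools.
  by nat_eq_bools; rewrite !subrr !addr0 mulrC.
by move=> r; rewrite move_unitC.
Qed.

Lemma row_ef p i j : row_e p i * row_f p j - row_f p j * row_e p i
  = sc ((i == j)%:R / (q - q^-1)) * (row_k p i - row_k' p i).
Proof.
have [<-{j}|nij] := eqVneq i j; last first.
  rewrite mul0r rmorph0 mul0r; apply/eqP; rewrite subr_eq0; apply/eqP.
  by apply: row_m_far; rewrite ?eqSS.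
rewrite mul1r row_opN !row_opM row_opN row_opD row_opZ.
rewrite (row_op_shift _ _ (s' := id)); last by move=> r; rewrite move_unitK.
rewrite [X in _ + X](row_op_shift _ _ (s' := id)); last first.
  by move=> r; rewrite move_unitK.
rewrite row_opD; apply: row_op_ext => // r; row_field.
Qed.

Lemma row_rep n p : uq_rep (n := n) sc q (fun i => row_e p i)
  (fun i => row_f p i) (fun i => row_k p i) (fun i => row_k' p i).
Proof.
split=> [i|i|i j|i j|i j|i j|i j nij aij|i j nij aij|i j aij|i j aij].
- rewrite row_opM -(row_op_one p); apply: row_op_ext => // r.
  by row_field.
- rewrite row_opM -(row_op_one p); apply: row_op_ext => // r.
  by row_field.
- by rewrite !row_opM; apply: row_op_ext => // r; rewrite mulrC.
- rewrite row_opZ !row_opM; apply: row_op_ext => // r.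
  rewrite [LHS]mulrC [RHS]mulrA -expfzDr //; congr (_ ^ _ * _).
  rewrite /move_unit /cartanA -val_eqE /= eqSS.
  by have [->|nij] := eqVneq (i : nat) j; repeat case: eqP => //=; lia.
- rewrite row_opZ !row_opM; apply: row_op_ext => // r.
  rewrite [LHS]mulrC [RHS]mulrA -expfzDr //; congr (_ ^ _ * _).
  rewrite /move_unit /cartanA -val_eqE /= eqSS.
  by have [->|nij] := eqVneq (i : nat) j; repeat case: eqP => //=; lia.
- exact: row_ef.
- by apply: row_m_far; move: nij aij; rewrite /adjacent -val_eqE /=; lia.
- by apply: row_m_far; move: nij aij; rewrite /adjacent -val_eqE /=; lia.
- by apply: row_m_adj; move: aij; rewrite /adjacent; lia.
- by apply: row_m_adj; move: aij; rewrite /adjacent; lia.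
Qed.

End RowOperators.

(** * Tensor power of the q-boson representation *)

Section TotalOperators.
Variables (F : fieldType) (q : F).
Hypothesis q_neq0 : q != 0.
Hypothesis q_sub_neq0 : q - q^-1 != 0.

Local Notation M := (exponents -> F^o).
Local Notation S := (rendo M).
Local Notation sc := (@rendo_scalar F M).

Fixpoint tot_k N i : S := if N is N'.+1 then row_k q N' i * tot_k N' i else 1.
Fixpoint tot_k' N i : S := if N is N'.+1 then row_k' q N' i * tot_k' N' i else 1.
Fixpoint tot_e N i : S :=
  if N is N'.+1 then row_e q N' i + row_k q N' i * tot_e N' i else 0.
Fixpoint tot_f N i : S :=
  if N is N'.+1 then tot_f N' i + row_f q N' i * tot_k' N' i else 0.

Lemma row_op_totC N p c s i : (N <= p)%N ->
  [/\ row_op p c s * tot_e N i = tot_e N i * row_op p c s,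
      row_op p c s * tot_f N i = tot_f N i * row_op p c s,
      row_op p c s * tot_k N i = tot_k N i * row_op p c s
    & row_op p c s * tot_k' N i = tot_k' N i * row_op p c s].
Proof.
elim: N => [|N IHN] lt_Np /=; first by rewrite !mulr0 !mul0r !mulr1 !mul1r.
have [He Hf Hk Hk'] := IHN (ltnW lt_Np).
have C c' s' : row_op p c s * row_op N c' s' = row_op N c' s' * row_op p c s :> S.
  by apply: row_opC; rewrite gtn_eqF.
split.
- by rewrite mulrDl mulrDr C [_ * (row_k _ _ _ * _)]mulrA C -!mulrA He.
- by rewrite mulrDl mulrDr Hf [_ * (row_f _ _ _ * _)]mulrA C -!mulrA Hk'.
- by rewrite mulrA C -!mulrA Hk.
- by rewrite mulrA C -!mulrA Hk'.
Qed.

Lemma tot_rep n N : uq_rep (n := n) sc q (fun i => tot_e N i)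
  (fun i => tot_f N i) (fun i => tot_k N i) (fun i => tot_k' N i).
Proof.
elim: N => [|N IHN]; first exact: uq_rep_trivial.
apply: (uq_rep_coproduct (@rendo_scalarC _ _) q_neq0 (row_rep q_neq0 q_sub_neq0 n N) IHN).
move=> x y [i Hx] [j Hy].
have [c [s ->]] : exists c s, x = row_op N c s.
  case: Hx => ->.
  - by exists (fun r : nat -> int => qintz q (r i)), (move_unit i i.+1).
  - by exists (fun r : nat -> int => qintz q (r i.+1)), (move_unit i.+1 i).
  - by exists (fun r : nat -> int => q ^ (r i.+1 - r i)), id.
  - by exists (fun r : nat -> int => q ^ (r i - r i.+1)), id.
have [He Hf Hk Hk'] := row_op_totC c s j (leqnn N).
by case: Hy => ->.
Qed.

Definition move_in (a : exponents) p i j : exponents :=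
  set_row a p (move_unit i j (a p)).

Lemma row_kE p i (g : M) a : row_k q p i g a = q ^ (a p i.+1 - a p i) * g a.
Proof. by rewrite row_opE set_row_id. Qed.

Lemma row_k'E p i (g : M) a : row_k' q p i g a = q ^ (a p i - a p i.+1) * g a.
Proof. by rewrite row_opE set_row_id. Qed.

Lemma tot_kS N i : tot_k N.+1 i = row_k q N i * tot_k N i. Proof. by []. Qed.
Lemma tot_k'S N i : tot_k' N.+1 i = row_k' q N i * tot_k' N i. Proof. by []. Qed.
Lemma tot_eS N i : tot_e N.+1 i = row_e q N i + row_k q N i * tot_e N i.
Proof. by []. Qed.
Lemma tot_fS N i : tot_f N.+1 i = tot_f N i + row_f q N i * tot_k' N i.
Proof. by []. Qed.

Lemma tot_kE N i (g : M) a :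
  tot_k N i g a = q ^ (\sum_(0 <= p < N) (a p i.+1 - a p i)) * g a.
Proof.
elim: N g => [|N IHN] g; first by rewrite big_geq // expr0z mul1r.
rewrite tot_kS rendoME IHN row_kE mulrA -expfzDr // big_nat_recr //.
Qed.

Lemma tot_k'E N i (g : M) a :
  tot_k' N i g a = q ^ (\sum_(0 <= p < N) (a p i - a p i.+1)) * g a.
Proof.
elim: N g => [|N IHN] g; first by rewrite big_geq // expr0z mul1r.
rewrite tot_k'S rendoME IHN row_k'E mulrA -expfzDr // big_nat_recr //.
Qed.

(** The exponents w contributed by the other factors stay existential: all that matters is that the
    coefficients are powers of q. *)
Lemma tot_eE N i a : exists w : nat -> int, forall g : M,
  tot_e N i g a = \sum_(0 <= p < N)
    q ^ (w p) * (qintz q (a p i) * g (move_in a p i i.+1)).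
Proof.
elim: N => [|N [w IHN]]; first by exists (fun=> 0) => g; rewrite big_geq.
exists (fun p => if p == N then 0 else w p + (a N i.+1 - a N i)) => g.
rewrite tot_eS rendoDE big_nat_recr // [RHS]/= eqxx expr0z mul1r addrC.
congr (_ + _); rewrite rendoME IHN; apply: eq_big_nat => p /andP[_ lt_p].
rewrite ltn_eqF // row_kE [q ^ (w p + _)]expfzDr // -[RHS]mulrA; congr (_ * _).
by rewrite /move_in set_row_neq ?gtn_eqF // mulrCA.
Qed.

Lemma tot_fE N i a : exists w : nat -> int, forall g : M,
  tot_f N i g a = \sum_(0 <= p < N)
    q ^ (w p) * (qintz q (a p i.+1) * g (move_in a p i.+1 i)).
Proof.
elim: N => [|N [w IHN]]; first by exists (fun=> 0) => g; rewrite big_geq.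
exists (fun p => if p == N then \sum_(0 <= p < N) (a p i - a p i.+1) else w p) => g.
rewrite tot_fS rendoDE big_nat_recr // [RHS]/= eqxx; congr (_ + _).
  by rewrite IHN; apply: eq_big_nat => p /andP[_ lt_p]; rewrite ltn_eqF.
by rewrite rendoME tot_k'E.
Qed.

End TotalOperators.

Import Num.Theory.

(** * Action of the top PBW monomial on a monomial *)

Section Evaluation.
Variables (F : fieldType) (q : F) (n : nat).
Hypothesis q_neq0 : q != 0.
Hypothesis q_sub_neq0 : q - q^-1 != 0.

Local Notation M := (exponents -> F^o).
Local Notation S := (rendo M).
Local Notation sc := (@rendo_scalar F M).
Local Notation qz := (qintz q).

Lemma qintz0 : qz 0 = 0.
Proof. by rewrite qintzE // expr0z invr1 subrr mul0r. Qed.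

Lemma qintz1 : qz 1 = 1.
Proof. by rewrite qintzE // expr1z divff. Qed.

Lemma move_inE a p i j p' k : move_in a p i j p' k
  = a p' k + (if p' == p then (k == j)%:Z - (k == i)%:Z else 0).
Proof.
rewrite /move_in /set_row /move_unit; case: eqP => [->//|_].
by rewrite addr0.
Qed.

(* In the p-th factor the variables below the p-th one have nonnegative
   exponents, and the ones above it have negative exponents. *)
Definition low_null (g : M) : Prop := forall a : exponents,
  (forall p j, (j < p <= n)%N -> 0 <= a p j) -> g a = 0.
Definition high_null (g : M) : Prop := forall (a : exponents) p j,
  (p < j <= n)%N -> 0 <= a p j -> g a = 0.

(** An exponent 0 cannot be lowered, since [0] = 0: the monomials whose low exponents are all
    nonnegative span a submodule. *)
Lemma low_term g a p i j : low_null g ->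
  (forall p j, (j < p <= n)%N -> 0 <= a p j) ->
  qz (a p i) * g (move_in a p i j) = 0.
Proof.
move=> Zg Ha; have [z0|nz0] := eqVneq (a p i) 0; first by rewrite z0 qintz0 mul0r.
rewrite Zg ?mulr0 // => p' k Hk; rewrite move_inE.
have := Ha _ _ Hk; case: eqP => [Dp|_]; last by rewrite addr0.
by case: eqP; case: eqP => // *; subst; lia.
Qed.

(** By the same vanishing, the monomials with some nonnegative high exponent span a submodule, and
    the forms [high_null] are those on the quotient. *)
Lemma high_term g a p i j p' k : high_null g ->
  (p' < k <= n)%N -> 0 <= a p' k ->
  qz (a p i) * g (move_in a p i j) = 0.
Proof.
move=> Zg Hk Ha; have [z0|nz0] := eqVneq (a p i) 0.
  by rewrite z0 qintz0 mul0r.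
rewrite (Zg _ _ _ Hk) ?mulr0 // move_inE.
case: eqP => [Dp|_]; last by rewrite addr0.
by case: eqP; case: eqP => // *; subst; lia.
Qed.

Definition preserves (Z : M -> Prop) (x : S) := forall g, Z g -> Z (x g).

Lemma low_null_tot i : [/\ preserves low_null (tot_e q n.+1 i),
  preserves low_null (tot_f q n.+1 i), preserves low_null (tot_k q n.+1 i)
  & preserves low_null (tot_k' q n.+1 i)].
Proof.
split=> g Zg a Ha.
- have [w ->] := tot_eE q_neq0 n.+1 i a; rewrite big1 // => p _.
  by rewrite low_term ?mulr0.
- have [w ->] := tot_fE q_neq0 n.+1 i a; rewrite big1 // => p _.
  by rewrite low_term ?mulr0.
- by rewrite tot_kE // Zg ?mulr0.
- by rewrite tot_k'E // Zg ?mulr0.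
Qed.

Lemma high_null_tot i : [/\ preserves high_null (tot_e q n.+1 i),
  preserves high_null (tot_f q n.+1 i), preserves high_null (tot_k q n.+1 i)
  & preserves high_null (tot_k' q n.+1 i)].
Proof.
split=> g Zg a p j Hpj Ha.
- have [w ->] := tot_eE q_neq0 n.+1 i a; rewrite big1 // => p' _.
  by rewrite (high_term _ _ _ Zg Hpj Ha) mulr0.
- have [w ->] := tot_fE q_neq0 n.+1 i a; rewrite big1 // => p' _.
  by rewrite (high_term _ _ _ Zg Hpj Ha) mulr0.
- by rewrite tot_kE // (Zg _ _ _ Hpj Ha) mulr0.
- by rewrite tot_k'E // (Zg _ _ _ Hpj Ha) mulr0.
Qed.

Local Notation e := (nat_gen (fun i : 'I_n => tot_e q n.+1 i)).
Local Notation X := (root_vec sc q e).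

Lemma high_null_e j : preserves high_null (e j).
Proof.
rewrite /nat_gen; case: insub => [i|]; first by case: (high_null_tot i).
by move=> g _ a p k _ _.
Qed.

Lemma high_nullM x y : preserves high_null x -> preserves high_null y ->
  preserves high_null (x * y).
Proof. by move=> Hx Hy g /Hx/Hy. Qed.

Lemma high_null_root_vec s d : preserves high_null (X s d).
Proof.
elim: d => [|d IHd]; first exact: high_null_e.
move=> g Zg a p j Hp Ha; rewrite root_vecS.
have -> : (e (s + d.+1) * X s d - sc q^-1 * X s d * e (s + d.+1)) g a
  = X s d (e (s + d.+1) g) a - e (s + d.+1) (X s d (q^-1 *: g)) a by [].
have Z1 : high_null (X s d (e (s + d.+1) g)) by apply/IHd/high_null_e.
have Z2 : high_null (e (s + d.+1) (X s d (q^-1 *: g))).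
  apply/high_null_e/IHd => b p' j' Hp' Hb.
  by rewrite -[(_ *: g) b]/(_ * g b) (Zg _ _ _ Hp' Hb) mulr0.
by rewrite (Z1 _ _ _ Hp Ha) (Z2 _ _ _ Hp Ha) subrr.
Qed.

Lemma eE j a : (j < n)%N -> exists w : nat -> int, forall g : M,
  e j g a = \sum_(0 <= p < n.+1) q ^ (w p) * (qz (a p j) * g (move_in a p j j.+1)).
Proof.
move=> lt_jn; have -> : e j = tot_e q n.+1 j by rewrite -[j]/(nat_of_ord (Ordinal lt_jn)) nat_genE.
exact: tot_eE.
Qed.

Fixpoint chain (j r : nat) : S := if r is r'.+1 then chain j.+1 r' * e j else 1.

Lemma chainSl j r : chain j r.+1 = e (j + r) * chain j r.
Proof.
elim: r j => [|r IHr] j; first by rewrite /= addn0 mulr1 mul1r.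
rewrite -[chain j r.+2]/(chain j.+1 r.+1 * e j) IHr addSnnS.
by rewrite -[chain j r.+1]/(chain j.+1 r * e j) mulrA.
Qed.

Lemma high_null_chain j r : preserves high_null (chain j r).
Proof.
elim: r j => [|r IHr] j; first by move=> g.
rewrite -[chain j r.+1]/(chain j.+1 r * e j).
by apply: high_nullM; [exact: IHr|exact: high_null_e].
Qed.

Variable c : nat -> int.

(** The operators preserve the degree of each row, so the diagonal exponent is what the low ones
    leave. The high exponents have the largest negative value: a unit moved into a high column gives
    0 in the quotient. *)
Definition state (m : nat -> nat -> nat) : exponents := fun p j =>
  if (j < p)%N then (m p j)%:Z
  else if j == p then c p - (\sum_(0 <= k < p) m p k)%:Z else -1.

Definition upd (m : nat -> nat -> nat) p s x : nat -> nat -> nat :=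
  fun p' j => if (p' == p) && (j == s) then x else m p' j.

Lemma state_low m p j : (j < p)%N -> state m p j = m p j.
Proof. by rewrite /state => ->. Qed.

Lemma state_high m p j : (p < j)%N -> state m p j = -1.
Proof. by rewrite /state => lt_pj; rewrite ltnNge ltnW //= gtn_eqF. Qed.

Lemma move_in_state m p s x : (s < p)%N -> m p s = x.+1 ->
  move_in (state m) p s p = state (upd m p s x).
Proof.
move=> lt_sp Dm; apply/funext => p'; apply/funext => k.
rewrite move_inE /state /upd; case: (eqVneq p' p) => [->|] /=; last by rewrite addr0.
have [lt_kp|le_pk] := ltnP k p.
  rewrite (ltn_eqF lt_kp); have [->|nks] := eqVneq k s; last by rewrite subrr addr0.
  by rewrite Dm; lia.
have -> : (k == s) = false by lia.
have [Dk|nkp] := eqVneq k p; last by rewrite subrr addr0.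
rewrite subr0 -addrA; congr (_ + _).
rewrite [in LHS](bigD1_seq s) ?iota_uniq ?mem_index_iota //=.
rewrite [in RHS](bigD1_seq s) ?iota_uniq ?mem_index_iota //= eqxx Dm.
have -> : \sum_(0 <= i < p | i != s) (if i == s then x else m p i)
    = \sum_(0 <= i < p | i != s) m p i.
  by apply: eq_bigr => i /negPf->.
move: (\sum_(_ <= _ < _ | _) _) => y.
by lia.
Qed.

Section Cleared.
Variables (m : nat -> nat -> nat) (s d : nat).
Hypothesis lt_sd : (s + d < n)%N.
Hypothesis m_mid : forall p j, (s < j < p)%N -> m p j = 0.
Hypothesis m_low : forall p, (s + d.+1 < p)%N -> m p s = 0.

(** In the rows p > j column j is empty; in the rows p <= j the unit would enter the high column
    j+1. *)
Lemma e_state_null j (h : M) : (s < j < n)%N -> high_null h -> e j h (state m) = 0.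
Proof.
move=> Hj Zh; have [w ->] := eE (state m) (ltac:(lia) : (j < n)%N).
rewrite big_nat big1 // => p /andP[_ lt_p].
have [lt_jp|le_pj] := ltnP j p.
  by rewrite state_low // m_mid ?qintz0 ?mul0r ?mulr0 //; lia.
rewrite (Zh _ p j.+1) ?mulr0 //; first by lia.
by rewrite move_inE eqxx state_high ?ltnS // eqxx (gtn_eqF (ltnSn j)).
Qed.

(** In each q-commutator, the product whose rightmost letter is e_{s+d'} with d' > 0 vanishes: on
    monomials that letter acts first, and it kills the state. *)
Lemma root_vec_chain d' (g : M) : (d' <= d)%N -> high_null g ->
  X s d' g (state m) = chain s d'.+1 g (state m).
Proof.
elim: d' g => [|d' IHd] g le_d Zg; first by rewrite chainSl addn0 mulr1.
rewrite chainSl root_vecS.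
have -> : (e (s + d'.+1) * X s d' - sc q^-1 * X s d' * e (s + d'.+1)) g (state m)
  = X s d' (e (s + d'.+1) g) (state m)
    - e (s + d'.+1) (X s d' (q^-1 *: g)) (state m) by [].
have Zg' : high_null (q^-1 *: g).
  by move=> b p' j' Hp' Hb; rewrite -[(_ *: g) b]/(_ * g b) (Zg _ _ _ Hp' Hb) mulr0.
rewrite [X in _ - X]e_state_null ?subr0; [|lia|exact: high_null_root_vec].
by rewrite IHd ?rendoME //; [lia|apply: high_null_e].
Qed.

(** A unit carried along row p can be moved up to the diagonal column p, but the next letter would
    put it in a high column. So only the row whose diagonal is the end of the chain survives. *)
Lemma chain_moved p r j (g : M) : (s < j <= p)%N -> (p <= s + d.+1)%N ->
  (j + r = s + d.+1)%N -> high_null g -> exists z : int,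
  chain j r g (move_in (state m) p s j)
  = if p == (s + d.+1)%N then q ^ z * g (move_in (state m) p s p) else 0.
Proof.
elim: r j g => [|r IHr] j g Hj le_p Djr Zg.
  have Dp : p = (s + d.+1)%N by lia.
  have Dj : j = p by lia.
  by exists 0; rewrite Dp eqxx expr0z mul1r /= -Dp Dj.
rewrite -[chain j r.+1]/(chain j.+1 r * e j) rendoME.
have Zh : high_null (chain j.+1 r g) by apply: high_null_chain.
set b := move_in _ _ _ _; have [w Ew] := eE b (ltac:(lia) : (j < n)%N).
have other p' : p' != p -> qz (b p' j) * (chain j.+1 r g) (move_in b p' j j.+1) = 0.
  move=> np; have bp k : b p' k = state m p' k by rewrite /b move_inE (negPf np) addr0.
  have [lt_jp'|le_p'j] := ltnP j p'.
    by rewrite bp state_low // m_mid ?qintz0 ?mul0r //; lia.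
  rewrite (Zh _ p' j.+1) ?mulr0 //; first by lia.
  by rewrite move_inE eqxx bp state_high ?ltnS // eqxx (gtn_eqF (ltnSn j)).
rewrite {}Ew (bigD1_seq p) ?iota_uniq ?mem_index_iota //=; last by lia.
rewrite big1_seq ?addr0; last by move=> p' /andP[np _]; rewrite other ?mulr0.
have [lt_jp|le_pj] := ltnP j p; last first.
  have Dj : j = p by lia.
  exists 0; rewrite [p == _](_ : _ = false); last by lia.
  rewrite (Zh _ p j.+1) ?mulr0 //; first by lia.
  rewrite move_inE /b move_inE !eqxx state_high ?Dj //.
  by nat_eq_bools.
have bj : b p j = 1.
  rewrite /b move_inE !eqxx state_low // m_mid; last by lia.
  by have -> : (j == s) = false by lia.
rewrite bj qintz1 mul1r.
have -> : move_in b p j j.+1 = move_in (state m) p s j.+1.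
  apply/funext => p'; apply/funext => k; rewrite /b !move_inE.
  by case: (p' == p); lia.
have [z ->] := IHr j.+1 g (ltac:(lia)) le_p (ltac:(lia)) Zg.
exists (w p + z); case: (p == _); last by rewrite mulr0.
by rewrite mulrA expfzDr.
Qed.

(** Rows p <= s would fill a high column, rows p > s+d+1 are empty in column s by [m_low], and
    [chain_moved] excludes the rows in between: only row s+d+1 contributes. *)
Lemma root_vec_state x (g : M) : m (s + d.+1)%N s = x.+1 -> high_null g ->
  exists z : int, X s d g (state m)
    = q ^ z * qint q x.+1 * g (state (upd m (s + d.+1) s x)).
Proof.
move=> Dx Zg; rewrite root_vec_chain //.
rewrite -[chain s d.+1]/(chain s.+1 d * e s) rendoME.
have Zh : high_null (chain s.+1 d g) by apply: high_null_chain.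
have [w ->] := eE (state m) (ltac:(lia) : (s < n)%N).
set p0 := (s + d.+1)%N in Dx *.
rewrite (bigD1_seq p0) ?iota_uniq ?mem_index_iota //=; last by rewrite /p0; lia.
rewrite big_nat_cond big1 ?addr0 => [|p /andP[/andP[_ lt_p] np]]; last first.
  have [lt_sp|le_ps] := ltnP s p; last first.
    rewrite (Zh _ p s.+1) ?mulr0 //; first by lia.
    by rewrite move_inE eqxx state_high ?ltnS // eqxx (gtn_eqF (ltnSn s)).
  have [le_p|gt_p] := leqP p p0; last by rewrite state_low // m_low ?qintz0 ?mul0r ?mulr0.
  have [z ->] := chain_moved (ltac:(lia) : (s < s.+1 <= p)%N) le_p
     (ltac:(rewrite /p0; lia) : (s.+1 + d = s + d.+1)%N) Zg.
  by rewrite (negPf np) !mulr0.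
have lt_sp : (s < p0)%N by rewrite /p0; lia.
have [z ->] := chain_moved (ltac:(lia) : (s < s.+1 <= p0)%N) (leqnn p0)
     (ltac:(rewrite /p0; lia) : (s.+1 + d = s + d.+1)%N) Zg.
rewrite eqxx state_low // Dx qintz_nat (move_in_state lt_sp Dx).
exists (w p0 + z); move: (qint q x.+1) => y; rewrite expfzDr // -!mulrA; congr (_ * _).
by rewrite mulrCA.
Qed.

End Cleared.

Variables (l : nat) (U : F -> Prop).
Hypothesis U_M : forall x y, U x -> U y -> U (x * y).
Hypothesis U_X : forall z, U (q ^ z).
Hypothesis U_qint : forall k, (0 < k < l)%N -> U (qint q k).

Let U1 : U 1. Proof. by rewrite -(expr0z q). Qed.

(** The coefficients produced are powers of q and integers [k] with 0 < k < l; [U] will be the set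
    of elements with a nonzero specialization. *)
Lemma root_vecX_state m s d k (g : M) : (s + d < n)%N -> (k < l)%N ->
  (forall p j, (s < j < p)%N -> m p j = 0) ->
  (forall p, (s + d.+1 < p)%N -> m p s = 0) ->
  m (s + d.+1)%N s = k -> high_null g ->
  exists2 u, U u & (X s d ^+ k) g (state m) = u * g (state (upd m (s + d.+1) s 0)).
Proof.
move=> lt_sd; elim: k m g => [|k IHk] m g lt_kl m_mid m_low Dk Zg.
  exists 1 => //; rewrite expr0 mul1r rendo1E; congr (g (state _)).
  apply/funext => p; apply/funext => j; rewrite /upd.
  by case: andP => // -[/eqP-> /eqP->].
have ZX : high_null ((X s d ^+ k) g).
  have H : preserves high_null (X s d ^+ k).
    elim: (k) => [|k' IH]; [by move=> h|rewrite exprS].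
    by apply: high_nullM IH; apply: high_null_root_vec.
  exact: H.
rewrite exprSr rendoME; have [z ->] := root_vec_state lt_sd m_mid m_low Dk ZX.
have [|||u Uu ->] := IHk (upd m (s + d.+1) s k) g (ltnW lt_kl) _ _ _ Zg.
- move=> p j Hj; rewrite /upd m_mid //.
  by have -> : (j == s) = false by [lia]; rewrite andbF.
- by move=> p Hp; rewrite /upd m_low // gtn_eqF.
- by rewrite /upd !eqxx.
exists (q ^ z * qint q k.+1 * u).
  by apply: (U_M) => //; apply: U_M; [exact: U_X|exact: U_qint].
rewrite -[RHS]mulrA; congr (_ * (_ * g (state _))).
by apply/funext => p; apply/funext => j; rewrite /upd; case: andP.
Qed.

Lemma pbw_row_state m s N (g : M) : (0 < l)%N -> (s + N <= n)%N ->
  (forall p j, (s < j < p)%N -> m p j = 0) ->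
  (forall p, m p s = if (s < p <= s + N)%N then l.-1 else 0%N) -> high_null g ->
  exists2 u, U u & pbw_row sc q e s N (fun=> l.-1) g (state m)
    = u * g (state (fun p j => if j == s then 0%N else m p j)).
Proof.
move=> l_gt0; elim: N m g => [|N IHN] m g le_n m_mid ms Zg.
  exists 1 => //; rewrite mul1r /pbw_row big_geq // rendo1E; congr (g (state _)).
  apply/funext => p; apply/funext => j; case: eqP => // ->; rewrite ms.
  by case: ifP => //; lia.
have -> : pbw_row sc q e s N.+1 (fun=> l.-1)
    = pbw_row sc q e s N (fun=> l.-1) * X s N ^+ l.-1.
  by rewrite /pbw_row big_nat_recr.
rewrite rendoME.
have ZP : high_null (pbw_row sc q e s N (fun=> l.-1) g).
  have H : preserves high_null (pbw_row sc q e s N (fun=> l.-1)).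
    apply: (big_ind (preserves high_null)) => [h //|x y|d _]; first exact: high_nullM.
    elim: (l.-1) => [|k IHk]; [by move=> h|rewrite exprS].
    by apply: high_nullM IHk; apply: high_null_root_vec.
  exact: H.
have [||||u Uu ->] := @root_vecX_state m s N l.-1 _ _ _ m_mid _ _ ZP.
- by lia.
- by lia.
- by move=> p Hp; rewrite ms; case: ifP => //; lia.
- by rewrite ms; case: ifP => //; lia.
have [|||u' Uu' ->] := IHN (upd m (s + N.+1) s 0) g _ _ _ Zg.
- by lia.
- by move=> p j Hj; rewrite /upd m_mid //; case: andP.
- move=> p; rewrite /upd eqxx andbT ms; case: eqP => [->|np].
    by case: ifP => //; lia.
  by case: ifP; case: ifP => //; lia.
exists (u * u'); first exact: U_M.
rewrite -[RHS]mulrA; congr (_ * (_ * g (state _))).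
by apply/funext => p; apply/funext => j; rewrite /upd; case: eqP => //; rewrite andbF.
Qed.

(** The columns from s on have been emptied. The top monomial empties columns by decreasing index,
    and each column by decreasing row: X_{s,d}^(l-1), an ordinary power, clears the entry at row
    s+d+1 and column s. *)
Definition full_box (s : nat) : nat -> nat -> nat := fun p j =>
  if [&& (j < p)%N, (p <= n)%N & (j < s)%N] then l.-1 else 0%N.

Lemma pbw_top_state s (g : M) : (0 < l)%N -> (s <= n)%N -> high_null g ->
  exists2 u, U u & pbw sc q e n s (fun _ _ => l.-1) g (state (full_box n))
    = u * g (state (full_box s)).
Proof.
move=> l_gt0 le_sn; move Dk: (n - s)%N => k.
elim: k s le_sn Dk g => [|k IHk] s le_sn Dk g Zg.
  have -> : s = n by lia.
  by exists 1 => //; rewrite /pbw big_geq // rendo1E mul1r.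
rewrite /pbw big_ltn; last by lia.
rewrite rendoME -/(pbw sc q e n s.+1 (fun _ _ => l.-1)).
have ZP : high_null (pbw_row sc q e s (n - s) (fun=> l.-1) g).
  have H : preserves high_null (pbw_row sc q e s (n - s) (fun=> l.-1)).
    apply: (big_ind (preserves high_null)) => [h //|x y|d _]; first exact: high_nullM.
    elim: (l.-1) => [|k' IHk']; [by move=> h|rewrite exprS].
    by apply: high_nullM IHk'; apply: high_null_root_vec.
  exact: H.
have [||u Uu ->] := IHk s.+1 _ _ _ ZP; [by lia|by lia|].
have [|||u' Uu' ->] := @pbw_row_state (full_box s.+1) s (n - s) g l_gt0 _ _ _ Zg.
- by lia.
- by move=> p j Hj; rewrite /full_box; case: ifP => //; lia.
- by move=> p; rewrite /full_box; case: ifP; case: ifP => //; lia.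
exists (u * u'); first exact: U_M.
rewrite -[RHS]mulrA; congr (_ * (_ * g (state _))).
apply/funext => p; apply/funext => j; rewrite /full_box.
by case: eqP => [->|]; [case: ifP => //; lia|case: ifP; case: ifP => //; lia].
Qed.

End Evaluation.

(** * Integrality and the functional on the small quantum group *)

Section QuantumBinomialIntegrality.
Variables (F : fieldType) (q : F).
Hypothesis q_neq0 : q != 0.
Hypothesis qint_neq0 : forall r, (0 < r)%N -> qint q r != 0.
Variable I : F -> Prop.
Hypothesis I_B : forall x y, I x -> I y -> I (x - y).
Hypothesis I_M : forall x y, I x -> I y -> I (x * y).
Hypothesis I_X : forall z, I (q ^ z).

Let q_sub_neq0 : q - q^-1 != 0 := qint_sub_neq0 qint_neq0.

Definition qbinz (z : int) (r : nat) : F :=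
  (\prod_(0 <= t < r) qintz q (z - t%:Z)) / qfact q r.

Lemma qbinz0 z : qbinz z 0 = 1.
Proof. by rewrite /qbinz big_geq // qfact0 divr1. Qed.

Lemma qbinzSr z r : qbinz z r.+1 = qbinz z r * (qintz q (z - r%:Z) / qint q r.+1).
Proof. by rewrite /qbinz big_nat_recr //= qfactS invfM mulrACA. Qed.

Lemma qbinzSl z r : qbinz (z + 1) r.+1 = qbinz z r * (qintz q (z + 1) / qint q r.+1).
Proof.
rewrite /qbinz big_nat_recl // qfactS invfM subr0.
set A := (X in qintz _ _ * X); have -> : A = \prod_(0 <= t < r) qintz q (z - t%:Z).
  by apply: eq_bigr => t _; congr qintz; lia.
move: (\prod_(_ <= _ < _) _) (qintz _ _) => a b.
by rewrite [b * a]mulrC mulrACA.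
Qed.

Lemma qbinz_pascal z r : qbinz (z + 1) r.+1
  = q ^+ r.+1 * qbinz z r.+1 + q ^ (r%:Z - z) * qbinz z r.
Proof.
have nz := qint_neq0 (ltn0Sn r).
suff E : qintz q (z + 1) = q ^+ r.+1 * qintz q (z - r%:Z) + q ^ (r%:Z - z) * qint q r.+1.
  rewrite qbinzSl qbinzSr E; move: (qbinz z r) (qintz q _) (q ^ _) => b a c.
  by move: (qint q _) nz (q ^+ _) => d d_neq0 x; field.
rewrite -!qintz_nat !qintzE //.
have -> : z + 1 = (z - r%:Z) + r.+1%:Z by lia.
have -> : r%:Z - z = - (z - r%:Z) by rewrite opprB.
rewrite expfzDr // -invr_expz -[q ^ r.+1%:Z]/(q ^+ r.+1).
move: (q ^ (z - r%:Z)) (expfz_neq0 (z - r%:Z) q_neq0) => x x_neq0.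
move: (q ^+ r.+1) (expf_neq0 r.+1 q_neq0) => y y_neq0.
move: (q - q^-1) q_sub_neq0 => d d_neq0.
by field; rewrite d_neq0 x_neq0 y_neq0.
Qed.

(** Exponents of monomials may be negative, so Pascal's rule is used upwards and downwards from z =
    0. *)
Lemma qbinz_integral z r : I (qbinz z r).
Proof.
have I1 : I 1 by rewrite -(expr0z q).
have I0 : I 0 by rewrite -(subrr 1); apply: I_B.
have I_D x y : I x -> I y -> I (x + y).
  by move=> Ix Iy; rewrite -[y]opprK; apply: (I_B) => //; rewrite -sub0r; apply: I_B.
elim: r z => [|r IHr] z; first by rewrite qbinz0.
elim/int_ind: z => [|k IHk|k IHk].
- by rewrite /qbinz big_nat_recl // qintz0 // !mul0r.
- have -> : k.+1%:Z = k%:Z + 1 by lia.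
  by rewrite qbinz_pascal; apply: I_D; apply: I_M => //; apply: (I_X r.+1%:Z).
have E := qbinz_pascal (- k.+1%:Z) r.
have {}E : qbinz (- k.+1%:Z) r.+1 = q ^ (- r.+1%:Z)
   * (qbinz (- k%:Z) r.+1 - q ^ (r%:Z - - k.+1%:Z) * qbinz (- k.+1%:Z) r).
  have -> : - k%:Z = - k.+1%:Z + 1 by lia.
  rewrite E addrK -invr_expz -[q ^ r.+1%:Z]/(q ^+ r.+1) mulrA mulVf ?mul1r //.
  by rewrite expf_neq0.
by rewrite E; apply: (I_M) => //; apply: I_B => //; apply: I_M.
Qed.

Local Notation M := (exponents -> F^o).
Local Notation S := (rendo M).
Local Notation sc := (@rendo_scalar F M).

Definition integral_op (x : S) : Prop :=
  forall g : M, (forall a, I (g a)) -> forall a, I (x g a).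

Lemma integral_opB x y : integral_op x -> integral_op y -> integral_op (x - y).
Proof. by move=> Hx Hy g Ig a; apply: I_B; [apply: Hx|apply: Hy]. Qed.

Lemma integral_opM x y : integral_op x -> integral_op y -> integral_op (x * y).
Proof. by move=> Hx Hy g Ig a; apply: Hy => b; apply: Hx. Qed.

Lemma integral_op1 : integral_op 1.
Proof. by []. Qed.

Lemma integral_opX x k : integral_op x -> integral_op (x ^+ k).
Proof.
move=> Hx; elim: k => [|k IHk]; first exact: integral_op1.
by rewrite exprS; apply: integral_opM.
Qed.

Lemma integral_op_sc c : I c -> integral_op (sc c).
Proof. by move=> Ic g Ig a; apply: I_M. Qed.

Lemma integral_opD x y : integral_op x -> integral_op y -> integral_op (x + y).
Proof.
move=> Hx Hy; have I0 : integral_op 0.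
  by rewrite -(subrr 1); apply: integral_opB; apply: integral_op1.
rewrite -[y]opprK; apply: integral_opB => //; rewrite -sub0r.
exact: integral_opB.
Qed.

Lemma integral_row_op p c s : (forall r, I (c r)) -> integral_op (row_op p c s).
Proof. by move=> Ic g Ig a; apply: I_M. Qed.

Lemma row_mX p i i' r : i != i' -> (row_m q p i i') ^+ r
  = row_op p (fun x => \prod_(0 <= t < r) qintz q (x i - t%:Z))
      (iter r (move_unit i i')).
Proof.
move=> nii'; elim: r => [|r IHr].
  by rewrite expr0 -(row_op_one _ p); apply: row_op_ext => // x; rewrite big_geq.
rewrite exprSr IHr row_opM; apply: row_op_ext => x; last first.
  by rewrite -iterSr.
rewrite big_nat_recl // subr0; congr (_ * _); apply: eq_bigr => t _.
by congr qintz; rewrite /move_unit eqxx (negPf nii'); lia.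
Qed.

(** The r-th divided power multiplies a monomial by the q-binomial coefficient of its i-th exponent
    over r; this makes Lusztig's form act integrally. *)
Lemma div_pow_row_m p i i' r : i != i' -> integral_op (div_pow sc q (row_m q p i i') r).
Proof.
move=> nii'; rewrite /div_pow row_mX // row_opZ; apply: integral_row_op => x.
by rewrite mulrC; apply: qbinz_integral.
Qed.

Lemma div_powM_comm x y r : x * y = y * x ->
  div_pow sc q (x * y) r = x ^+ r * div_pow sc q y r.
Proof.
move=> xy; rewrite /div_pow exprMn_comm // !mulrA; congr (_ * _).
exact: rendo_scalarC.
Qed.

Lemma integral_div_pow_sum x1 x2 r : x2 * x1 = sc (q ^+ 2) * x1 * x2 ->
  (forall k, integral_op (div_pow sc q x1 k)) ->
  (forall k, integral_op (div_pow sc q x2 k)) ->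
  integral_op (div_pow sc q (x1 + x2) r).
Proof.
move=> x21 I1 I2; rewrite (div_pow_sum (@rendo_scalarC _ _) q_neq0 qint_neq0) //.
apply: (big_ind integral_op) => [|x y|t _].
- by rewrite -(subrr 1); apply: integral_opB; apply: integral_op1.
- exact: integral_opD.
by apply: integral_opM; [apply: integral_op_sc; apply: (I_X (_%:Z))|apply: integral_opM].
Qed.

Lemma integral_row_k p i : integral_op (row_k q p i) /\ integral_op (row_k' q p i).
Proof. by split; apply: integral_row_op. Qed.

Lemma integral_tot_k N i : integral_op (tot_k q N i) /\ integral_op (tot_k' q N i).
Proof.
elim: N => [|N [IH IH']]; first by split; apply: integral_op1.
by have [Ik Ik'] := integral_row_k N i; split; apply: integral_opM.
Qed.

Lemma integral_div_pow0 r : integral_op (div_pow sc q 0 r).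
Proof.
case: r => [|r]; first by rewrite div_pow0; apply: integral_op1.
rewrite /div_pow expr0n mulr0 -(subrr 1).
by apply: integral_opB; apply: integral_op1.
Qed.

Lemma integral_tot_e N i r : integral_op (div_pow sc q (tot_e q N i) r).
Proof.
elim: N r => [|N IHN] r; first exact: integral_div_pow0.
have [Ce _ _ _] := row_op_totC (N := N) q (p := N)
  (fun r : nat -> int => qintz q (r i)) (move_unit i i.+1) i (leqnn N).
have [Ce' _ _ _] := row_op_totC (N := N) q (p := N)
  (fun r : nat -> int => q ^ (r i.+1 - r i)) id i (leqnn N).
have ke : row_k q N i * row_e q N i = sc (q ^+ 2) * row_e q N i * row_k q N i.
  (* Here i is a natural number; in rank i+1 it is the last ordinal. *)
  have := uq_KEq (row_rep q_neq0 q_sub_neq0 i.+1 N) ord_max ord_max.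
  by rewrite cartanA_ii.
rewrite tot_eS; apply: integral_div_pow_sum => [|k|k].
- have A : row_k q N i * tot_e q N i * row_e q N i
         = row_k q N i * (row_e q N i * tot_e q N i).
    by rewrite -mulrA; congr (_ * _); exact: (esym Ce).
  by apply: (etrans A); rewrite mulrA ke !mulrA.
- exact: (div_pow_row_m _ _ (negbT (ltn_eqF (ltnSn i)))).
rewrite (div_powM_comm _ Ce').
by apply: integral_opM => //; apply: integral_opX; case: (integral_row_k N i).
Qed.

Lemma integral_tot_f N i r : integral_op (div_pow sc q (tot_f q N i) r).
Proof.
elim: N r => [|N IHN] r; first exact: integral_div_pow0.
have [_ Cf _ Ck'] := row_op_totC (N := N) q (p := N)
  (fun r : nat -> int => qintz q (r i.+1)) (move_unit i.+1 i) i (leqnn N).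
have kf : tot_k' q N i * tot_f q N i = sc (q ^+ 2) * tot_f q N i * tot_k' q N i.
  have := uq_K'F (@rendo_scalarC _ _) q_neq0 (tot_rep q_neq0 q_sub_neq0 i.+1 N) ord_max ord_max.
  by rewrite cartanA_ii.
rewrite tot_fS; apply: integral_div_pow_sum => [|k|k].
- rewrite -[row_f q N i * _ * _]mulrA kf.
  have A : row_f q N i * (sc (q ^+ 2) * tot_f q N i * tot_k' q N i)
      = sc (q ^+ 2) * (row_f q N i * tot_f q N i) * tot_k' q N i.
    by rewrite !mulrA -(rendo_scalarC (q ^+ 2) (row_f q N i)).
  have B : row_f q N i * tot_f q N i = tot_f q N i * row_f q N i := Cf.
  by rewrite A B !mulrA.
- exact: IHN.
have C : row_f q N i * tot_k' q N i = tot_k' q N i * row_f q N i := Ck'.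
rewrite C (div_powM_comm _ (esym C)).
apply: integral_opM; last exact: (div_pow_row_m _ _ (negbT (gtn_eqF (ltnSn i)))).
by apply: integral_opX; case: (integral_tot_k N i).
Qed.

End QuantumBinomialIntegrality.

(** * Universal property of the quantum group over Q(v) *)

Section ExtensionRelations.
Variables (F : fieldType) (X : choiceType) (S : pzRingType).
Variables (sc : {rmorphism F -> S}) (phi : X -> S).
Hypothesis scC : forall c x, sc c * x = x * sc c.
Local Notation ext := (malg_ext sc phi).
Implicit Types x y z w : free_alg F X.

Lemma malg_ext_relM x y z w :
  ext x * ext y = ext z * ext w -> ext (x * y - z * w) = 0.
Proof.
move=> H; have extM := malg_extM phi scC.
have E := etrans (malg_extB sc phi (x * y) (z * w))
  (congr2 (fun a b => a - b) (etrans (extM x y) H) (extM z w)).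
by apply: (etrans E); exact: subrr.
Qed.

Lemma malg_ext_rel_inv x y : ext x * ext y = 1 -> ext (x * y - 1) = 0.
Proof.
move=> H; have E := etrans (malg_extB sc phi (x * y) 1)
  (congr2 (fun a b => a - b) (etrans (malg_extM phi scC x y) H) (malg_ext1 sc phi)).
by apply: (etrans E); exact: subrr.
Qed.

Lemma malg_ext_rel_conj k x k' c :
  ext k * ext x = sc c * ext x * ext k -> ext k * ext k' = 1 ->
  ext (k * x * k' - c *: x) = 0.
Proof.
move=> H kk'; rewrite malg_extB !malg_extM // malg_extZ H -mulrA kk' mulr1.
by rewrite subrr.
Qed.

Lemma malg_ext_rel_bracket x y z w c :
  ext x * ext y - ext y * ext x = sc c * (ext z - ext w) ->
  ext (x * y - y * x - c *: (z - w)) = 0.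
Proof.
move=> H; have extB := malg_extB sc phi; have extM := malg_extM phi scC.
have E1 := etrans (extB (x * y) (y * x))
  (congr2 (fun a b => a - b) (extM x y) (extM y x)).
have E2 := etrans (malg_extZ sc phi c (z - w)) (congr1 ( *%R (sc c)) (extB z w)).
have E3 := etrans (extB (x * y - y * x) (c *: (z - w)))
  (congr2 (fun a b => a - b) (etrans E1 H) E2).
by apply: (etrans E3); exact: subrr.
Qed.

Lemma malg_extM3 x y z : ext (x * y * z) = ext x * ext y * ext z.
Proof.
exact: etrans (malg_extM phi scC (x * y) z)
  (congr1 ( *%R^~ _) (malg_extM phi scC x y)).
Qed.

Lemma malg_ext_rel_serre x y c :
  ext x * ext x * ext y - sc c * ext x * ext y * ext x + ext y * ext x * ext x
    = 0 ->
  ext (x * x * y - c *: (x * y * x) + y * x * x) = 0.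
Proof.
move=> H; have extB := malg_extB sc phi.
have E0 := etrans (malg_extZ sc phi c (x * y * x))
  (congr1 ( *%R (sc c)) (malg_extM3 x y x)).
have E1 := etrans (extB (x * x * y) (c *: (x * y * x)))
  (congr2 (fun a b => a - b) (malg_extM3 x x y) E0).
have E2 := etrans (malg_extD sc phi (x * x * y - c *: (x * y * x)) (y * x * x))
  (congr2 +%R E1 (malg_extM3 y x x)).
apply: (etrans E2); rewrite -[RHS]H; move: (ext x) (ext y) => a b.
by rewrite !mulrA.
Qed.

End ExtensionRelations.

Section UniversalProperty.
Variables (n : nat) (S : pzRingType) (sc : {rmorphism Qv -> S}).
Hypothesis scC : forall c x, sc c * x = x * sc c.
Variables E F' K K' : 'I_n -> S.
Hypothesis rep : uq_rep sc vQ E F' K K'.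

Definition uq_sym_value (x : uq_sym n) : S :=
  match x with SymE i => E i | SymF i => F' i | SymK i => K i | SymK' i => K' i end.

Local Notation ext := (malg_ext sc uq_sym_value).

Lemma malg_ext_uq_rel z : uq_rel z -> ext z = 0.
Proof.
have g x : ext << fmu x >> = uq_sym_value x by exact: malg_ext_gen.
have gE i := g (SymE i); have gF i := g (SymF i).
have gK i := g (SymK i); have gK' i := g (SymK' i).
have KVr i : ext << fmu (SymK i) >> * ext << fmu (SymK' i) >> = 1.
  rewrite gK gK'; exact: (uq_KVr rep).
case=> [i|i|i j|i j|i j|i j|i j nij|i j nij].
- by apply: (malg_ext_rel_inv scC); exact: KVr.
- by apply: (malg_ext_rel_inv scC); rewrite gK gK'; exact: (uq_KVl rep).
- by apply: (malg_ext_relM scC); rewrite !gK; exact: (uq_KC rep).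
- have H : ext << fmu (SymK i) >> * ext << fmu (SymE j) >>
      = sc (vQ ^ cartanA i j) * ext << fmu (SymE j) >> * ext << fmu (SymK i) >>.
    by rewrite gK gE; exact: (uq_KEq rep).
  exact (malg_ext_rel_conj scC H (KVr i)).
- have H : ext << fmu (SymK i) >> * ext << fmu (SymF j) >>
      = sc (vQ ^ (- cartanA i j)) * ext << fmu (SymF j) >> * ext << fmu (SymK i) >>.
    by rewrite gK gF; exact: (uq_KFq rep).
  exact (malg_ext_rel_conj scC H (KVr i)).
- by apply: (malg_ext_rel_bracket scC); rewrite gK gK' gE gF; exact: (uq_EFq rep).
- rewrite (cartanA_adj nij); case: ifP => aij.
    by rewrite serre_neg1; apply: (malg_ext_rel_serre scC); rewrite !gE; exact: (uq_E_adj rep).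
  by rewrite serre_0; apply: (malg_ext_relM scC); rewrite !gE; apply: (uq_E_far rep) => //; rewrite aij.
- rewrite (cartanA_adj nij); case: ifP => aij.
    by rewrite serre_neg1; apply: (malg_ext_rel_serre scC); rewrite !gF; exact: (uq_F_adj rep).
  by rewrite serre_0; apply: (malg_ext_relM scC); rewrite !gF; apply: (uq_F_far rep) => //; rewrite aij.
Qed.

Definition uq_ext : Uv n -> S := presented_ext sc uq_sym_value (rel := @uq_rel n).

Lemma uq_extM : {morph uq_ext : x y / x * y}.
Proof. exact: (presented_extM scC malg_ext_uq_rel). Qed.
Lemma uq_extB : {morph uq_ext : x y / x - y}.
Proof. exact: (presented_extB scC malg_ext_uq_rel). Qed.
Lemma uq_extZ c : {morph uq_ext : x / c *: x >-> sc c * x}.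
Proof. exact: (presented_extZ scC malg_ext_uq_rel c). Qed.
Lemma uq_ext1 : uq_ext 1 = 1.
Proof. exact: (presented_ext1 scC malg_ext_uq_rel). Qed.
Lemma uq_extX x k : uq_ext (x ^+ k) = uq_ext x ^+ k.
Proof. exact: (presented_extX scC malg_ext_uq_rel x k). Qed.
Lemma uq_ext_E i : uq_ext (Uv_E i) = E i.
Proof. exact: (presented_ext_gen scC malg_ext_uq_rel (SymE i)). Qed.
Lemma uq_ext_F i : uq_ext (Uv_F i) = F' i.
Proof. exact: (presented_ext_gen scC malg_ext_uq_rel (SymF i)). Qed.
Lemma uq_ext_K i : uq_ext (Uv_K i) = K i.
Proof. exact: (presented_ext_gen scC malg_ext_uq_rel (SymK i)). Qed.
Lemma uq_ext_K' i : uq_ext (Uv_K' i) = K' i.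
Proof. exact: (presented_ext_gen scC malg_ext_uq_rel (SymK' i)). Qed.
End UniversalProperty.

Import Order.TTheory.

(** * A matrix coefficient of weight lambda *)

Section HighestWeightFunctional.
Variables (n : nat) (lambda : 'I_n -> int).

Local Notation M := (exponents -> Qv^o).
Local Notation UAval := (@subalg_val _ _ (@uq_rel n) is_laurent (@lusztig_gen n)).
Local Notation S := (rendo M).
Local Notation sc := (@rendo_scalar Qv M).
Let v_sub_neq0 : vQ - vQ^-1 != 0 := qint_sub_neq0 qint_vQ_neq0.

(** K_i multiplies the monomial [tau] by v to the power [tau_diag i.+1] - [tau_diag i] - 1, where -1
    is the high exponent of row i in column i+1; hence the increment lambda_i + 1. *)
Fixpoint tau_diag (i : nat) : int :=
  if i is j.+1 then tau_diag j + (if insub j is Some k then lambda k else 0) + 1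
  else 0.

Definition tau : exponents := state tau_diag (fun _ _ => 0%N).
Definition psi : M := fun a => (`[< a = tau >])%:R.

Local Notation act := (uq_ext (@rendo_scalar Qv M)
  (fun i : 'I_n => tot_e vQ n.+1 i) (fun i => tot_f vQ n.+1 i)
  (fun i => tot_k vQ n.+1 i) (fun i => tot_k' vQ n.+1 i)).
Let rep := tot_rep vQ_neq0 v_sub_neq0 n n.+1.
Let scC := @rendo_scalarC Qv M.

Lemma tau_low p j : (j < p)%N -> tau p j = 0.
Proof. exact: state_low. Qed.

Lemma tau_high p j : (p < j)%N -> tau p j = -1.
Proof. exact: state_high. Qed.

Lemma tau_eq p : tau p p = tau_diag p.
Proof. by rewrite /tau /state ltnn eqxx big1 // subr0. Qed.

Lemma high_null_psi : high_null n psi.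
Proof.
move=> a p j /andP[lt_pj _]; rewrite /psi; case: asboolP => // ->.
by rewrite tau_high.
Qed.

Lemma tot_k_psi (i : 'I_n) : tot_k vQ n.+1 i psi = vQ ^ lambda i *: psi.
Proof.
apply/funext => a; rewrite tot_kE ?vQ_neq0 //.
rewrite [RHS](_ : _ = vQ ^ lambda i * psi a) //.
rewrite /psi; case: asboolP => [->|_]; last by rewrite !mulr0.
congr (_ ^ _ * _).
have i_lt := ltn_ord i.
rewrite (big_cat_nat (n := i)) //=; last by lia.
rewrite [X in X + _]big_nat big1 ?add0r => [|p /andP[_ lt_p]]; last first.
  by rewrite !tau_high ?subrr; lia.
rewrite big_ltn ?[X in _ + X]big_ltn; try lia.
rewrite [X in _ + (_ + X)]big_nat big1 ?addr0 => [|p /andP[lt_p _]]; last first.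
  by rewrite !tau_low ?subrr; lia.
rewrite tau_high // tau_eq tau_eq (tau_low (ltnSn i)) /= insubT /=.
have -> : Sub (nat_of_ord i) i_lt = i by apply: val_inj.
by move: (tau_diag i) (lambda i) => x y; lia.
Qed.

(** For F_i to reach [tau] in row p, the start must have exponent -1 in column i if i < p, which is
    a negative low exponent, or exponent 0 in column i+1 if p <= i, and then the coefficient is
    [0]. *)
Lemma tot_f_psi (i : 'I_n) : low_null n (tot_f vQ n.+1 i psi).
Proof.
move=> a Ha; have [w ->] := tot_fE vQ_neq0 n.+1 i a.
rewrite big_nat big1 // => p /andP[_ lt_p]; apply/eqP.
rewrite mulf_eq0; apply/orP; right; rewrite mulf_eq0 /psi.
case: asboolP => [E|_]; last by rewrite eqxx orbT.
have Ei : tau p i = a p i + 1.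
  by rewrite -E move_inE eqxx eqxx ltn_eqF ?subr0.
have Ei1 : tau p i.+1 = a p i.+1 - 1.
  by rewrite -E move_inE !eqxx gtn_eqF ?sub0r.
have [lt_ip|le_pi] := ltnP i p.
  by have := Ha p i; rewrite tau_low // in Ei; lia.
rewrite tau_high // in Ei1; have -> : a p i.+1 = 0 by lia.
by rewrite qintz0 ?vQ_neq0 // eqxx.
Qed.

Section Integrality.
Variables (K : fieldType) (zeta : K).
Hypothesis zeta_neq0 : zeta != 0.
Hypothesis zeta_sub_neq0 : zeta - zeta^-1 != 0.

Definition specializable (c : Qv) : Prop := exists d, specializes zeta c d.

Lemma specializableB x y : specializable x -> specializable y -> specializable (x - y).
Proof. by case=> d Hd [d' Hd']; exists (d - d'); apply: specializesB. Qed.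
Lemma specializableM x y : specializable x -> specializable y -> specializable (x * y).
Proof. by case=> d Hd [d' Hd']; exists (d * d'); apply: specializesM. Qed.
Lemma specializableX z : specializable (vQ ^ z).
Proof. by exists (zeta ^ z); apply: specializesXz. Qed.

Local Notation intop := (integral_op specializable).

Lemma UA_stable (Z : S -> Prop) : Z 1 -> (forall x y, Z x -> Z y -> Z (x - y)) ->
  (forall x y, Z x -> Z y -> Z (x * y)) -> (forall c, is_laurent c -> Z (sc c)) ->
  (forall (i : 'I_n) r, [/\ Z (div_pow sc vQ (tot_e vQ n.+1 i) r),
    Z (div_pow sc vQ (tot_f vQ n.+1 i) r), Z (tot_k vQ n.+1 i)
    & Z (tot_k' vQ n.+1 i)]) -> forall x : UA n, Z (act (UAval x)).
Proof.
move=> Z1 ZB ZM Zsc Zg [x /= /asboolP]; elim=> {x} [x []|||x y _ IHx _ IHy|c x Dc _ IHx].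
- move=> i r; rewrite /divpow (uq_extZ scC rep) (uq_extX scC rep) (uq_ext_E scC rep).
  by case: (Zg i r).
- move=> i r; rewrite /divpow (uq_extZ scC rep) (uq_extX scC rep) (uq_ext_F scC rep).
  by case: (Zg i r).
- by move=> i; rewrite (uq_ext_K scC rep); case: (Zg i 0%N).
- by move=> i; rewrite (uq_ext_K' scC rep); case: (Zg i 0%N).
- by rewrite (uq_ext1 scC rep).
- by move=> x y _ IHx _ IHy; rewrite (uq_extB scC rep); apply: ZB.
- by rewrite (uq_extM scC rep); apply: ZM.
- by rewrite (uq_extZ scC rep); apply: ZM => //; apply: Zsc.
Qed.

Lemma UA_integral x : intop (act (UAval x)).
Proof.
apply: UA_stable => [|y z|y z|c [p [k ->]]|i r].
- exact: integral_op1.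
- exact: integral_opB specializableB _ _.
- exact: integral_opM.
- by apply: (integral_op_sc specializableM); exists (laurent zeta p k), p, k.
have [Ik Ik'] := integral_tot_k specializableM specializableX n.+1 i.
split=> //.
- exact: (integral_tot_e vQ_neq0 qint_vQ_neq0 specializableB specializableM specializableX).
- exact: (integral_tot_f vQ_neq0 qint_vQ_neq0 specializableB specializableM specializableX).
Qed.

Lemma UA_low_null x : preserves (low_null n) (act (UAval x)).
Proof.
have PM y z : preserves (low_null n) y -> preserves (low_null n) z ->
    preserves (low_null n) (y * z) by move=> Hy Hz g /Hy/Hz.
have PX y r : preserves (low_null n) y -> preserves (low_null n) (y ^+ r).
  move=> Hy; elim: r => [|r IHr]; first by move=> g.
  by rewrite exprS; apply: PM.
have Psc c : preserves (low_null n) (sc c).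
  by move=> g Zg a Ha; apply: (etrans (_ : _ = c * g a)); rewrite // Zg ?mulr0.
apply: UA_stable => [|y z Hy Hz|y z Hy Hz|c _|i r].
- by [].
- move=> g Zg a Ha; apply: (etrans (_ : _ = y g a - z g a)) => //.
  by rewrite (Hy g Zg a Ha) (Hz g Zg a Ha) subrr.
- exact: PM.
- exact: Psc.
have [He Hf Hk Hk'] := low_null_tot n vQ_neq0 v_sub_neq0 i.
by split=> //; (apply: PM; [exact: Psc|exact: PX]).
Qed.

Variables (l : nat).
Hypothesis l_gt0 : (0 < l)%N.
Hypothesis qint_zeta_neq0 : forall k, (0 < k < l)%N -> qint zeta k != 0.

Let s0 : exponents := state tau_diag (full_box n l n).

(** The coefficient of the monomial [tau] in x applied to the monomial [s0], because x acts on forms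
    by transposition. *)
Definition theta_v (x : Uv n) : Qv := act x psi s0.

Lemma theta_vF i (x : UA n) : theta_v (Uv_F i * UAval x) = 0.
Proof.
rewrite /theta_v (uq_extM scC rep) (uq_ext_F scC rep) rendoME.
apply: UA_low_null; first exact: tot_f_psi.
by move=> p j /andP[lt_jp _]; rewrite /s0 state_low.
Qed.

Lemma theta_vK i x : theta_v (Uv_K i * x) = vQ ^ lambda i * theta_v x.
Proof.
rewrite /theta_v (uq_extM scC rep) (uq_ext_K scC rep) rendoME tot_k_psi.
by rewrite rendoZ.
Qed.

Lemma theta_vB x y : theta_v (x - y) = theta_v x - theta_v y.
Proof. by rewrite /theta_v (uq_extB scC rep). Qed.

Lemma theta_vZ c x : theta_v (c *: x) = c * theta_v x.
Proof. by rewrite /theta_v (uq_extZ scC rep) rendoME rendoZ. Qed.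

Lemma theta_v_integral (x : UA n) : specializable (theta_v (UAval x)).
Proof.
apply: UA_integral => a; rewrite /psi; case: asboolP => _.
  by exists 1; apply: specializes1.
by exists 0; apply: specializes0.
Qed.

(** The l-1 units that [s0] has in each low entry are moved to the diagonals one by one, ending at
    [tau]; every move costs a scalar with nonzero specialization. *)
Lemma theta_v_top : exists2 d, d != 0 & specializes zeta
  (theta_v (pbw (presented_scalar (@uq_rel n)) vQ (nat_gen (@Uv_E n)) n 0 (fun _ _ => l.-1))) d.
Proof.
pose U c := exists2 d : K, d != 0 & specializes zeta c d.
have U_M x y : U x -> U y -> U (x * y).
  by case=> d nd Hd [d' nd' Hd']; exists (d * d'); rewrite ?mulf_neq0 //; apply: specializesM.
have U_X z : U (vQ ^ z).
  by exists (zeta ^ z); [exact: expfz_neq0|exact: specializesXz].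
have U_q k : (0 < k < l)%N -> U (qint vQ k).
  by move=> Hk; exists (qint zeta k); [exact: qint_zeta_neq0|exact: specializes_qint].
have [u Uu] := pbw_top_state vQ_neq0 v_sub_neq0 tau_diag U_M U_X U_q l_gt0 (leq0n n) high_null_psi.
rewrite /theta_v.
have -> : act (pbw (presented_scalar (@uq_rel n)) vQ (nat_gen (@Uv_E n)) n 0 (fun _ _ => l.-1))
  = pbw sc vQ (nat_gen (fun i : 'I_n => tot_e vQ n.+1 i)) n 0 (fun _ _ => l.-1).
  apply: (pbw_related (T := fun x y => act x = y)).
  - exact: (uq_ext1 scC rep).
  - by move=> x _ y _ <- <-; rewrite (uq_extB scC rep).
  - by move=> x _ y _ <- <-; rewrite (uq_extM scC rep).
  - by rewrite /presented_scalar (uq_extZ scC rep) (uq_ext1 scC rep) mulr1.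
  move=> j; rewrite /nat_gen; case: insub => [i|]; first exact: (uq_ext_E scC rep).
  by rewrite -(subrr 0) (uq_extB scC rep) subrr.
move=> ->; case: Uu => d nd Hd.
exists d => //; suff -> : psi (state tau_diag (full_box n l 0)) = 1 by rewrite mulr1.
rewrite /psi; case: asboolP => // -[]; rewrite /tau; congr (state _ _).
by apply/funext => p; apply/funext => j; rewrite /full_box ltn0 !andbF.
Qed.

End Integrality.

End HighestWeightFunctional.

(** * Functionals on the specialization from Lusztig's form *)

Section TensorFunctional.
Variables (n : nat) (K : fieldType) (zeta : K).

Local Notation UAK := (UA n -> K^o).

Definition semilinear_pred : {pred UAK} := fun g =>
  `[< {morph g : x y / x + y} /\
      forall p k x, g (UA_scale p k x) = laurent zeta p k * g x >].

Fact semilinear_closed : subsemimod_closed semilinear_pred.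
Proof.
split; first split.
- apply/asboolP; split=> [x y|p k x]; rewrite /GRing.zero /=.
    by rewrite /cst addr0.
  by rewrite /cst mulr0.
- move=> g h /asboolP[gD gZ] /asboolP[hD hZ]; apply/asboolP; split=> [x y|p k x].
    by rewrite /GRing.add /= gD hD addrACA.
  by rewrite /GRing.add /= gZ hZ mulrDr.
- move=> a g /asboolP[gD gZ]; apply/asboolP; split=> [x y|p k x].
    by rewrite -[LHS]/(a * g (x + y)) gD mulrDr.
  by rewrite -[LHS]/(a * g _) gZ mulrCA.
Qed.

HB.instance Definition _ :=
  GRing.isSubmodClosed.Build K UAK semilinear_pred semilinear_closed.

Definition semilinear : lmodType K := submod semilinear_pred.
Local Notation S := (rendo semilinear).
Local Notation sc := (@rendo_scalar K semilinear).
Implicit Type g : semilinear.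

Lemma semilinearD g x y : submod_val g (x + y) = submod_val g x + submod_val g y.
Proof. by case: g => g /= /asboolP[]. Qed.

Lemma semilinearZ g p k x :
  submod_val g (UA_scale p k x) = laurent zeta p k * submod_val g x.
Proof. by case: g => g /= /asboolP[]. Qed.

Lemma UA_scaleAl p k (x y : UA n) : UA_scale p k (x * y) = UA_scale p k x * y.
Proof. by apply: val_inj; apply: presented_scaleAl. Qed.

Fact translate_subproof x c g : (fun y => c * submod_val g (x * y) : K^o) \in semilinear_pred.
Proof.
apply/asboolP; split=> [y z|p k y]; first by rewrite mulrDr semilinearD mulrDr.
rewrite -[UA_scale p k y]mul1r mulrCA; congr (_ * _).
have -> : x * (1 * UA_scale p k y) = UA_scale p k (x * y).
  apply: val_inj; rewrite mul1r.
  exact: (esym (presented_scaleAr _ _ _)).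
exact: semilinearZ.
Qed.

Definition translate_fun x c g : semilinear := Submod (translate_subproof x c g).

Fact translate_linear x c : linear (translate_fun x c).
Proof.
move=> a g h; apply: val_inj; apply/funext => y /=.
by rewrite mulrDr mulrCA.
Qed.

Definition translate (z : UA n * K) : S := Rendo (translate_linear z.1 z.2).

Lemma translateE z g y : submod_val (translate z g) y = z.2 * submod_val g (z.1 * y).
Proof. by []. Qed.

Local Notation ext := (malg_ext sc translate).
Let scC := @rendo_scalarC K semilinear.

Lemma semilinear_eq g h : (forall y, submod_val g y = submod_val h y) -> g = h.
Proof. by move=> H; apply: val_inj; apply/funext. Qed.

Lemma malg_ext_tensor_rel z : tensor_rel zeta z -> ext z = 0.
Proof.
have gen z' : ext << fmu z' >> = translate z' := malg_ext_gen sc translate z'.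
have extB := malg_extB sc translate.
have eB2 a b c : ext a - ext b - ext c = 0 -> ext (a - b - c) = 0.
  move=> H; apply: etrans H; apply: etrans (extB (a - b) c) _.
  by rewrite -(extB a b).
have eB a b : ext a = ext b -> ext (a - b) = 0.
  by move=> H; apply: etrans (extB a b) _; rewrite H subrr.
case=> [x y c|x c d|p k x c|d x c|x y c d|].
- apply: eB2; rewrite !gen; apply: rendo_eq => g; apply: semilinear_eq => u.
  apply: (etrans (_ : _ = c * submod_val g ((x + y) * u)
     - c * submod_val g (x * u) - c * submod_val g (y * u))) => //.
  by rewrite mulrDl semilinearD mulrDr addrAC addrK subrr.
- apply: eB2; rewrite !gen; apply: rendo_eq => g; apply: semilinear_eq => u.
  apply: (etrans (_ : _ = (c + d) * submod_val g (x * u)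
     - c * submod_val g (x * u) - d * submod_val g (x * u))) => //.
  by rewrite mulrDl addrAC addrK subrr.
- apply: eB; rewrite !gen; apply: rendo_eq => g; apply: semilinear_eq => u.
  by rewrite !translateE /= -UA_scaleAl semilinearZ mulrA [c * _]mulrC.
- apply: eB; apply: etrans (gen _) _; apply: etrans _ (esym (malg_extZ sc translate d _)).
  rewrite gen; apply: rendo_eq => g; apply: semilinear_eq => u.
  apply: (etrans (_ : _ = d * c * submod_val g (x * u))) => //.
  apply: (etrans _ (_ : c * (d * submod_val g (x * u)) = _)) => //.
  by rewrite mulrCA mulrA.
- apply: eB; apply: etrans (malg_extM translate scC _ _) _.
  rewrite !gen; apply: rendo_eq => g; apply: semilinear_eq => u.
  apply: (etrans (_ : _ = d * (c * submod_val g (x * (y * u))))) => //.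
  by rewrite translateE /= mulrA [d * c]mulrC mulrA.
- apply: eB; rewrite gen; apply: etrans _ (esym (malg_ext1 sc translate)).
  by apply: rendo_eq => g; apply: semilinear_eq => u; rewrite translateE /= !mul1r.
Qed.

Definition UK_act : UK n zeta -> S :=
  presented_ext sc translate (rel := @tensor_rel n K zeta).

Variable g0 : semilinear.
(** [UK n zeta] is presented as an algebra, so it is easier to map to a ring than to give a linear
    form on it. It is made to act on semilinear forms by left translation of the argument, and the
    form induced by g0 is the value at 1 of the translated g0. *)
Definition UK_functional (x : UK n zeta) : K := submod_val (UK_act x g0) 1.

Lemma UK_functional_of x : UK_functional (UK_of zeta x) = submod_val g0 x.
Proof.
rewrite /UK_functional /UK_act (presented_ext_gen scC malg_ext_tensor_rel).
by rewrite translateE /= mul1r mulr1.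
Qed.

Lemma UK_functionalB x y :
  UK_functional (x - y) = UK_functional x - UK_functional y.
Proof. by rewrite /UK_functional /UK_act (presented_extB scC malg_ext_tensor_rel). Qed.

Lemma UK_functionalZ c x : UK_functional (c *: x) = c * UK_functional x.
Proof.
rewrite /UK_functional /UK_act (presented_extZ scC malg_ext_tensor_rel) rendoME.
by rewrite rendoZ.
Qed.

Lemma UK_functionalM x c y : (forall u, submod_val g0 (x * u) = c * submod_val g0 u) ->
  UK_functional (UK_of zeta x * y) = c * UK_functional y.
Proof.
move=> H; rewrite /UK_functional /UK_act (presented_extM scC malg_ext_tensor_rel).
rewrite (presented_ext_gen scC malg_ext_tensor_rel) rendoME.
have -> : translate (x, 1) g0 = c *: g0.
  by apply: semilinear_eq => u; rewrite translateE /= mul1r H.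
by rewrite rendoZ.
Qed.

End TensorFunctional.

Section SmallFunctional.
Variables (n : nat) (K : fieldType) (zeta : K) (lambda : 'I_n -> int) (l : nat).
Hypothesis zeta_neq0 : zeta != 0.
Hypothesis zeta_sub_neq0 : zeta - zeta^-1 != 0.
Hypothesis l_gt0 : (0 < l)%N.
Hypothesis qint_zeta_neq0 : forall k, (0 < k < l)%N -> qint zeta k != 0.

Local Notation R := (small_u n zeta).
Local Notation sc := (small_scalar n zeta).

Definition theta_spec (x : UA n) := theta_v_integral lambda zeta_neq0 l x.
Definition theta_K (x : UA n) : K^o := projT1 (cid (theta_spec x)).

Lemma theta_KP x : specializes zeta (theta_v lambda l (subalg_val x)) (theta_K x).
Proof. exact: projT2 (cid (theta_spec x)). Qed.

Lemma theta_K_eq x d : specializes zeta (theta_v lambda l (subalg_val x)) d -> theta_K x = d.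
Proof. by move=> H; apply: (specializes_fun zeta_neq0 (theta_KP x) H). Qed.

Fact theta_K_semilinear : theta_K \in @semilinear_pred n K zeta.
Proof.
have KB x y : theta_K (x - y) = theta_K x - theta_K y.
  apply: theta_K_eq; rewrite [subalg_val _](_ : _ = subalg_val x - subalg_val y) //.
  by rewrite theta_vB; apply: specializesB => //; apply: theta_KP.
apply/asboolP; split=> [x y|p k x].
  have K0 : theta_K 0 = 0 by rewrite -(subrr 0) KB subrr.
  have KN : theta_K (- y) = - theta_K y by rewrite -[- y]sub0r KB K0 sub0r.
  have H := KB x (- y); rewrite KN !opprK in H; exact: H.
apply: theta_K_eq; rewrite [subalg_val _](_ : _ = laurent vQ p k *: subalg_val x) //.
rewrite theta_vZ; apply: specializesM => //; last exact: theta_KP.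
by exists p, k.
Qed.

Definition theta_sl : semilinear n zeta := Submod theta_K_semilinear.

Definition small_functional (x : R) : K := UK_functional theta_sl (subalg_val x).

Lemma small_functionalB x y :
  small_functional (x - y) = small_functional x - small_functional y.
Proof. exact: UK_functionalB. Qed.

Lemma small_functionalZ c x : small_functional (sc c * x) = c * small_functional x.
Proof.
rewrite -UK_functionalZ /small_functional; congr UK_functional.
exact: presented_scalarE.
Qed.

Lemma small_functionalF i x : small_functional (small_F zeta i * x) = 0.
Proof.
have H u : theta_K (UA_F i 1 * u) = 0 * theta_K u.
  rewrite mul0r; apply: theta_K_eq.
  rewrite [subalg_val _](_ : _ = divpow (Uv_F i) 1 * subalg_val u) // divpow1.
  by rewrite theta_vF //; apply: specializes0.
exact: (etrans (UK_functionalM (g0 := theta_sl) _ H) (mul0r _)).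
Qed.

Lemma small_functionalK i x :
  small_functional (small_K zeta i * x) = zeta ^ lambda i * small_functional x.
Proof.
have H u : theta_K (UA_K i * u) = zeta ^ lambda i * theta_K u.
  apply: theta_K_eq.
  rewrite [subalg_val _](_ : _ = Uv_K i * subalg_val u) // theta_vK.
  by apply: specializesM; [exact: zeta_neq0|exact: specializesXz|exact: theta_KP].
exact: (UK_functionalM (g0 := theta_sl) _ H).
Qed.

Lemma small_functional_top : small_functional
  (pbw sc zeta (nat_gen (@small_E n K zeta)) n 0 (fun _ _ => l.-1)) != 0.
Proof.
have [d d_neq0 Hd] := theta_v_top lambda zeta_neq0 zeta_sub_neq0 l_gt0 qint_zeta_neq0.
set P := pbw _ _ _ _ _ _.
have [x [Dx Ex]] : UK_image
    (pbw (presented_scalar (@uq_rel n)) vQ (nat_gen (@Uv_E n)) n 0 (fun _ _ => l.-1))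
    (subalg_val P).
  apply: (pbw_related (T := fun x (y : R) => UK_image x (subalg_val y))).
  - exact: UK_image1.
  - by move=> x x' y y' Hx Hy; apply: (UK_imageB Hx Hy).
  - by move=> x x' y y' Hx Hy; apply: (UK_imageM Hx Hy).
  - by apply: UK_image_scalar; apply: specializesV.
  move=> j; rewrite /nat_gen; case: insub => [i|]; first exact: UK_image_E.
  exact: UK_image0.
rewrite /small_functional -Ex UK_functional_of; change (theta_K x != 0).
by rewrite (theta_K_eq (d := d)) // Dx.
Qed.

End SmallFunctional.

(** * Socles, heads and extremal vectors *)

Section Submodules.
Variable R : pzRingType.

Section FromPredicate.
Variables (M : lmodType R) (P : M -> Prop).
Hypotheses (P0 : P 0) (PD : forall x y, P x -> P y -> P (x + y)).
Hypothesis PZ : forall r x, P x -> P (r *: x).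

Lemma submodule_exists : exists N : submodClosed M, forall x, x \in N <-> P x.
Proof.
pose p : {pred M} := fun x => `[< P x >].
have p_closed : subsemimod_closed p.
  split; first split; first exact/asboolP.
    by move=> x y /asboolP Px /asboolP Py; apply/asboolP/PD.
  by move=> r x /asboolP Px; apply/asboolP/PZ.
pose H := GRing.isSubmodClosed.Build R M p p_closed.
pose N : submodClosed M := HB.pack p H.
by exists N => x; split=> /asboolP.
Qed.

End FromPredicate.

Lemma submod_val_in (M : lmodType R) (N : submodClosed M) (x : submod N) :
  submod_val x \in N.
Proof. by case: x. Qed.

Variable M : lmodType R.

Lemma submodule_image (N : submodClosed M) (N' : submodClosed (submod N)) :
  exists P : submodClosed M, forall x, x \in P <-> exists2 y, y \in N' & submod_val y = x.
Proof.
apply: submodule_exists.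
- by exists 0; rewrite ?rpred0.
- by move=> _ _ [x Nx <-] [y Ny <-]; exists (x + y); rewrite ?rpredD.
- by move=> r _ [x Nx <-]; exists (r *: x); rewrite ?rpredZ.
Qed.

Section Socle.
Variable w : M.
Hypothesis w_neq0 : w != 0.
Hypothesis w_in : forall N : submodClosed M, (exists2 x, x \in N & x != 0) -> w \in N.

(** R w is simple, and it is the only simple submodule, since each one contains w. *)
Lemma simple_socle :
  simple_module (modsocle M) /\ exists w' : modsocle M, submod_val w' = w.
Proof.
have [C CP] : exists C : submodClosed M, forall x, x \in C <-> exists r, x = r *: w.
  apply: submodule_exists.
  - by exists 0; rewrite scale0r.
  - by move=> _ _ [r ->] [s ->]; exists (r + s); rewrite scalerDl.
  - by move=> r _ [s ->]; exists (r * s); rewrite scalerA.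
have Cw : w \in C by apply/CP; exists 1; rewrite scale1r.
have simple_sub (N : submodClosed M) : w \in N -> {subset N <= C} ->
    simple_module (submod N).
  move=> Nw sNC; split; first by exists (Submod Nw); rewrite -(inj_eq val_inj).
  move=> N'; have [P PP] := submodule_image N'.
  have [[x N'x x_neq0]|H] := pselect (exists2 x, x \in N' & x != 0); last first.
    by left=> x N'x; apply: contrapT => /eqP x_neq0; apply: H; exists x.
  have /w_in/PP[w' N'w' Dw'] : exists2 x, x \in P & x != 0.
    by exists (submod_val x); [apply/PP; exists x|rewrite -(inj_eq val_inj) in x_neq0].
  right=> y; have /sNC/CP[r Dy] := submod_val_in y.
  have -> : y = r *: w' by apply: val_inj; rewrite /= Dw'.
  by rewrite rpredZ.
have sw : w \in socle_pred (M := M).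
  apply/asboolP; exists [:: w]; last by rewrite big_seq1.
  by move=> y; rewrite inE => /eqP->; exists C => //; apply: simple_sub.
split; last by exists (Submod sw).
apply: simple_sub => // _ /asboolP[s Hs ->].
have {}Hs : forall y, y \in s -> y \in C.
  move=> y /Hs[N [[x x_neq0] simN] Ny].
  have Nw : w \in N.
    apply: w_in; exists (submod_val x); first exact: submod_val_in.
    by rewrite -(inj_eq val_inj) in x_neq0.
  (* The part of the simple N that lies in R w: it contains w, hence is all of N. *)
  have [N' N'P] : exists N' : submodClosed (submod N),
      forall z, z \in N' <-> submod_val z \in C.
    apply: submodule_exists; first exact: rpred0.
      by move=> z z'; apply: rpredD.
    by move=> r z; apply: rpredZ.
  case: (simN N') => [N'0|N'T]; last exact/(N'P (Submod Ny)).
  have /N'P/N'0 w0 : submod_val (Submod Nw) \in C by [].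
  have {}w0 : w = 0 := congr1 (fun z : submod N => submod_val z) w0.
  by case/eqP: w_neq0.
by rewrite big_seq; apply: rpred_sum.
Qed.

End Socle.

Section Head.
Variable N0 : submodClosed M.
Hypothesis N0_proper : exists x, x \notin N0.
Hypothesis N0_max : forall N : submodClosed M, (exists2 x, x \in N & x \notin N0) ->
  forall x, x \in N.

(** A submodule not inside N0 is everything, which makes N0 the only maximal submodule. *)
Lemma radicalE x : (x \in radical_pred (M := M)) = (x \in N0).
Proof.
have cases (N : submodClosed M) : {subset N <= N0} \/ (forall x, x \in N).
  have [H|H] := pselect (exists2 x, x \in N & x \notin N0); first by right; apply: N0_max.
  by left=> y Ny; apply: contrapT => /negP nN0; apply: H; exists y.
have max0 : maximal_submodule N0 by split=> // P _; apply: cases.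
apply/asboolP/idP => [|N0x N [[y Ny] maxN]]; first exact.
have [sNN0|NT] := cases N; last by rewrite NT in Ny.
have [|N0T] := maxN N0 sNN0; first exact.
by case: N0_proper => z; rewrite N0T.
Qed.

Lemma head_pi0 x : quotmod_pi (radical_pred (M := M)) x = 0 <-> x \in N0.
Proof.
rewrite -(raddf0 (quotmod_pi (radical_pred (M := M)))) -radicalE.
by split=> [/quotmod_piE|H]; [rewrite subr0|apply/quotmod_piE; rewrite subr0].
Qed.

Lemma simple_head : simple_module (modhead M).
Proof.
pose pi := quotmod_pi (radical_pred (M := M)).
have piK : cancel (@quotmod_repr _ _ _) pi := @quotmod_reprK _ _ (radical_pred (M := M)).
split.
  case: N0_proper => x Nx; exists (pi x); apply: contraNneq Nx => /head_pi0; exact.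
move=> Q; have [P PP] : exists P : submodClosed M, forall x, x \in P <-> pi x \in Q.
  apply: submodule_exists.
  - by rewrite /pi (_ : quotmod_pi _ 0 = 0) ?rpred0 //; apply/head_pi0/rpred0.
  - by move=> x y; rewrite /pi quotmod_piD; apply: rpredD.
  - by move=> r x Qx; rewrite /pi -quotmod_scaleE; apply: (rpredZ (s := Q) r Qx).
have [H|H] := pselect (exists2 x, x \in P & x \notin N0).
  by right=> x; rewrite -(piK x); apply/PP/N0_max.
left=> x Qx; rewrite -(piK x); apply/head_pi0; apply: contrapT => /negP nN0.
by apply: H; exists (quotmod_repr x) => //; apply/PP; rewrite piK.
Qed.

End Head.

End Submodules.

(** * Simple modules with an extremal vector *)

Section CyclicIsomorphism.
Variable R : pzRingType.

Lemma simple_cyclic (M : lmodType R) (v : M) : simple_module M -> v != 0 ->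
  forall x, exists r, x = r *: v.
Proof.
move=> [_ simM] v_neq0.
have [C CP] : exists C : submodClosed M, forall x, x \in C <-> exists r, x = r *: v.
  apply: submodule_exists.
  - by exists 0; rewrite scale0r.
  - by move=> _ _ [r ->] [s ->]; exists (r + s); rewrite scalerDl.
  - by move=> r _ [s ->]; exists (r * s); rewrite scalerA.
have Cv : v \in C by apply/CP; exists 1; rewrite scale1r.
have [C0|CT] := simM C; first by rewrite (C0 v Cv) eqxx in v_neq0.
by move=> x; apply/CP.
Qed.

Lemma cyclic_isomorphic (M M' : lmodType R) (v : M) (v' : M') :
  (forall x, exists r, x = r *: v) -> (forall x, exists r, x = r *: v') ->
  (forall r, r *: v = 0 <-> r *: v' = 0) -> isomorphic_modules M M'.
Proof.
move=> genv genv' ann.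
pose f x := projT1 (cid (genv x)) *: v'; pose g x := projT1 (cid (genv' x)) *: v.
have fE r : f (r *: v) = r *: v'.
  rewrite /f; case: cid => s /= E; apply/eqP; rewrite -subr_eq0 -scalerBl.
  by apply/eqP/ann; rewrite scalerBl E subrr.
have gE r : g (r *: v') = r *: v.
  rewrite /g; case: cid => s /= E; apply/eqP; rewrite -subr_eq0 -scalerBl.
  by apply/eqP/ann; rewrite scalerBl E subrr.
have f_linear : linear f.
  move=> a x y; have [[r ->] [s ->]] := (genv x, genv y).
  by rewrite scalerA -scalerDl !fE scalerA scalerDl.
pose F : {linear M -> M'} := HB.pack f (GRing.isLinear.Build R M M' *:%R f f_linear).
exists F; exists g => x.
  by have [r ->] := genv x; rewrite /= fE gE.
by have [r ->] := genv' x; rewrite /= gE fE.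
Qed.

End CyclicIsomorphism.

Definition letter_word (I : Type) (R : pzRingType) (x : I -> R) (w : seq I) : R :=
  \prod_(i <- w) x i.

Section LetterWords.
Variables (I : Type) (R : pzRingType) (x : I -> R).

Lemma letter_word_cons i w : letter_word x (i :: w) = x i * letter_word x w.
Proof. exact: big_cons. Qed.
Lemma letter_word_cat w w' :
  letter_word x (w ++ w') = letter_word x w * letter_word x w'.
Proof. exact: big_cat. Qed.
Lemma letter_word0 : letter_word x [::] = 1.
Proof. exact: big_nil. Qed.
Lemma letter_word1 i : letter_word x [:: i] = x i.
Proof. exact: big_seq1. Qed.

End LetterWords.

(* A raises, B lowers and T is the torus; both the pair (E, F) and the pair
   (F, E) satisfy these hypotheses. *)
Section ExtremalVectors.
Variables (n : nat) (J : Type) (K : fieldType) (R : pzRingType).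
Variable sc : {rmorphism K -> R}.
Hypothesis scC : forall c x, sc c * x = x * sc c.
Variables (A B : 'I_n -> R) (T : J -> R).
Hypothesis A_T : forall i j, exists c, A i * T j = sc c * T j * A i.
Hypothesis T_B : forall i j, exists c, T j * B i = sc c * B i * T j.
Hypothesis A_B : forall i j,
  lin_span sc (fun y => exists k, y = T k) (A i * B j - B j * A i).
Hypothesis R_ind : forall P : R -> Prop,
  (forall c, P (sc c)) -> (forall x y, P x -> P y -> P (x - y)) ->
  (forall x y, P x -> P y -> P (x * y)) ->
  (forall i, P (A i)) -> (forall i, P (B i)) -> (forall j, P (T j)) ->
  forall x, P x.

Local Notation wB := (letter_word B).
Local Notation wT := (letter_word T).

(** Only a lower bound on the number of lowering letters is recorded, so that bounds add up in
    products. *)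
Definition ordered_word k (y : R) :=
  exists w w', (k <= size w)%N /\ y = wB w * wT w'.
Local Notation tri := (lin_span sc (ordered_word 0)).
Local Notation low := (lin_span sc (ordered_word 1)).
Local Notation tor := (lin_span sc (fun y => exists w, y = wT w)).

Lemma torus_letter_word j w : exists c, T j * wB w = sc c * wB w * T j.
Proof.
elim: w => [|i w [c IHw]].
  by exists 1; rewrite letter_word0 rmorph1 !mul1r mulr1.
have [d Hd] := T_B i j; exists (d * c).
rewrite letter_word_cons mulrA Hd -!mulrA IHw rmorphM -!mulrA.
by congr (_ * _); rewrite !mulrA -scC.
Qed.

Lemma torus_word_word w' w : exists c, wT w' * wB w = sc c * wB w * wT w'.
Proof.
elim: w' => [|j w' [c IHw]].
  by exists 1; rewrite letter_word0 rmorph1 !mul1r mulr1.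
have [d Hd] := torus_letter_word j w; exists (c * d).
rewrite letter_word_cons -mulrA IHw rmorphM.
have -> : T j * (sc c * wB w * wT w') = sc c * (T j * wB w) * wT w'.
  by rewrite !mulrA -scC.
by rewrite Hd !mulrA.
Qed.

Lemma lin_span_ordered_torus j k y : lin_span sc (ordered_word k) y ->
  lin_span sc (ordered_word k) (T j * y).
Proof.
apply: (lin_spanMl scC) => _ [w [w' [le_k ->]]].
have [c Hc] := torus_letter_word j w; rewrite mulrA Hc -!mulrA; apply: span_Z.
by apply: span_in; exists w, (j :: w'); rewrite letter_word_cons.
Qed.

Lemma lin_span_ordered_B j k y : lin_span sc (ordered_word k) y ->
  lin_span sc (ordered_word k.+1) (B j * y).
Proof.
apply: (lin_spanMl scC) => _ [w [w' [le_k ->]]].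
by apply: span_in; exists (j :: w), w'; rewrite letter_word_cons -mulrA.
Qed.

Definition killed (M : lmodType R) (x : M) := forall i, A i *: x = 0.

Lemma killed_torus (M : lmodType R) (x : M) w : killed x -> killed (wT w *: x).
Proof.
move=> Ax; elim: w => [|j w IHw] i; first by rewrite letter_word0 scale1r.
have [c Hc] := A_T i j.
by rewrite letter_word_cons -scalerA scalerA Hc -!scalerA IHw !scaler0.
Qed.

Lemma tri_low k y : lin_span sc (ordered_word k) y -> tri y.
Proof.
apply: lin_span_sub => z [w [w' [_ ->]]]; apply: span_in.
by exists w, w'.
Qed.

Lemma raise_word i w w' : exists2 y, tri y &
  forall (M : lmodType R) (x : M), killed x -> A i *: (wB w * wT w' *: x) = y *: x.
Proof.
elim: w => [|j w [y IHy Hy]].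
  exists 0 => [|M x Ax]; first exact: span_0.
  by rewrite letter_word0 mul1r scale0r; apply: killed_torus.
exists (B j * y + (A i * B j - B j * A i) * (wB w * wT w')).
  apply: span_D; first exact: tri_low (lin_span_ordered_B j IHy).
  apply: (lin_spanMr scC) (A_B i j) => _ [k ->].
  by apply: lin_span_ordered_torus; apply: span_in; exists w, w'.
move=> M x Ax; have E : (B j * y) *: x = (B j * A i * (wB w * wT w')) *: x.
  by rewrite -scalerA -Hy // !scalerA mulrA.
rewrite letter_word_cons -mulrA scalerDl E -scalerDl scalerA.
by congr (_ *: _); rewrite mulrBl addrC subrK !mulrA.
Qed.

(** The element y depends on z only: it serves for all modules and all killed vectors at once, which
    is what allows vectors of two modules to be compared. *)
Lemma extremal_form z : exists2 y, tri y &
  forall (M : lmodType R) (x : M), killed x -> z *: x = y *: x.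
Proof.
suff H : forall y, tri y -> exists2 y', tri y' &
    forall (M : lmodType R) (x : M), killed x -> z *: (y *: x) = y' *: x.
  have T1 : tri 1.
    by apply: span_in; exists [::], [::]; rewrite /letter_word !big_nil mulr1.
  have [y Ty Hy] := H 1 T1; exists y => // M x Ax.
  by rewrite -Hy // scale1r.
elim/R_ind: z => [c y Ty|z z' IHz IHz' y Ty|z z' IHz IHz' y Ty|i y|i y Ty|j y Ty].
- by exists (sc c * y); [apply: span_Z|move=> M x _; rewrite scalerA].
- have [[u Tu Hu] [u' Tu' Hu']] := (IHz y Ty, IHz' y Ty).
  exists (u - u'); first exact: span_B.
  by move=> M x Ax; rewrite !scalerBl Hu ?Hu'.
- have [u' Tu' Hu'] := IHz' y Ty; have [u Tu Hu] := IHz u' Tu'.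
  by exists u => // M x Ax; rewrite -scalerA Hu' ?Hu.
- elim=> {y} [_ [w [w' [_ ->]]]||x y _ [x' Tx Hx] _ [y' Ty Hy]|c x _ [x' Tx Hx]].
  + exact: raise_word.
  + by exists 0; [exact: span_0|move=> M x _; rewrite !scale0r scaler0].
  + exists (x' + y'); first exact: span_D.
    by move=> M v Av; rewrite !scalerDl scalerDr Hx ?Hy.
  + exists (sc c * x'); first exact: span_Z.
    by move=> M v Av; rewrite -!scalerA -Hx // !scalerA scC.
- exists (B i * y); first exact: tri_low (lin_span_ordered_B i Ty).
  by move=> M x _; rewrite scalerA.
- exists (T j * y); first exact: lin_span_ordered_torus.
  by move=> M x _; rewrite scalerA.
Qed.

Lemma tri_split y : tri y -> exists t z, [/\ tor t, low z & y = t + z].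
Proof.
elim=> {y} [_ [[|i w] [w' [_ ->]]]||x y _ [t [z [Ht Hz ->]]] _ [t' [z' [Ht' Hz' ->]]]
  |c y _ [t [z [Ht Hz ->]]]].
- exists (wT w'), 0; split; last by rewrite letter_word0 mul1r addr0.
    by apply: span_in; exists w'.
  exact: span_0.
- exists 0, (wB (i :: w) * wT w'); split; last by rewrite add0r.
    exact: span_0.
  by apply: span_in; exists (i :: w), w'.
- by exists 0, 0; split; [exact: span_0|exact: span_0|rewrite addr0].
- by exists (t + t'), (z + z'); split; [exact: span_D|exact: span_D|rewrite addrACA].
- by exists (sc c * t), (sc c * z); split; [exact: span_Z|exact: span_Z|rewrite mulrDr].
Qed.

Lemma extremal_decomposition z : exists t y, [/\ tor t, low y &
  forall (M : lmodType R) (x : M), killed x -> z *: x = t *: x + y *: x].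
Proof.
have [y /tri_split[t [u [Ht Hu ->]]] Hz] := extremal_form z.
by exists t, u; split=> // M x /Hz->; rewrite scalerDl.
Qed.

Variable D : nat.
Hypothesis B_nilpotent : forall w, (D < size w)%N -> wB w = 0.

(** Each factor brings at least one lowering letter, and torus letters move to the right at the cost
    of scalars. *)
Lemma low_nilpotent y : low y -> y ^+ D.+1 = 0.
Proof.
move=> low_y; have H k : lin_span sc (ordered_word k) (y ^+ k).
  elim: k => [|k IHk].
    by apply: span_in; exists [::], [::]; rewrite expr0 /letter_word !big_nil mulr1.
  rewrite exprSr; apply: (lin_spanMr scC) IHk => _ [w [w' [le_k ->]]].
  apply: (lin_spanMl scC) low_y => _ [v [v' [le_1 ->]]].
  have [c Hc] := torus_word_word w' v.
  have -> : wB w * wT w' * (wB v * wT v') = wB w * (wT w' * wB v) * wT v'.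
    by rewrite !mulrA.
  rewrite Hc; have -> : wB w * (sc c * wB v * wT w') * wT v'
      = sc c * (wB w * wB v * (wT w' * wT v')) by rewrite !mulrA -scC.
  apply: span_Z; apply: span_in; exists (w ++ v), (w' ++ v').
  by rewrite !letter_word_cat size_cat -addn1 leq_add.
elim: (H D.+1) => [_ [w [w' [lt_D ->]]]||x x' _ -> _ ->|c x _ ->].
- by rewrite B_nilpotent ?mul0r.
- by [].
- by rewrite addr0.
- by rewrite mulr0.
Qed.

Lemma nilpotent_fixed (M : lmodType R) (x : M) c y :
  c != 0 -> low y -> sc c *: x = y *: x -> x = 0.
Proof.
move=> c_neq0 /low_nilpotent yD Hx.
have H k : sc (c ^+ k) *: x = y ^+ k *: x.
  elim: k => [|k IHk]; first by rewrite !expr0 rmorph1.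
  by rewrite exprS exprSr rmorphM -!scalerA IHk -Hx !scalerA scC.
have := H D.+1; rewrite yD scale0r => /(congr1 ( *:%R (sc (c ^+ D.+1)^-1))).
by rewrite scalerA -rmorphM mulVf ?expf_neq0 // rmorph1 scale1r scaler0.
Qed.

Definition torus_weight (mu : J -> K) (M : lmodType R) (x : M) :=
  forall j, T j *: x = sc (mu j) *: x.

Lemma torus_scalar mu t : tor t -> exists c,
  forall (M : lmodType R) (x : M), torus_weight mu x -> t *: x = sc c *: x.
Proof.
elim=> {t} [_ [w ->]||x y _ [c Hx] _ [d Hy]|a x _ [c Hx]].
- elim: w => [|j w [c Hc]].
    by exists 1 => M x _; rewrite letter_word0 rmorph1.
  exists (c * mu j) => M x Hx; rewrite letter_word_cons -scalerA Hc // scalerA -scC.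
  by rewrite -scalerA Hx scalerA -rmorphM.
- by exists 0 => M x _; rewrite rmorph0.
- by exists (c + d) => M v Hv; rewrite scalerDl Hx ?Hy // rmorphD scalerDl.
- by exists (a * c) => M v Hv; rewrite -scalerA Hx // scalerA rmorphM.
Qed.

Theorem extremal_isomorphic (mu : J -> K) (M M' : lmodType R) (v : M) (v' : M') :
  simple_module M -> simple_module M' -> v != 0 -> v' != 0 ->
  killed v -> killed v' -> torus_weight mu v -> torus_weight mu v' ->
  isomorphic_modules M M'.
Proof.
have ann (M1 M2 : lmodType R) (v1 : M1) (v2 : M2) :
    simple_module M2 -> v1 != 0 -> v2 != 0 ->
    killed v1 -> killed v2 -> torus_weight mu v1 -> torus_weight mu v2 ->
    forall r, r *: v1 = 0 -> r *: v2 = 0.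
  move=> simM2 v1_neq0 v2_neq0 k1 k2 w1 w2 r rv1; apply: contrapT => /eqP rv2.
  (* The element s r fixes v2 and kills v1, while on both it is the same scalar c plus the same
     nilpotent y. If c = 0 then v2 = y v2, otherwise - c v1 = y v1: one of the vectors would be
     0. *)
  have [s Ds] := simple_cyclic simM2 rv2 v2; rewrite scalerA in Ds.
  have sr1 : (s * r) *: v1 = 0 by rewrite -scalerA rv1 scaler0.
  have [t [y [Ht Hy H]]] := extremal_decomposition (s * r).
  have [c Hc] := torus_scalar mu Ht.
  have [c0|c_neq0] := eqVneq c 0.
    case/eqP: v2_neq0; apply: (nilpotent_fixed (c := 1) _ Hy); first exact: oner_neq0.
    by rewrite rmorph1 scale1r {1}Ds H // Hc // c0 rmorph0 scale0r add0r.
  case/eqP: v1_neq0; apply: (nilpotent_fixed (c := - c) (y := y)) => //.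
    by rewrite oppr_eq0.
  rewrite rmorphN scaleNr; apply/eqP; rewrite eq_sym -subr_eq0 opprK addrC.
  by rewrite -Hc // -H // sr1.
move=> sM sM' nv nv' kv kv' wv wv'.
apply: (cyclic_isomorphic (v := v) (v' := v')); [exact: simple_cyclic|exact: simple_cyclic|].
by move=> r; split; [apply: (ann M M')|apply: (ann M' M)].
Qed.

(** chi is injective on killed vectors: if z is killed and chi z = 0, then R z lies in the kernel of
    chi and cannot be M. The vector T_j x - mu_j x is killed and chi vanishes on it. *)
Lemma extremal_line (mu : J -> K) (M : lmodType R) (chi : M -> K) (x : M) :
  simple_module M -> (forall x y, chi (x + y) = chi x + chi y) ->
  (forall c x, chi (sc c *: x) = c * chi x) ->
  (forall i x, chi (B i *: x) = 0) -> (forall j x, chi (T j *: x) = mu j * chi x) ->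
  (exists y, chi y != 0) -> killed x -> torus_weight mu x.
Proof.
move=> simM chiD chiZ chiB chiT [y0 chi_y0] kx.
have chi0 : chi 0 = 0 by apply: (addrI (chi 0)); rewrite -chiD !addr0.
have chi_tor t : tor t -> forall x, chi x = 0 -> chi (t *: x) = 0.
  elim=> {t} [_ [w ->]||t t' _ Ht _ Ht'|c t _ Ht] {kx}x chi_x.
  - elim: w => [|j w IHw]; first by rewrite letter_word0 scale1r.
    by rewrite letter_word_cons -scalerA chiT IHw mulr0.
  - by rewrite scale0r.
  - by rewrite scalerDl chiD Ht ?Ht' ?addr0.
  - by rewrite -scalerA chiZ Ht ?mulr0.
have chi_low z : low z -> forall x, chi (z *: x) = 0.
  elim=> {z} [_ [[|i w] [w' [// _ ->]]]||z z' _ Hz _ Hz'|c z _ Hz] {kx}x.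
  - by rewrite letter_word_cons -!scalerA chiB.
  - by rewrite scale0r.
  - by rewrite scalerDl chiD Hz Hz' addr0.
  - by rewrite -scalerA chiZ Hz mulr0.
have inj (z : M) : killed z -> chi z = 0 -> z = 0.
  move=> kz chi_z; apply: contrapT => /eqP z_neq0.
  have [r Dy] := simple_cyclic simM z_neq0 y0.
  have [t [y [Ht Hy H]]] := extremal_decomposition r.
  by case/eqP: chi_y0; rewrite Dy H // chiD chi_tor ?chi_low ?addr0.
move=> j; apply/eqP; rewrite -subr_eq0; apply/eqP/inj.
  move=> i; have := killed_torus [:: j] kx i; rewrite letter_word1 => Hj.
  by rewrite scalerBr Hj sub0r scalerA -scC -scalerA kx scaler0 oppr0.
by rewrite -scaleN1r -(rmorphN1 sc) chiD !chiZ chiT mulN1r subrr.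
Qed.

End ExtremalVectors.

(** * Words in the generators: nilpotency and the top monomial *)

Section LetterWordsPBW.
Variables (n l : nat) (F : fieldType) (R : pzRingType) (sc : {rmorphism F -> R}).
Hypothesis scC : forall c x, sc c * x = x * sc c.
Variables (q : F) (x : 'I_n -> R).
Hypothesis q_neq0 : q != 0.
Hypothesis q2_neqN1 : 1 + q ^+ 2 != 0.
Hypothesis x_far : forall i j, i != j -> ~~ adjacent i j -> x i * x j = x j * x i.
Hypothesis x_adj : forall i j, adjacent i j ->
    x i * x i * x j - sc (q + q^-1) * x i * x j * x i + x j * x i * x i = 0.
Hypothesis l_gt0 : (0 < l)%N.
Hypothesis root_vecXl : forall s d, root_vec sc q (nat_gen x) s d ^+ l = 0.

Local Notation e := (nat_gen x).
Local Notation pbwx := (pbw sc q e n 0).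

Definition word_of_size k (y : R) := exists2 w, size w = k & y = letter_word x w.

Lemma word_of_sizeM j k y z : lin_span sc (word_of_size j) y ->
  lin_span sc (word_of_size k) z -> lin_span sc (word_of_size (j + k)) (y * z).
Proof.
move=> Hy Hz; apply: (lin_spanMr scC) Hy => _ [w <- ->].
apply: (lin_spanMl scC) Hz => _ [w' <- ->]; apply: span_in.
by exists (w ++ w'); rewrite ?size_cat ?letter_word_cat.
Qed.

Lemma word_of_size1 : lin_span sc (word_of_size 0) 1.
Proof. by apply: span_in; exists [::]; rewrite ?letter_word0. Qed.

Lemma word_of_sizeX j k y : lin_span sc (word_of_size j) y ->
  lin_span sc (word_of_size (k * j)) (y ^+ k).
Proof.
move=> Hy; elim: k => [|k IHk]; first exact: word_of_size1.
by rewrite exprS mulSn; apply: word_of_sizeM.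
Qed.

Lemma root_vec_words s d : lin_span sc (word_of_size d.+1) (root_vec sc q e s d).
Proof.
have gen j : lin_span sc (word_of_size 1) (e j).
  rewrite /nat_gen; case: insub => [i|]; last exact: span_0.
  by apply: span_in; exists [:: i]; rewrite ?letter_word1.
elim: d => [|d IHd]; first exact: gen.
rewrite root_vecS; apply: span_B; first by rewrite -[d.+2]add1n; apply: word_of_sizeM.
by rewrite -mulrA -[d.+2]addn1; apply: span_Z; apply: word_of_sizeM.
Qed.

Lemma pbw_words m : lin_span sc (word_of_size (pbw_deg n 0 m)) (pbwx m).
Proof.
rewrite /pbw_deg /pbw; apply: (big_ind2 (fun k y => lin_span sc (word_of_size k) y)).
- exact: word_of_size1.
- by move=> *; apply: word_of_sizeM.
move=> i _; apply: (big_ind2 (fun k y => lin_span sc (word_of_size k) y)).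
- exact: word_of_size1.
- by move=> *; apply: word_of_sizeM.
by move=> d _; apply: word_of_sizeX; apply: root_vec_words.
Qed.

Lemma letter_word_pbw_homog w :
  lin_span sc (pbw_homog sc q e n l 0 (size w)) (letter_word x w).
Proof.
have -> : letter_word x w = gen_word e [seq val i | i <- w].
  elim: w => [|i w IHw]; first by rewrite letter_word0 /gen_word big_nil.
  by rewrite letter_word_cons map_cons gen_word_cons nat_genE IHw.
rewrite -(size_map val); apply: (gen_word_pbw scC) => //.
- exact: nat_gen_far.
- exact: nat_gen_serre.
- exact: nat_gen_serre'.
- exact: nat_gen_out.
by apply/allP.
Qed.

Lemma letter_word_pbw w : lin_span sc
  (fun y => exists2 m, forall i d, (m i d < l)%N & y = pbwx m) (letter_word x w).
Proof.
apply: lin_span_sub (letter_word_pbw_homog w) => _ [m [-> Hm _]].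
by apply: span_in; exists m.
Qed.

Definition pbw_top_deg := pbw_deg n 0 (fun _ _ => l.-1).

(** PBW rewriting preserves length, and a monomial with exponents below l has at most the degree of
    the top one. *)
Lemma letter_word_nilpotent w : (pbw_top_deg < size w)%N -> letter_word x w = 0.
Proof.
move=> lt_w; have := letter_word_pbw_homog w; move: (letter_word x w) => y Hy.
elim: Hy => {y} [_ [m [-> Hm deg]]||y z _ -> _ ->|c y _ ->].
- suff : (pbw_deg n 0 m <= pbw_top_deg)%N by rewrite deg leqNgt lt_w.
  apply: leq_sum => i _; apply: leq_sum => d _; rewrite leq_mul2r.
  by have := Hm i d; case: (l) => // k; rewrite ltnS => ->; rewrite orbT.
- by [].
- by rewrite addr0.
- by rewrite mulr0.
Qed.

(** Expanded back into words, the product only has words one letter longer than the top degree. *)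
Lemma pbw_topM i : pbwx (fun _ _ => l.-1) * x i = 0.
Proof.
have : lin_span sc (word_of_size (pbw_top_deg + 1)) (pbwx (fun _ _ => l.-1) * x i).
  apply: word_of_sizeM; first exact: pbw_words.
  by apply: span_in; exists [:: i]; rewrite ?letter_word1.
elim=> [_ [w Dw ->]||y z _ -> _ ->|c y _ ->].
- by rewrite letter_word_nilpotent // Dw addn1.
- by [].
- by rewrite addr0.
- by rewrite mulr0.
Qed.

(** The index shift between V(lambda), where roots are pairs counted from 1, and X_{i,d}, with i
    counted from 0 and d one less than the height. *)
Definition exponents_of (m : multiindex n l) (i d : nat) : nat :=
  mcomp m i.+1 (i + d).+1.

Hypothesis l_gt1 : (1 < l)%N.

Lemma pbw_exponents m : (forall i d, (m i d < l)%N) ->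
  exists mi : multiindex n l, pbwx m = pbwx (exponents_of mi).
Proof.
move=> Hm; pose mi : multiindex n l :=
  [ffun p : posroot n => (m (val p).1.-1 ((val p).2 - (val p).1)%N)%:R].
exists mi; apply: eq_big_nat => i /andP[_ lt_in].
apply: eq_big_nat => d /andP[_ lt_d]; congr (_ ^+ _).
have [|p [E1 E2 _]] := @root_indexP n i.+1 (i + d).+1; first by rewrite /is_root_index; lia.
rewrite /exponents_of -E1 -E2 mcomp_val ffunE E1 E2 /= subSS addKn.
by rewrite val_Zp_nat // modn_small.
Qed.

End LetterWordsPBW.

(** * Duality between nabla(lambda) and V(lambda) *)

Section TorusRelations.
Variables (n : nat) (F : fieldType) (R : pzRingType) (sc : {rmorphism F -> R}).
Hypothesis scC : forall c x, sc c * x = x * sc c.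
Variables (q : F) (E F' K K' : 'I_n -> R).
Hypothesis q_neq0 : q != 0.
Hypothesis rep : uq_rep sc q E F' K K'.

Definition torus_letter (j : 'I_n + 'I_n) : R :=
  match j with inl i => K i | inr i => K' i end.
Local Notation T := torus_letter.

Lemma q_commutes_sym c x t : c != 0 -> t * x = sc c * x * t ->
  x * t = sc c^-1 * t * x.
Proof.
move=> c_neq0 H; rewrite -mulrA H !mulrA -rmorphM mulVf // rmorph1 mul1r.
by [].
Qed.

Lemma torus_E j i : exists2 c, c != 0 & T j * E i = sc c * E i * T j.
Proof.
case: j => j /=.
  by exists (q ^ cartanA j i); [rewrite expfz_neq0|exact: (uq_KEq rep)].
exists (q ^ cartanA j i)^-1; first by rewrite invr_eq0 expfz_neq0.
exact: (uq_K'E scC q_neq0 rep).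
Qed.

Lemma torus_F j i : exists2 c, c != 0 & T j * F' i = sc c * F' i * T j.
Proof.
case: j => j /=.
  by exists (q ^ (- cartanA j i)); [rewrite expfz_neq0|exact: (uq_KFq rep)].
exists (q ^ cartanA j i); first by rewrite expfz_neq0.
exact: (uq_K'F scC q_neq0 rep).
Qed.

Lemma torus_E_after i j : exists c, E i * T j = sc c * T j * E i.
Proof. by have [c nc /(q_commutes_sym nc)] := torus_E j i; exists c^-1. Qed.
Lemma torus_F_after i j : exists c, F' i * T j = sc c * T j * F' i.
Proof. by have [c nc /(q_commutes_sym nc)] := torus_F j i; exists c^-1. Qed.
Lemma torus_E_before i j : exists c, T j * E i = sc c * E i * T j.
Proof. by have [c _] := torus_E j i; exists c. Qed.
Lemma torus_F_before i j : exists c, T j * F' i = sc c * F' i * T j.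
Proof. by have [c _] := torus_F j i; exists c. Qed.

Lemma torus_EF i j : lin_span sc (fun y => exists k, y = T k) (E i * F' j - F' j * E i).
Proof.
rewrite (uq_EFq rep); apply: span_Z; apply: span_B; apply: span_in.
  by exists (inl i).
by exists (inr i).
Qed.

Lemma torus_FE i j : lin_span sc (fun y => exists k, y = T k) (F' i * E j - E j * F' i).
Proof. by rewrite -opprB; apply: span_N; apply: torus_EF. Qed.

End TorusRelations.

(** * The linear forms that make up nabla(lambda) *)

Section SmallAlgebra.
Variables (n : nat) (K : fieldType) (zeta : K).
Hypothesis zeta_neq0 : zeta != 0.
Hypothesis zeta_sub_neq0 : zeta - zeta^-1 != 0.

Local Notation R := (small_u n zeta).
Local Notation sc := (small_scalar n zeta).
Local Notation E := (@small_E n K zeta).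
Local Notation F := (@small_F n K zeta).
Local Notation Kk := (@small_K n K zeta).
Let scC := @small_scalarC n K zeta.
Let rep := small_rep n zeta_neq0 zeta_sub_neq0.
Local Notation K' := (@small_K' n K zeta).
Local Notation T := (torus_letter Kk K').
Local Notation wE := (letter_word E).

Definition torus_value (mu : 'I_n -> K) (j : 'I_n + 'I_n) : K :=
  match j with inl i => mu i | inr i => (mu i)^-1 end.

Lemma torus_weightP (mu : 'I_n -> K) (M : lmodType R) (x : M) :
  (forall i, mu i != 0) -> (forall i, Kk i *: x = sc (mu i) *: x) ->
  torus_weight sc T (torus_value mu) x.
Proof.
move=> nmu Hx [i|i] /=; first exact: Hx.
have := congr1 ( *:%R (K' i)) (Hx i).
rewrite !scalerA (uq_KVl rep) scale1r -scC -scalerA => H.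
by rewrite [in RHS]H !scalerA mulrA -rmorphM mulVf // rmorph1 mul1r.
Qed.

Lemma small_torus_ind (P : R -> Prop) :
  (forall c, P (sc c)) -> (forall x y, P x -> P y -> P (x - y)) ->
  (forall x y, P x -> P y -> P (x * y)) ->
  (forall i, P (E i)) -> (forall i, P (F i)) -> (forall j, P (T j)) ->
  forall x, P x.
Proof. by move=> Psc PB PM PE PF PT; apply: small_u_ind => // i; apply: (PT (inl i)). Qed.

Variable lambda : 'I_n -> int.

(** The elements of nabla(lambda), once the 1-dimensional module is identified with K. *)
Record verma_functional (phi : R -> K) : Prop := VermaFunctional {
  vermaB x y : phi (x - y) = phi x - phi y;
  vermaZ c x : phi (sc c * x) = c * phi x;
  vermaF i x : phi (F i * x) = 0;
  vermaK i x : phi (Kk i * x) = zeta ^ lambda i * phi x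
}.

Lemma verma0 phi : verma_functional phi -> phi 0 = 0.
Proof. by move=> H; rewrite -(subrr 0) (vermaB H) subrr. Qed.

Lemma vermaD phi x y : verma_functional phi -> phi (x + y) = phi x + phi y.
Proof.
move=> H; have N : phi (- y) = - phi y by rewrite -[- y]sub0r (vermaB H) (verma0 H) sub0r.
by have := vermaB H x (- y); rewrite N !opprK.
Qed.

Lemma vermaT phi j x : verma_functional phi ->
  phi (T j * x) = torus_value (fun i => zeta ^ lambda i) j * phi x.
Proof.
move=> H; case: j => i /=; first exact: (vermaK H).
have := vermaK H i (K' i * x); rewrite mulrA (uq_KVr rep) mul1r => ->.
by rewrite mulKf // expfz_neq0.
Qed.

Local Notation Espan := (lin_span sc (fun y => exists w, y = wE w)).

(** Congruence to a combination of E-words modulo the common kernel of all these forms; it plays the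
    part of a triangular decomposition. *)
Definition verma_reducible (y : R) := exists2 y', Espan y' &
  forall phi, verma_functional phi -> phi y = phi y'.

Lemma Espan_reducible y : Espan y -> verma_reducible y.
Proof. by move=> Hy; exists y. Qed.

Lemma verma_reducibleB x y : verma_reducible x -> verma_reducible y ->
  verma_reducible (x - y).
Proof.
move=> [x' Hx xx'] [y' Hy yy']; exists (x' - y'); first exact: span_B.
by move=> phi P; rewrite !(vermaB P) xx' // yy'.
Qed.

Lemma verma_reducibleZ c x : verma_reducible x -> verma_reducible (sc c * x).
Proof.
move=> [x' Hx xx']; exists (sc c * x'); first exact: span_Z.
by move=> phi P; rewrite !(vermaZ P) xx'.
Qed.

Lemma verma_reducibleD x y : verma_reducible x -> verma_reducible y ->
  verma_reducible (x + y).
Proof.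
move=> Hx Hy; have := verma_reducibleB Hx (verma_reducibleZ (-1) Hy).
by rewrite rmorphN1 mulN1r opprK.
Qed.

Lemma verma_reducible_sub (P : R -> Prop) y : (forall y, P y -> verma_reducible y) ->
  lin_span sc P y -> verma_reducible y.
Proof.
move=> HP; elim=> {y} [y /HP //||x y _ Hx _ Hy|c y _ Hy].
- by apply: Espan_reducible; apply: span_0.
- exact: verma_reducibleD.
- exact: verma_reducibleZ.
Qed.

(* Right translation preserves verma_functional. *)
Lemma verma_reducible_word x :
  (forall w, verma_reducible (wE w * x)) ->
  forall y, verma_reducible y -> verma_reducible (y * x).
Proof.
move=> Hx y [y' Hy yy'].
have P phi : verma_functional phi -> verma_functional (fun z => phi (z * x)).
  move=> H; split=> [a b|c a|i a|i a].
  - by rewrite mulrBl (vermaB H).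
  - by rewrite -mulrA (vermaZ H).
  - by rewrite -mulrA (vermaF H).
  - by rewrite -mulrA (vermaK H).
have [z Hz zz] : verma_reducible (y' * x).
  elim: Hy {yy'} => {y'} [_ [w ->]||a b _ Ha _ Hb|c a _ Ha].
  - exact: Hx.
  - by rewrite mul0r; apply: Espan_reducible; apply: span_0.
  - by rewrite mulrDl; apply: verma_reducibleD.
  - by rewrite -mulrA; apply: verma_reducibleZ.
by exists z => // phi H; rewrite -zz //; exact: (yy' _ (P phi H)).
Qed.

Lemma verma_reducible_E i y : verma_reducible y -> verma_reducible (y * E i).
Proof.
apply: verma_reducible_word => w; apply: Espan_reducible; apply: span_in.
by exists (w ++ [:: i]); rewrite letter_word_cat letter_word1.
Qed.

Lemma verma_reducible_T j y : verma_reducible y -> verma_reducible (y * T j).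
Proof.
apply: verma_reducible_word => w.
suff [c Hc] : exists c, wE w * T j = sc c * T j * wE w.
  exists (sc (c * torus_value (fun i => zeta ^ lambda i) j) * wE w).
    by apply: span_Z; apply: span_in; exists w.
  by move=> phi P; rewrite Hc -mulrA !(vermaZ P) (vermaT _ _ P) mulrA.
elim: w => [|i w [c IHw]].
  by exists 1; rewrite letter_word0 rmorph1 !mul1r mulr1.
have [d Hd] := torus_E_after scC zeta_neq0 rep i j.
exists (c * d); rewrite letter_word_cons -mulrA IHw rmorphM.
have -> : E i * (sc c * T j * wE w) = sc c * (E i * T j) * wE w.
  by rewrite !mulrA -scC.
by rewrite Hd !mulrA.
Qed.

(** F_i moves left through the E-word, leaving torus letters behind, and vanishes when it reaches
    the left end. *)
Lemma verma_reducible_F i y : verma_reducible y -> verma_reducible (y * F i).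
Proof.
apply: verma_reducible_word => w.
elim/last_ind: w => [|w j IHw].
  rewrite letter_word0 mul1r; exists 0; first exact: span_0.
  by move=> phi P; rewrite -[F i]mulr1 (vermaF P) (verma0 P).
have -> : wE (rcons w j) * F i
    = wE w * F i * E j + wE w * (E j * F i - F i * E j).
  by rewrite -cats1 letter_word_cat letter_word1 mulrBr !mulrA addrC subrK.
apply: verma_reducibleD; first exact: verma_reducible_E.
apply: verma_reducible_sub (lin_spanMl scC _ (torus_EF rep j i)); first by move=> z; exact.
move=> _ [k ->]; apply: span_in; apply: verma_reducible_T.
by apply: Espan_reducible; apply: span_in; exists w.
Qed.

Lemma verma_reduce x : verma_reducible x.
Proof.
suff H y : verma_reducible y -> verma_reducible (y * x).
  rewrite -[x]mul1r; apply: H; apply: Espan_reducible; apply: span_in.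
  by exists [::]; rewrite letter_word0.
elim/small_torus_ind: x y => [c y|x x' IHx IHx' y Hy|x x' IHx IHx' y Hy|i y|i y|j y].
- by rewrite -scC; apply: verma_reducibleZ.
- by rewrite mulrBr; apply: verma_reducibleB; [exact: IHx|exact: IHx'].
- by rewrite mulrA; apply: IHx'; apply: IHx.
- exact: verma_reducible_E.
- exact: verma_reducible_F.
- exact: verma_reducible_T.
Qed.

Lemma verma_eq0 phi : verma_functional phi -> (forall w, phi (wE w) = 0) ->
  forall x, phi x = 0.
Proof.
move=> P H x; have [y Hy ->] := verma_reduce x; last by [].
elim: Hy => {y x} [_ [w ->]||x y _ Hx _ Hy|c x _ Hx].
- exact: H.
- exact: verma0.
- by rewrite (vermaD _ _ P) Hx Hy addr0.
- by rewrite (vermaZ P) Hx mulr0.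
Qed.

End SmallAlgebra.

(** * Identification of nabla(lambda) with these forms *)

Section FlatAlgebra.
Variables (n : nat) (K : fieldType) (zeta : K).

Local Notation scz := (presented_scalar (@tensor_rel n K zeta)).
Local Notation R := (small_u n zeta).
Local Notation S := (flat_u n zeta).
Local Notation sc := (small_scalar n zeta).
Local Notation fsc := (flat_scalar n zeta).
Local Notation fval := (fun x : S => subalg_val x).
Local Notation iota := (@flat_small n K zeta).

Let fval_inj : injective fval := val_inj.

Lemma flat_scalarM a b : fsc (a * b) = fsc a * fsc b.
Proof. by apply: fval_inj; exact: (rmorphM scz a b). Qed.
Lemma flat_scalarB a b : fsc (a - b) = fsc a - fsc b.
Proof. by apply: fval_inj; exact: (rmorphB scz a b). Qed.
Lemma flat_scalarD a b : fsc (a + b) = fsc a + fsc b.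
Proof. by apply: fval_inj; exact: (rmorphD scz a b). Qed.
Lemma flat_scalar0 : fsc 0 = 0.
Proof. by apply: fval_inj; exact: (rmorph0 scz). Qed.
Lemma flat_scalar1 : fsc 1 = 1.
Proof. by apply: fval_inj; exact: (rmorph1 scz). Qed.
Lemma flat_u_ind (P : S -> Prop) :
  (forall c, P (fsc c)) -> (forall x y, P x -> P y -> P (x - y)) ->
  (forall x y, P x -> P y -> P (x * y)) ->
  (forall i, P (flat_F zeta i)) -> (forall i, P (flat_K zeta i)) ->
  forall x, P x.
Proof.
move=> Psc PB PM PF PK.
have P1 : P 1 by rewrite -flat_scalar1; apply: Psc.
suff H y : subalg_gen (@all_scalars K) (@flat_gen n K zeta) y ->
    forall x : S, fval x = y -> P x.
  by move=> x; case: (x) => y Hy; apply: (H y) => //; apply/asboolP.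
elim=> {y} [y [] i x Dx||y z Hy IHy Hz IHz x Dx|y z Hy IHy Hz IHz x Dx
           |c y _ Hy IHy x Dx].
- by rewrite (fval_inj (Dx : fval x = fval (flat_F zeta i))).
- by rewrite (fval_inj (Dx : fval x = fval (flat_K zeta i))).
- by move=> x Dx; rewrite (fval_inj (Dx : fval x = fval 1)).
- pose y' : S := Subalg (introT (asboolP _) Hy).
  pose z' : S := Subalg (introT (asboolP _) Hz).
  rewrite (fval_inj (Dx : fval x = fval (y' - z'))).
  by apply: PB; [apply: IHy|apply: IHz].
- pose y' : S := Subalg (introT (asboolP _) Hy).
  pose z' : S := Subalg (introT (asboolP _) Hz).
  rewrite (fval_inj (Dx : fval x = fval (y' * z'))).
  by apply: PM; [apply: IHy|apply: IHz].
- pose y' : S := Subalg (introT (asboolP _) Hy).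
  have Dx' : fval x = fval (fsc c * y').
    by apply: (etrans Dx); exact: (esym (presented_scalarE c (subalg_val y'))).
  by rewrite (fval_inj Dx'); apply: PM; [exact: Psc|exact: IHy].
Qed.

Lemma flat_smallB x y : iota (x - y) = iota x - iota y.
Proof. exact: val_inj. Qed.
Lemma flat_smallM x y : iota (x * y) = iota x * iota y.
Proof. exact: val_inj. Qed.
Lemma flat_small_scalar c : iota (fsc c) = sc c.
Proof. exact: val_inj. Qed.
Lemma flat_small_F i : iota (flat_F zeta i) = small_F zeta i.
Proof. exact: val_inj. Qed.
Lemma flat_small_K i : iota (flat_K zeta i) = small_K zeta i.
Proof. exact: val_inj. Qed.

Variables (lambda : 'I_n -> int) (L : lmodType S).
Hypothesis L_lambda : weight_module lambda L.

Let gen_exists : exists w : L, w != 0 /\ forall x : L, exists c, x = fsc c *: w.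
Proof. by case: L_lambda => -[w]; exists w. Qed.

Definition weight_gen : L := projT1 (cid gen_exists).
Lemma weight_gen_neq0 : weight_gen != 0.
Proof. by rewrite /weight_gen; case: cid => w []. Qed.
Lemma weight_gen_span (x : L) : exists c, x = fsc c *: weight_gen.
Proof. by rewrite /weight_gen; case: cid => w []. Qed.
Local Notation w := weight_gen.

Definition weight_val (x : L) : K := projT1 (cid (weight_gen_span x)).
Lemma weight_valK x : fsc (weight_val x) *: w = x.
Proof. by rewrite /weight_val; case: cid. Qed.

Lemma weight_val_eq c x : x = fsc c *: w -> weight_val x = c.
Proof.
move=> Dx; apply/eqP; rewrite -subr_eq0; apply: contraT => nz.
have : fsc (weight_val x - c) *: w = 0.
  by rewrite flat_scalarB scalerBl weight_valK -Dx subrr.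
move/(congr1 ( *:%R (fsc (weight_val x - c)^-1))).
rewrite scalerA -flat_scalarM mulVf // flat_scalar1 scale1r scaler0 => w0.
by have := weight_gen_neq0; rewrite w0 eqxx.
Qed.

Lemma weight_valB x y : weight_val (x - y) = weight_val x - weight_val y.
Proof. by apply: weight_val_eq; rewrite flat_scalarB scalerBl !weight_valK. Qed.

Lemma weight_valZ c x : weight_val (fsc c *: x) = c * weight_val x.
Proof. by apply: weight_val_eq; rewrite flat_scalarM -scalerA weight_valK. Qed.

Local Notation N := (nabla L).

Definition nabla_functional (f : N) (y : R) : K := weight_val (coind_val f y).

Lemma nabla_valD (f : N) x y : coind_val f (x + y) = coind_val f x + coind_val f y.
Proof. by case: f => f /= /asboolP[]. Qed.

Lemma nabla_valZ (f : N) s x : coind_val f (iota s * x) = s *: coind_val f x.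
Proof. by case: f => f /= /asboolP[]. Qed.

Lemma nabla_verma f : verma_functional lambda (nabla_functional f).
Proof.
have [_ LF LK] := L_lambda.
have f0 : coind_val f 0 = 0 by apply: (addrI (coind_val f 0)); rewrite -nabla_valD !addr0.
have fN x : coind_val f (- x) = - coind_val f x.
  by apply: (addrI (coind_val f x)); rewrite -nabla_valD !subrr.
split=> [x y|c x|i x|i x]; rewrite /nabla_functional.
- by rewrite nabla_valD fN weight_valB.
- by rewrite -flat_small_scalar nabla_valZ weight_valZ.
- rewrite -flat_small_F nabla_valZ LF; apply: weight_val_eq.
  by rewrite flat_scalar0 scale0r.
- by rewrite -flat_small_K nabla_valZ LK weight_valZ.
Qed.

Lemma nabla_functionalB f g y :
  nabla_functional (f - g) y = nabla_functional f y - nabla_functional g y.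
Proof. exact: weight_valB. Qed.

Lemma nabla_functional_scale r f y :
  nabla_functional (r *: f) y = nabla_functional f (y * r).
Proof. by []. Qed.

Lemma nabla_functional_eq0 f : (forall y, nabla_functional f y = 0) -> f = 0.
Proof.
move=> H; apply: val_inj; apply/funext => y.
apply: (etrans (_ : _ = coind_val f y)) => //; rewrite -[LHS]weight_valK.
have -> : weight_val (coind_val f y) = 0 by exact: H.
by rewrite flat_scalar0 scale0r.
Qed.

Lemma verma_nabla theta : verma_functional lambda theta ->
  exists f : N, forall y, nabla_functional f y = theta y.
Proof.
move=> P; have [_ LF LK] := L_lambda.
have Hf : (fun y => fsc (theta y) *: w) \in @coind_pred _ _ iota L.
  apply/asboolP; split=> [x y|s y].
    by rewrite (vermaD _ _ P) flat_scalarD scalerDl.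
  elim/flat_u_ind: s y => [c y|s t Hs Ht y|s t Hs Ht y|i y|i y].
  - by rewrite flat_small_scalar (vermaZ P) flat_scalarM scalerA.
  - by rewrite flat_smallB mulrBl (vermaB P) flat_scalarB !scalerBl Hs Ht.
  - by rewrite flat_smallM -mulrA Hs Ht scalerA.
  - by rewrite flat_small_F (vermaF P) LF flat_scalar0 scale0r.
  - by rewrite flat_small_K (vermaK P) flat_scalarM -scalerA LK.
by exists (Coind Hf) => y; apply: weight_val_eq.
Qed.

End FlatAlgebra.

(** The vector is obtained from x by a longest word in the A_i that does not kill x. *)
Lemma killed_exists (n : nat) (R : pzRingType) (A : 'I_n -> R) (D : nat)
    (M : lmodType R) (P : M -> Prop) (x : M) :
  (forall w, (D < size w)%N -> letter_word A w = 0) ->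
  (forall i x, P x -> P (A i *: x)) -> P x -> x != 0 ->
  exists y, [/\ P y, y != 0 & killed A y].
Proof.
move=> nilA PA Px x_neq0.
have PwA w : P (letter_word A w *: x).
  elim: w => [|i w IHw]; first by rewrite letter_word0 scale1r.
  by rewrite letter_word_cons -scalerA; apply: PA.
have : forall w, size w = D.+1 -> letter_word A w *: x = 0.
  by move=> w Dw; rewrite nilA ?scale0r // Dw.
elim: (D.+1) => [|k IHk] H.
  by have := H [::] erefl; rewrite letter_word0 scale1r => x0; rewrite x0 eqxx in x_neq0.
have [[w Dw w_neq0]|H'] := pselect (exists2 w, size w = k & letter_word A w *: x != 0).
  exists (letter_word A w *: x); split=> // i.
  by rewrite scalerA -letter_word_cons H //= Dw.
by apply: IHk => w Dw; apply: contrapT => /eqP nw; apply: H'; exists w.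
Qed.

(** * Simple socles and heads over the small quantum group *)

Section SmallModules.
Variables (n l : nat) (K : fieldType) (zeta : K).
Hypothesis zeta_neq0 : zeta != 0.
Hypothesis zeta_sub_neq0 : zeta - zeta^-1 != 0.
Hypothesis l_gt2 : (2 < l)%N.
Hypothesis qint_zeta_neq0 : forall k, (0 < k < l)%N -> qint zeta k != 0.
Hypothesis qfact_l : qfact zeta l = 0.

Local Notation R := (small_u n zeta).
Local Notation sc := (small_scalar n zeta).
Local Notation E := (@small_E n K zeta).
Local Notation F := (@small_F n K zeta).
Local Notation Kk := (@small_K n K zeta).
Local Notation K' := (@small_K' n K zeta).
Local Notation T := (torus_letter Kk K').
Local Notation wE := (letter_word E).
Local Notation D := (pbw_top_deg n l).
Local Notation X m := (pbw sc zeta (nat_gen E) n 0 m).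
Local Notation Xtop := (X (fun _ _ => l.-1)).

Let scC := @small_scalarC n K zeta.
Let rep := small_rep n zeta_neq0 zeta_sub_neq0.
Let l_gt1 : (1 < l)%N := ltnW l_gt2.
Let l_gt0 : (0 < l)%N := ltnW l_gt1.

Let q2_neqN1 : 1 + zeta ^+ 2 != 0.
Proof. by apply: qint2_neq0 => //; apply: qint_zeta_neq0; rewrite l_gt2. Qed.

Lemma small_E_nilpotent w : (D < size w)%N -> letter_word E w = 0.
Proof.
apply: (letter_word_nilpotent scC zeta_neq0 q2_neqN1 (uq_E_far rep) (uq_E_adj rep) l_gt0).
exact: small_E_root_vecXl.
Qed.

Lemma small_F_nilpotent w : (D < size w)%N -> letter_word F w = 0.
Proof.
apply: (letter_word_nilpotent scC zeta_neq0 q2_neqN1 (uq_F_far rep) (uq_F_adj rep) l_gt0).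
exact: small_F_root_vecXl.
Qed.

Lemma small_E_topM i : Xtop * E i = 0.
Proof.
apply: (pbw_topM scC zeta_neq0 q2_neqN1 (uq_E_far rep) (uq_E_adj rep) l_gt0).
exact: small_E_root_vecXl.
Qed.

Lemma small_E_word_pbw w : lin_span sc
  (fun y => exists m : multiindex n l, y = X (exponents_of m)) (wE w).
Proof.
have H := letter_word_pbw scC zeta_neq0 q2_neqN1 (uq_E_far rep) (uq_E_adj rep) l_gt0.
apply: lin_span_sub (H _ w); last exact: small_E_root_vecXl.
move=> _ [m Hm ->]; apply: span_in; exact: pbw_exponents.
Qed.

Lemma small_pbw_words m : lin_span sc (fun y => exists w, y = wE w) (X m).
Proof.
apply: lin_span_sub (pbw_words scC zeta E m) => y [w _ ->].
by apply: span_in; exists w.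
Qed.

Section SocleLine.
Variables (M : lmodType R) (mu : 'I_n + 'I_n -> K) (w : M).
Hypotheses (w_neq0 : w != 0) (Ew : killed E w) (Tw : torus_weight sc T mu w).
Hypothesis E_line : forall x : M, killed E x -> exists c, x = sc c *: w.

Lemma extremal_socle : simple_module (modsocle M) /\
  exists w' : modsocle M, [/\ w' != 0, killed E w' & torus_weight sc T mu w'].
Proof.
have [|simS [w' Dw']] := @simple_socle _ M w w_neq0.
  move=> N [x Nx x_neq0].
  have [y [Ny y_neq0 Ey]] := killed_exists (P := fun x => x \in N)
    small_E_nilpotent (fun i x Nx => rpredZ (s := N) (E i) Nx) Nx x_neq0.
  have [c Dy] := E_line Ey; have c_neq0 : c != 0.
    by apply: contra_neq y_neq0 => c0; rewrite Dy c0 rmorph0 scale0r.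
  have -> : w = sc c^-1 *: y by rewrite Dy scalerA -rmorphM mulVf // rmorph1 scale1r.
  exact: (rpredZ (s := N)).
split=> //; exists w'; split.
- by apply: contra_neq w_neq0 => w'0; rewrite -Dw' w'0.
- by move=> i; apply: val_inj; rewrite /= -[RHS](Ew i) -Dw'.
- by move=> j; apply: val_inj; have := Tw j; rewrite -Dw'.
Qed.

End SocleLine.

Section HeadLine.
Variables (M : lmodType R) (mu : 'I_n -> K) (chi : M -> K).
Hypothesis mu_neq0 : forall i, mu i != 0.
Hypothesis chiD : forall x y, chi (x + y) = chi x + chi y.
Hypothesis chiZ : forall c x, chi (sc c *: x) = c * chi x.
Hypothesis chiE : forall i x, chi (E i *: x) = 0.
Hypothesis chiK : forall i x, chi (Kk i *: x) = mu i * chi x.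
Hypothesis chi_neq0 : exists x, chi x != 0.
Hypothesis chi_full : forall (P : M -> Prop) p, P 0 ->
  (forall x y, P x -> P y -> P (x + y)) -> (forall c x, P x -> P (sc c *: x)) ->
  (forall i x, P x -> P (E i *: x)) -> P p -> chi p != 0 -> forall x, P x.

Lemma extremal_head : simple_module (modhead M) /\
  exists w : modhead M, [/\ w != 0, killed F w & torus_weight sc T (torus_value mu) w].
Proof.
have chi0 : chi 0 = 0 by apply: (addrI (chi 0)); rewrite -chiD !addr0.
have [N0 N0P] : exists N0 : submodClosed M,
    forall x, x \in N0 <-> forall r, chi (r *: x) = 0.
  apply: submodule_exists.
  - by move=> r; rewrite scaler0.
  - by move=> x y Hx Hy r; rewrite scalerDr chiD Hx Hy addr0.
  - by move=> s x Hx r; rewrite scalerA.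
have N0_notin x : chi x != 0 -> x \notin N0.
  by apply: contraNN => /N0P/(_ 1); rewrite scale1r => ->.
have proper : exists x, x \notin N0 by case: chi_neq0 => x /N0_notin; exists x.
have full (N : submodClosed M) : (exists2 x, x \in N & x \notin N0) ->
    forall x, x \in N.
  move=> [x Nx N0x]; have [r Hr] : exists r, chi (r *: x) != 0.
    apply: contrapT => H; case/negP: N0x; apply/N0P => r; apply: contrapT => /eqP Hr.
    by apply: H; exists r.
  apply: (chi_full (p := r *: x)) => //.
  - exact: rpred0.
  - by move=> y z; apply: rpredD.
  - by move=> c y; apply: rpredZ.
  - by move=> i y; apply: rpredZ.
  - exact: rpredZ.
have simH := simple_head proper full; split=> //.
pose pi x : modhead M := quotmod_pi (radical_pred (M := M)) x.
pose chi' (x : modhead M) := chi (quotmod_repr x).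
have piK (x : modhead M) : exists y, x = pi y.
  by exists (quotmod_repr x); rewrite /pi quotmod_reprK.
have piZ r x : r *: pi x = pi (r *: x) := quotmod_scaleE _ r x.
have piD x y : pi x + pi y = pi (x + y) by rewrite /pi quotmod_piD.
(* chi descends to the head because the radical is N0, on which it vanishes. *)
have chi'E x : chi' (pi x) = chi x.
  have /quotmod_piE : pi (quotmod_repr (pi x)) = pi x by rewrite /pi quotmod_reprK.
  rewrite (radicalE proper full) => /N0P/(_ 1); rewrite scale1r => H.
  by rewrite /chi' -[quotmod_repr _](subrK x) chiD H add0r.
have [x0 x0_neq0] : exists x : modhead M, x != 0 by case: simH.
(* In the head the roles are exchanged: F raises and E lowers, so the extremal vector is killed by
   the F_i, and chi, vanishing on the images of the E_i, determines its weight. *)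
have [w [_ w_neq0 Fw]] := killed_exists (P := fun _ => True) small_F_nilpotent
  (fun _ _ _ => I) I x0_neq0.
exists w; split=> //.
have chiT j x : chi (T j *: x) = torus_value mu j * chi x.
  case: j => i /=; first exact: chiK.
  by rewrite -[in RHS](scale1r x) -(uq_KVr rep i) -scalerA chiK mulKf.
have chi'D x y : chi' (x + y) = chi' x + chi' y.
  by have [[x' ->] [y' ->]] := (piK x, piK y); rewrite piD !chi'E chiD.
have chi'Z c x : chi' (sc c *: x) = c * chi' x.
  by have [x' ->] := piK x; rewrite piZ !chi'E chiZ.
have chi'B i x : chi' (E i *: x) = 0.
  by have [x' ->] := piK x; rewrite piZ chi'E chiE.
have chi'T j x : chi' (T j *: x) = torus_value mu j * chi' x.
  by have [x' ->] := piK x; rewrite piZ !chi'E chiT.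
have chi'_neq0 : exists x, chi' x != 0.
  by case: chi_neq0 => x Hx; exists (pi x); rewrite chi'E.
have ind : forall P : R -> Prop,
    (forall c, P (sc c)) -> (forall x y, P x -> P y -> P (x - y)) ->
    (forall x y, P x -> P y -> P (x * y)) ->
    (forall i, P (F i)) -> (forall i, P (E i)) -> (forall j, P (T j)) ->
    forall x, P x.
  by move=> P Psc PB PM PF PE PT; apply: small_torus_ind.
exact: (extremal_line scC (torus_F_after scC zeta_neq0 rep)
  (torus_E_before scC zeta_neq0 rep) (torus_FE rep) ind simH chi'D chi'Z chi'B
  chi'T chi'_neq0 Fw).
Qed.

End HeadLine.

Lemma extremal_socle_isomorphic (M M' : lmodType R) mu :
  simple_module M -> simple_module M' ->
  (exists w : M, [/\ w != 0, killed E w & torus_weight sc T mu w]) ->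
  (exists w : M', [/\ w != 0, killed E w & torus_weight sc T mu w]) ->
  isomorphic_modules M M'.
Proof.
move=> simM simM' [w [nw kw tw]] [w' [nw' kw' tw']].
have ind : forall P : R -> Prop,
    (forall c, P (sc c)) -> (forall x y, P x -> P y -> P (x - y)) ->
    (forall x y, P x -> P y -> P (x * y)) ->
    (forall i, P (E i)) -> (forall i, P (F i)) -> (forall j, P (T j)) ->
    forall x, P x.
  by move=> P Psc PB PM PA PA' PT; apply: small_torus_ind.
exact: (extremal_isomorphic scC (torus_E_after scC zeta_neq0 rep)
  (torus_F_before scC zeta_neq0 rep) (torus_EF rep) ind small_F_nilpotent
  simM simM' nw nw' kw kw' tw tw').
Qed.

Lemma extremal_head_isomorphic (M M' : lmodType R) mu :
  simple_module M -> simple_module M' ->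
  (exists w : M, [/\ w != 0, killed F w & torus_weight sc T mu w]) ->
  (exists w : M', [/\ w != 0, killed F w & torus_weight sc T mu w]) ->
  isomorphic_modules M M'.
Proof.
move=> simM simM' [w [nw kw tw]] [w' [nw' kw' tw']].
have ind : forall P : R -> Prop,
    (forall c, P (sc c)) -> (forall x y, P x -> P y -> P (x - y)) ->
    (forall x y, P x -> P y -> P (x * y)) ->
    (forall i, P (F i)) -> (forall i, P (E i)) -> (forall j, P (T j)) ->
    forall x, P x.
  by move=> P Psc PB PM PA PA' PT; apply: small_torus_ind.
exact: (extremal_isomorphic scC (torus_F_after scC zeta_neq0 rep)
  (torus_E_before scC zeta_neq0 rep) (torus_FE rep) ind small_E_nilpotent
  simM simM' nw nw' kw kw' tw tw').
Qed.

End SmallModules.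

(** * The pairing of nabla(lambda) with V(lambda) *)

Section Duality.
Variables (n l : nat) (K : fieldType) (zeta : K) (lambda : 'I_n -> int).
Hypothesis zeta_neq0 : zeta != 0.
Hypothesis zeta_sub_neq0 : zeta - zeta^-1 != 0.
Hypothesis l_gt2 : (2 < l)%N.
Hypothesis qint_zeta_neq0 : forall k, (0 < k < l)%N -> qint zeta k != 0.
Hypothesis qfact_l : qfact zeta l = 0.
Hypothesis zqint_eq0 : forall r : 'Z_l, zqint zeta r = 0 -> r = 0.
Hypothesis zeta_modl : forall a : int,
  zeta ^+ nat_of_ord (a%:~R : 'Z_l) = zeta ^ a.

Local Notation R := (small_u n zeta).
Local Notation sc := (small_scalar n zeta).
Local Notation E := (@small_E n K zeta).
Local Notation Kk := (@small_K n K zeta).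
Local Notation T := (torus_letter Kk (@small_K' n K zeta)).
Local Notation wE := (letter_word E).
Local Notation D := (pbw_top_deg n l).
Local Notation X m := (pbw sc zeta (nat_gen E) n 0 m).
Local Notation Xtop := (X (fun _ _ => l.-1)).
Local Notation mi := (multiindex n l).
Local Notation top := (top_index n l).
Local Notation lam := (fun i => zeta ^ lambda i).

Let scC := @small_scalarC n K zeta.
Let rep := small_rep n zeta_neq0 zeta_sub_neq0.
Let l_gt1 : (1 < l)%N := ltnW l_gt2.
Let l_gt0 : (0 < l)%N := ltnW l_gt1.
Let nilE w : (D < size w)%N -> wE w = 0.
Proof. exact: small_E_nilpotent. Qed.

Let lam_neq0 i : lam i != 0. Proof. exact: expfz_neq0. Qed.

Lemma letter_word_rcons w i : wE (rcons w i) = wE w * E i.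
Proof. by rewrite -cats1 letter_word_cat letter_word1. Qed.

Variables (V : lmodType R) (u : mi -> V).
Hypothesis u_basis : forall x : V,
  exists! c : {ffun mi -> K}, x = \sum_m sc (c m) *: u m.
Hypothesis u_E : forall (i : 'I_n) m, E i *: u m =
  \sum_(i.+1 <= k < n.+1) sc (Defs.coefE zeta m i.+1 k) *: u (shiftE m i.+1 k).
Hypothesis u_K : forall (i : 'I_n) m,
  Kk i *: u m = sc (Defs.coefK zeta m (lambdaZ l lambda i) i.+1) *: u m.

Local Notation coord := (V_coord u_basis).

Lemma u_E0 i : E i *: u 0 = 0.
Proof.
rewrite u_E big1 // => k _.
by rewrite coefE_arg /argE !mcomp0 !subr0 addr0 zqint0 rmorph0 scale0r.
Qed.

Lemma u_K0 i : Kk i *: u 0 = sc (lam i) *: u 0.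
Proof. by rewrite u_K /Defs.coefK !mcomp0 mul0rn !subr0 addr0 zeta_modl. Qed.

Lemma u_neq0 m : u m != 0.
Proof.
apply/eqP => u0; have := V_coord_u u_basis m m.
by rewrite u0 V_coord0 eqxx => /eqP; rewrite eq_sym oner_eq0.
Qed.

Lemma V_socle : simple_module (modsocle V) /\ exists w : modsocle V,
  [/\ w != 0, killed E w & torus_weight sc T (torus_value lam) w].
Proof.
apply: (extremal_socle zeta_neq0 zeta_sub_neq0 l_gt2 qint_zeta_neq0 qfact_l (u_neq0 0)).
- exact: u_E0.
- apply: (torus_weightP zeta_neq0 zeta_sub_neq0) => //; exact: u_K0.
by move=> x /(V_E_invariant zqint_eq0 u_basis u_E)->; exists (coord x 0).
Qed.

(** The weight lambda + 2 rho, which modulo l is lambda - 2(l-1) rho, the weight of a form supported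
    on the top monomial. *)
Definition top_weight (i : 'I_n) : K := Defs.coefK zeta top (lambdaZ l lambda i) i.+1.

Lemma top_weight_neq0 i : top_weight i != 0.
Proof. exact: expf_neq0. Qed.

Lemma V_coordK_weight i x m :
  coord (Kk i *: x) m = Defs.coefK zeta m (lambdaZ l lambda i) i.+1 * coord x m.
Proof.
rewrite {1}(V_coordK u_basis x) scaler_sumr V_coord_sum (bigD1 m) //= big1 ?addr0.
  by rewrite scalerA -scC -scalerA u_K !V_coordZ V_coord_u eqxx mulr1 mulrC.
move=> m' nm; rewrite scalerA -scC -scalerA u_K !V_coordZ V_coord_u eq_sym.
by rewrite (negPf nm) !mulr0.
Qed.

Lemma V_top_full (Q : V -> Prop) p : Q 0 ->
  (forall x y, Q x -> Q y -> Q (x + y)) -> (forall c x, Q x -> Q (sc c *: x)) ->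
  (forall i x, Q (E i *: x)) -> Q p -> coord p top != 0 -> forall x, Q x.
Proof.
move=> Q0 QD QZ QE Qp p_neq0 x.
have Qu := V_E_coinvariant zqint_eq0 u_E Q0 QD QZ QE.
have Qsum (r : seq mi) (P : pred mi) c : (forall m, P m -> Q (u m)) ->
    Q (\sum_(m <- r | P m) sc (c m) *: u m).
  by move=> H; apply: (big_ind Q) => // m Pm; apply: QZ; apply: H.
have Qtop : Q (u top).
  set S := \sum_(m | m != top) sc (coord p m) *: u m.
  have QS : Q S by apply: Qsum.
  have Dp : sc (coord p top) *: u top = p + sc (-1) *: S.
    by rewrite rmorphN1 scaleN1r {2}(V_coordK u_basis p) (bigD1 top) //= addrK.
  have := QZ (coord p top)^-1 _ (QD _ _ Qp (QZ (-1) _ QS)).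
  by rewrite -Dp scalerA -rmorphM mulVf // rmorph1 scale1r.
rewrite (V_coordK u_basis x); apply: Qsum => m _.
by have [->//|] := eqVneq m top; apply: Qu.
Qed.

(** Nakayama's lemma for the nilpotent E-words: P contains p, and p spans V modulo the images of the
    E_i. Words longer than [D] vanish, and the induction shortens the word w for which w V lies in
    P. *)
Lemma V_full (P : V -> Prop) p : P 0 ->
  (forall x y, P x -> P y -> P (x + y)) -> (forall c x, P x -> P (sc c *: x)) ->
  (forall i x, P x -> P (E i *: x)) -> P p -> coord p top != 0 -> forall x, P x.
Proof.
move=> P0 PD PZ PE Pp p_neq0.
have Pw w x : P x -> P (wE w *: x).
  move=> Px; elim: w => [|i w IHw]; first by rewrite letter_word0 scale1r.
  by rewrite letter_word_cons -scalerA; apply: PE.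
suff H k : (k <= D.+1)%N -> forall w, size w = (D.+1 - k)%N -> forall x, P (wE w *: x).
  move=> x; have := H D.+1 (leqnn _) [::]; rewrite subnn letter_word0 => /(_ erefl x).
  by rewrite scale1r.
elim: k => [|k IHk] le_k w Dw x.
  by rewrite nilE ?scale0r // Dw subn0.
apply: (V_top_full (Q := fun x => P (wE w *: x)) (p := p)) => //.
- by rewrite scaler0.
- by move=> y z Py Pz; rewrite scalerDr; apply: PD.
- by move=> c y Py; rewrite scalerA -scC -scalerA; apply: PZ.
- move=> i y; rewrite scalerA -letter_word_rcons; apply: IHk; first by lia.
  by rewrite size_rcons Dw; lia.
exact: Pw.
Qed.

Lemma V_head : simple_module (modhead V) /\ exists w : modhead V,
  [/\ w != 0, killed (@small_F n K zeta) w
    & torus_weight sc T (torus_value top_weight) w].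
Proof.
apply: (extremal_head zeta_neq0 zeta_sub_neq0 l_gt2 qint_zeta_neq0 qfact_l
  top_weight_neq0 (chi := fun x => coord x top)).
- by move=> x y; apply: V_coordD.
- by move=> c x; apply: V_coordZ.
- by move=> i x; apply: V_coord_top.
- by move=> i x; apply: V_coordK_weight.
- by exists (u top); rewrite V_coord_u eqxx oner_neq0.
- exact: V_full.
Qed.

Variable L : lmodType (flat_u n zeta).
Hypothesis L_lambda : weight_module lambda L.
Local Notation N := (nabla L).
Local Notation phi := (nabla_functional L_lambda).

Definition dual (f : N) (v : V) := forall w, phi f (wE w) = coord (wE w *: v) 0.

(** The vectors with this property form an E-stable subspace; if nonzero it would contain a nonzero
    killed vector, which is a multiple of u_0 with coordinate 0. *)
Lemma V_words_separate v : (forall w, coord (wE w *: v) 0 = 0) -> v = 0.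
Proof.
move=> H; apply: contrapT => /eqP v_neq0.
have [y [Hy y_neq0 Ey]] := killed_exists
  (P := fun x => forall w, coord (wE w *: x) 0 = 0) nilE
  (fun i x Hx w => etrans (congr1 (fun y => coord y 0)
     (etrans (scalerA _ _ _) (congr1 ( *:%R^~ x) (esym (letter_word_rcons w i)))))
     (Hx (rcons w i))) H v_neq0.
have := Hy [::]; rewrite letter_word0 scale1r => y0.
case/eqP: y_neq0; rewrite (V_E_invariant zqint_eq0 u_basis u_E Ey) y0.
by rewrite rmorph0 scale0r.
Qed.

(** A square linear system: unknown coordinates and equations are both indexed by [multiindex n l],
    so injectivity, from [V_words_separate] and the PBW span, is enough. *)
Lemma V_pairing_surj (a : {ffun mi -> K}) :
  exists v : V, forall m, coord (X (exponents_of m) *: v) 0 = a m.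
Proof.
pose vec (c : {ffun mi -> K^o}) : V := \sum_m sc (c m) *: u m.
have vecZD b c d : vec (b *: c + d) = sc b *: vec c + vec d.
  rewrite /vec scaler_sumr -big_split; apply: eq_bigr => m _ /=.
  by rewrite !ffunE rmorphD scalerDl rmorphM scalerA.
pose t (c : {ffun mi -> K^o}) : {ffun mi -> K^o} :=
  [ffun m => coord (X (exponents_of m) *: vec c) 0].
have t_linear : linear t.
  move=> b c d; apply/ffunP => m; rewrite !ffunE vecZD scalerDr V_coordD.
  by rewrite scalerA -scC -scalerA V_coordZ.
pose tL : {linear {ffun mi -> K^o} -> {ffun mi -> K^o}} :=
  HB.pack t (GRing.isLinear.Build K {ffun mi -> K^o} {ffun mi -> K^o} *:%R t t_linear).
have ker_t : lker (linfun tL) == 0%VS.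
  apply/lker0P => c d; rewrite !lfunE => tcd.
  have {}tcd : t (c - d) = 0 by rewrite -[LHS]/(tL (c - d)) linearB tcd subrr.
  have v0 : vec (c - d) = 0.
    apply: V_words_separate => w.
    have := small_E_word_pbw zeta_neq0 zeta_sub_neq0 l_gt2 qint_zeta_neq0 qfact_l w.
    elim=> {w} [_ [m ->]||x y _ Hx _ Hy|b x _ Hx].
    - by have := congr1 (fun f : {ffun mi -> K^o} => f m) tcd; rewrite !ffunE.
    - by rewrite scale0r V_coord0.
    - by rewrite scalerDl V_coordD Hx Hy addr0.
    - by rewrite -scalerA V_coordZ Hx mulr0.
  apply/eqP; rewrite -subr_eq0; apply/eqP/ffunP => m.
  have := congr1 (fun f : {ffun mi -> K} => f m)
    (V_coord_uniq u_basis (erefl (vec (c - d)))).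
  by rewrite v0 V_coord0 => <-; rewrite ffunE.
have : (a : {ffun mi -> K^o}) \in limg (linfun tL).
  by rewrite lker0_limgf ?memvf.
case/memv_imgP => c _ Da; exists (vec c) => m.
by rewrite Da lfunE /= ffunE.
Qed.

Lemma dual_exists f : exists v, dual f v.
Proof.
have [v Hv] := V_pairing_surj [ffun m => phi f (X (exponents_of m))].
have P := nabla_verma L_lambda f.
exists v => w; have := small_E_word_pbw zeta_neq0 zeta_sub_neq0 l_gt2 qint_zeta_neq0 qfact_l w.
move: (wE w) => y; elim=> {y} [_ [m ->]||x y _ Hx _ Hy|b x _ Hx].
- by rewrite Hv ffunE.
- by rewrite (verma0 P) scale0r V_coord0.
- by rewrite (vermaD _ _ P) scalerDl V_coordD Hx Hy.
- by rewrite (vermaZ P) -scalerA V_coordZ Hx.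
Qed.

Lemma dualB f g v v' : dual f v -> dual g v' -> dual (f - g) (v - v').
Proof.
move=> Hf Hg w; rewrite nabla_functionalB Hf Hg scalerBr.
by rewrite -[Y in _ = coord (_ + Y) _]scaleN1r -(rmorphN1 sc) V_coordD V_coordZ mulN1r.
Qed.

Lemma dualZ c f v : dual f v -> dual (sc c *: f) (sc c *: v).
Proof.
move=> Hf w; rewrite nabla_functional_scale -scC (vermaZ (nabla_verma L_lambda f)) Hf.
by rewrite scalerA -scC -scalerA V_coordZ.
Qed.

Lemma dual0 : dual 0 0.
Proof.
have [v Hv] := dual_exists 0; have := dualB Hv Hv; rewrite !subrr; exact.
Qed.

Lemma dualD f g v v' : dual f v -> dual g v' -> dual (f + g) (v + v').
Proof.
move=> Hf Hg; have := dualB Hf (dualB dual0 Hg).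
by rewrite !sub0r !opprK.
Qed.

Lemma dualE i f v : dual f v -> dual (E i *: f) (E i *: v).
Proof.
by move=> Hf w; rewrite nabla_functional_scale scalerA -letter_word_rcons Hf.
Qed.

Lemma dualK i f v : dual f v -> dual (Kk i *: f) (Kk i *: v).
Proof.
have wK w : exists c, wE w * Kk i = sc c * Kk i * wE w.
  elim: w => [|j w [c IHw]].
    by exists 1; rewrite letter_word0 rmorph1 !mul1r mulr1.
  have [d Hd] : exists d, E j * Kk i = sc d * Kk i * E j :=
    torus_E_after scC zeta_neq0 rep j (inl i).
  exists (c * d); rewrite letter_word_cons -mulrA IHw rmorphM.
  have -> : E j * (sc c * Kk i * wE w) = sc c * (E j * Kk i) * wE w.
    by rewrite !mulrA -scC.
  by rewrite Hd !mulrA.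
move=> Hf w; have [c Hc] := wK w; have Pf := nabla_verma L_lambda f.
rewrite nabla_functional_scale scalerA Hc -mulrA (vermaZ Pf) (vermaK Pf) Hf.
by rewrite -!scalerA V_coordZ V_coordK_weight /Defs.coefK !mcomp0 mul0rn !subr0 addr0 zeta_modl.
Qed.

Lemma dual_eq0 f : dual f 0 -> f = 0.
Proof.
move=> Hf; apply: (nabla_functional_eq0 (L_lambda := L_lambda)) => y.
apply: (verma_eq0 zeta_neq0 zeta_sub_neq0 (nabla_verma L_lambda f)) => w.
by rewrite Hf scaler0 V_coord0.
Qed.

Lemma dual_fun f v v' : dual f v -> dual f v' -> v = v'.
Proof.
move=> Hv Hv'; apply/eqP; rewrite -subr_eq0; apply/eqP/V_words_separate => w.
by rewrite -(dualB Hv Hv') nabla_functionalB subrr.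
Qed.

Definition dual_vector (f : N) : V := projT1 (cid (dual_exists f)).
Lemma dual_vectorP f : dual f (dual_vector f).
Proof. exact: projT2 (cid (dual_exists f)). Qed.
Lemma dual_vector_eq f v : dual f v -> dual_vector f = v.
Proof. exact: dual_fun (dual_vectorP f). Qed.

Lemma nabla_top_neq0 : exists f : N, coord (dual_vector f) top != 0.
Proof.
pose theta := small_functional lambda l zeta_neq0.
have P : verma_functional lambda theta.
  split; [exact: small_functionalB|exact: small_functionalZ|exact: small_functionalF|].
  exact: small_functionalK.
have [f Hf] := verma_nabla L_lambda P; exists f; apply/eqP => v0.
have : theta Xtop != 0 by apply: small_functional_top.
case/eqP; rewrite -Hf; set v := dual_vector f in v0.
have -> : phi f Xtop = coord (Xtop *: v) 0.
  have := small_pbw_words n zeta (fun _ _ => l.-1); move: Xtop => y.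
  have Pf := nabla_verma L_lambda f.
  elim=> {y} [_ [w ->]||x y _ Hx _ Hy|b x _ Hx].
  - exact: dual_vectorP.
  - by rewrite (verma0 Pf) scale0r V_coord0.
  - by rewrite (vermaD _ _ Pf) scalerDl V_coordD Hx Hy.
  - by rewrite (vermaZ Pf) -scalerA V_coordZ Hx.
(* Since X_top E_i = 0, this form vanishes on the images of the E_i, hence on every u_m except the
   top one. *)
have Qu : forall m, m != top -> coord (Xtop *: u m) 0 = 0.
  apply: (V_E_coinvariant (Q := fun x => coord (Xtop *: x) 0 = 0) zqint_eq0 u_E).
  - by rewrite scaler0 V_coord0.
  - by move=> x y Hx Hy; rewrite scalerDr V_coordD Hx Hy addr0.
  - by move=> c x Hx; rewrite scalerA -scC -scalerA V_coordZ Hx mulr0.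
  - move=> i x; rewrite scalerA small_E_topM ?scale0r ?V_coord0 //.
rewrite (V_coordK u_basis v) scaler_sumr V_coord_sum big1 // => m _.
rewrite scalerA -scC -scalerA V_coordZ; have [->|nm] := eqVneq m top.
  by rewrite v0 mul0r.
by rewrite Qu // mulr0.
Qed.

(** The vectors dual to members of P form an E-stable subspace to which [V_full] applies; as [dual]
    is injective, nothing of nabla(lambda) lies outside P. *)
Lemma nabla_full (P : N -> Prop) p : P 0 ->
  (forall x y, P x -> P y -> P (x + y)) -> (forall c x, P x -> P (sc c *: x)) ->
  (forall i x, P x -> P (E i *: x)) -> P p -> coord (dual_vector p) top != 0 ->
  forall x, P x.
Proof.
move=> P0 PD PZ PE Pp p_neq0 x.
have [y Py Hy] : exists2 y, P y & dual y (dual_vector x).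
  apply: (V_full (P := fun v => exists2 y, P y & dual y v) (p := dual_vector p)) => //.
  - by exists 0; last exact: dual0.
  - by move=> v v' [y Py Hy] [y' Py' Hy']; exists (y + y'); [exact: PD|exact: dualD].
  - by move=> c v [y Py Hy]; exists (sc c *: y); [exact: PZ|exact: dualZ].
  - by move=> i v [y Py Hy]; exists (E i *: y); [exact: PE|exact: dualE].
  by exists p; last exact: dual_vectorP.
have xy0 : x - y = 0.
  by apply: dual_eq0; have := dualB (dual_vectorP x) Hy; rewrite subrr.
by have/eqP := xy0; rewrite subr_eq0 => /eqP->.
Qed.

Lemma nabla_head : simple_module (modhead N) /\ exists w : modhead N,
  [/\ w != 0, killed (@small_F n K zeta) w
    & torus_weight sc T (torus_value top_weight) w].
Proof.
apply: (extremal_head zeta_neq0 zeta_sub_neq0 l_gt2 qint_zeta_neq0 qfact_l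
  top_weight_neq0 (chi := fun f => coord (dual_vector f) top)).
- move=> f g; rewrite (dual_vector_eq (dualD (dual_vectorP f) (dual_vectorP g))).
  exact: V_coordD.
- move=> c f; rewrite (dual_vector_eq (dualZ c (dual_vectorP f))).
  exact: V_coordZ.
- move=> i f; rewrite (dual_vector_eq (dualE i (dual_vectorP f))).
  exact: V_coord_top.
- move=> i f; rewrite (dual_vector_eq (dualK i (dual_vectorP f))).
  exact: V_coordK_weight.
- exact: nabla_top_neq0.
- exact: nabla_full.
Qed.

(** The value of f at w E_i is the value of E_i f at w, so only the empty word can give a nonzero
    value. *)
Lemma nabla_killed_eq0 (f : N) : killed E f -> phi f 1 = 0 -> f = 0.
Proof.
move=> Ef f1; apply: (nabla_functional_eq0 (L_lambda := L_lambda)) => y.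
apply: (verma_eq0 zeta_neq0 zeta_sub_neq0 (nabla_verma L_lambda f)) => w.
case/lastP: w => [|w i]; first by rewrite letter_word0.
rewrite letter_word_rcons -nabla_functional_scale Ef.
by rewrite -(subrr (0 : N)) nabla_functionalB subrr.
Qed.

Lemma nabla_killedB (f g : N) c : killed E f -> killed E g ->
  phi f 1 = c * phi g 1 -> f = sc c *: g.
Proof.
move=> Ef Eg H; apply/eqP; rewrite -subr_eq0; apply/eqP/nabla_killed_eq0.
  by move=> i; rewrite scalerBr Ef scalerA -scC -scalerA Eg scaler0 subrr.
rewrite nabla_functionalB nabla_functional_scale -scC.
by rewrite (vermaZ (nabla_verma L_lambda g)) H subrr.
Qed.

Lemma nabla_socle : simple_module (modsocle N) /\ exists w : modsocle N,
  [/\ w != 0, killed E w & torus_weight sc T (torus_value lam) w].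
Proof.
have [f f_top] := nabla_top_neq0.
have f_neq0 : f != 0.
  by apply: contra_neq f_top => ->; rewrite (dual_vector_eq dual0) V_coord0.
have [f0 [_ f0_neq0 Ef0]] := killed_exists (P := fun _ => True) nilE
  (fun _ _ _ => I) I f_neq0.
have f01 : phi f0 1 != 0 by apply: contra_neq f0_neq0 => /nabla_killed_eq0->.
apply: (extremal_socle zeta_neq0 zeta_sub_neq0 l_gt2 qint_zeta_neq0 qfact_l f0_neq0 Ef0).
- apply: (torus_weightP zeta_neq0 zeta_sub_neq0) => // i.
  apply: nabla_killedB => //.
    have := killed_torus (torus_E_after scC zeta_neq0 rep) [:: inl i] Ef0.
    by rewrite letter_word1.
  rewrite nabla_functional_scale mul1r -[Y in phi _ Y]mulr1.
  exact: (vermaK (nabla_verma L_lambda f0)).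
move=> x Ex; exists (phi x 1 / phi f0 1); apply: nabla_killedB => //.
by rewrite divfK.
Qed.

Theorem V_nabla_socle_head :
  [/\ simple_module (modsocle V), simple_module (modsocle N)
    & isomorphic_modules (modsocle V) (modsocle N)] /\
  [/\ simple_module (modhead V), simple_module (modhead N)
    & isomorphic_modules (modhead V) (modhead N)].
Proof.
have [[sV wV] [sN wN]] := (V_socle, nabla_socle).
have [[hV xV] [hN xN]] := (V_head, nabla_head).
split; split=> //.
  exact: (extremal_socle_isomorphic zeta_neq0 zeta_sub_neq0 l_gt2 qint_zeta_neq0 qfact_l sV sN wV wN).
exact: (extremal_head_isomorphic zeta_neq0 zeta_sub_neq0 l_gt2 qint_zeta_neq0 qfact_l hV hN xV xN).
Qed.

End Duality.

(** * Roots of unity *)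

Section CyclotomicOrder.
Variables (l : nat) (l_gt0 : (0 < l)%N).
Local Notation h := (cyclotomic_rat l).
Local Notation zeta := (cyc_zeta l_gt0).

(** Over Q the cyclotomic polynomial is the minimal polynomial of a primitive complex root z, so it
    divides X^k - 1 exactly when z^k = 1. *)
Lemma cyc_zetaX_eq1 k : (zeta ^+ k == 1) = (l %| k)%N.
Proof.
have [[h_gt1 _] h_monic] := cyclotomic_rat_irreducible l_gt0.
have mkh : mk_monic h = h by rewrite /mk_monic h_gt1 h_monic.
have [z prim_z] := C_prim_root_exists l_gt0.
have -> : (zeta ^+ k == 1) = (h %| 'X^k - 1)%R.
  rewrite -subr_eq0 [zeta ^+ k - 1](_ : _ = in_qpoly h ('X^k - 1)); last first.
    by rewrite rmorphB rmorph1 rmorphXn.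
  rewrite -(inj_eq val_inj) /= mkh /dvdp.
  by rewrite (Pdiv.IdomainMonic.modpE h_monic).
have Dh : map_poly ratr h = cyclotomic z l.
  rewrite -(Cintr_Cyclotomic prim_z) /cyclotomic_rat -map_poly_comp.
  by apply: eq_map_poly => a /=; rewrite ratr_int.
have dvm p q := dvdp_map (ratr : {rmorphism rat -> algC}) p q.
rewrite -(dvm h) Dh.
rewrite rmorphB rmorph1 /= map_polyXn.
apply/idP/idP => [dv|/dvdnP[d ->]].
  rewrite (prim_order_dvd prim_z).
  have : root ('X^k - 1) z.
    by rewrite -dvdp_XsubCl; apply: dvdp_trans dv; rewrite dvdp_XsubCl root_cyclotomic.
  by rewrite /root !hornerE subr_eq0.
rewrite -(minCpoly_cyclotomic prim_z).
have [p [-> _] dv_p] := minCpolyP z.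
rewrite (_ : _ - 1 = map_poly ratr ('X^(d * l) - 1 : {poly rat})); last first.
  by rewrite rmorphB rmorph1 /= map_polyXn.
rewrite dvm -dv_p rmorphB rmorph1 /= map_polyXn /root !hornerE subr_eq0.
by rewrite mulnC exprM (prim_expr_order prim_z) expr1n.
Qed.

End CyclotomicOrder.

Section RootOfUnity.
Variables (K : fieldType) (zeta : K) (l : nat).
Hypothesis l_gt2 : (2 < l)%N.
Hypothesis l_odd : odd l.
Hypothesis zeta_order : forall k, (zeta ^+ k == 1) = (l %| k)%N.

Let zetaXl : zeta ^+ l = 1. Proof. by apply/eqP; rewrite zeta_order. Qed.

Lemma root_neq0 : zeta != 0.
Proof.
apply/eqP => z0; have := zetaXl; rewrite z0 expr0n eqn0Ngt (ltnW (ltnW l_gt2)) => /eqP.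
by rewrite eq_sym oner_eq0.
Qed.

(** Oddness of l enters here: the square of zeta still has order l. *)
Let double k : zeta ^+ k - zeta ^- k = 0 -> (l %| k)%N.
Proof.
move=> /eqP; rewrite subr_eq0 => /eqP H.
have : zeta ^+ (2 * k) == 1.
  by rewrite mul2n -addnn exprD {1}H mulVf // expf_neq0 // root_neq0.
by rewrite zeta_order Gauss_dvdr // coprime_sym prime_coprime // dvdn2 l_odd.
Qed.

Lemma root_sub_neq0 : zeta - zeta^-1 != 0.
Proof. by apply/eqP => H; have := @double 1%N H; rewrite dvdn1 => /eqP; lia. Qed.

Lemma qint_root_neq0 k : (0 < k < l)%N -> qint zeta k != 0.
Proof.
move=> Hk; rewrite /qint mulf_neq0 ?invr_eq0 ?root_sub_neq0 //.
by apply/eqP => /double/dvdn_leq; lia.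
Qed.

Lemma qfact_root : qfact zeta l = 0.
Proof.
rewrite -(prednK (ltnW (ltnW l_gt2))) qfactS (prednK (ltnW (ltnW l_gt2))).
by rewrite [qint _ l]/qint zetaXl invr1 subrr mul0r mulr0.
Qed.

Lemma zqint_root_eq0 (r : 'Z_l) : zqint zeta r = 0 -> r = 0.
Proof.
move=> H; apply: val_inj => /=; apply/eqP; rewrite -leqn0 leqNgt; apply/negP => r_gt0.
have := qint_root_neq0 (k := r); rewrite r_gt0 -[qint _ _]/(zqint zeta r) H eqxx.
by have := ltn_ord r; rewrite [X in (_ < X)%N]Zp_cast ?(ltnW l_gt2) // => -> /(_ isT).
Qed.

Lemma root_modl (a : int) : zeta ^+ nat_of_ord (a%:~R : 'Z_l) = zeta ^ a.
Proof.
have l_gt1 := ltnW l_gt2; case: a => k.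
  by rewrite -[_%:~R]/(k%:R) val_Zp_nat // expr_mod.
set r : 'Z_l := _%:~R; have Dr : r + k.+1%:R = 0 by rewrite /r NegzE mulrNz addNr.
have : (val r + k.+1)%:R = 0 :> 'Z_l by rewrite natrD natr_Zp.
move/(congr1 (fun x : 'Z_l => nat_of_ord x)); rewrite val_Zp_nat // => /eqP dv.
have : zeta ^+ (r + k.+1) == 1 by rewrite zeta_order.
rewrite exprD -[zeta ^ _]/(zeta ^- k.+1) => /eqP H.
by apply: (mulIf (expf_neq0 k.+1 root_neq0)); rewrite H mulVf // expf_neq0 // root_neq0.
Qed.

End RootOfUnity.

Theorem mainTheorem5 (n l : nat) (n_gt0 : (0 < n)%N) (l_gt2 : (2 < l)%N)
    (l_odd : odd l) (lambda : 'I_n -> int)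
    (L : lmodType (flat_u n (cyc_zeta (ltnW (ltnW l_gt2)))))
    (L_lambda : weight_module lambda L)
    (V : lmodType (small_u n (cyc_zeta (ltnW (ltnW l_gt2)))))
    (V_lambda : V_module l lambda V) :
  [/\ simple_module (modsocle V), simple_module (modsocle (nabla L))
    & isomorphic_modules (modsocle V) (modsocle (nabla L))] /\
  [/\ simple_module (modhead V), simple_module (modhead (nabla L))
    & isomorphic_modules (modhead V) (modhead (nabla L))].
Proof.
have order := cyc_zetaX_eq1 (ltnW (ltnW l_gt2)).
have [u [u_basis u_E _ u_K]] := V_lambda.
exact: (V_nabla_socle_head (root_neq0 l_gt2 order) (root_sub_neq0 l_gt2 l_odd order)
  l_gt2 (qint_root_neq0 l_gt2 l_odd order) (qfact_root l_gt2 order)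
  (zqint_root_eq0 l_gt2 l_odd order) (root_modl l_gt2 order) u_basis u_E u_K L_lambda).
Qed.
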